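(* Let $(w(t))_{t\ge0}$ be a Brownian motion on the quaternionic hyperbolic space $\mathbb{H}H^n$ started at $0$, with quaternionic stochastic area process $\mathfrak a(t)$, and let $(\Theta(t))_{t\ge0}$ be the $\mathbf{SU}(2)$-valued solution, started from the identity, of the Stratonovich stochastic differential equation $$d\Theta(t)=\Theta(t)\circ d\mathfrak a(t),$$ where $\mathfrak a$ is viewed as an element of the Lie algebra $\mathfrak{su}(2)$. Then the $\mathbf{AdS}^{4n+3}(\mathbb{H})$-valued diffusion process $$X(t)=\frac{\Theta(t)}{\sqrt{1-|w(t)|^2}}\,\big(w(t),1\big),\qquad t\ge0,$$ is the horizontal stochastic lift at the north pole of $(w(t))_{t\ge0}$ by the submersion $\mathbf{AdS}^{4n+3}(\mathbb{H})\to\mathbb{H}H^n$.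
   Context: $n\ge1$. $\mathbb{H}$ is the field of quaternions with units $I,J,K$ (realized as $2\times2$ matrices, so that $\mathbf{SU}(2)$ is the group of unit quaternions and $\mathfrak{su}(2)\simeq\mathbb{R}^3$ is the space of imaginary quaternions $xI+yJ+zK$, with $I,J,K$ as orthonormal basis). $\mathbf{AdS}^{4n+3}(\mathbb{H})=\{q\in\mathbb{H}^{n+1}:\ \sum_{k=1}^n|q_k|^2-|q_{n+1}|^2=-1\}$ with the pseudo-Riemannian metric induced by this quadratic form. $\mathbf{SU}(2)$ acts on it isometrically by left multiplication, and the quotient is the quaternionic hyperbolic space $\mathbb{H}H^n$, identified with the unit ball $\{w\in\mathbb{H}^n:|w|<1\}$ by the inhomogeneous coordinates $w_i=q_{n+1}^{-1}q_i$, $1\le i\le n$, and equipped with the Riemannian metric making the projection $\pi:q\mapsto w$ a pseudo-Riemannian submersion, i.e. $\frac{\sum_j|dw_j|^2}{1-|w|^2}+\frac{|\sum_j dw_j\overline{w_j}|^2}{(1-|w|^2)^2}$. $0$ is the point with $w_1=\dots=w_n=0$; Brownian motion on $\mathbb{H}H^n$ has generator $\frac12\Delta_{\mathbb{H}H^n}$ (half the Laplace–Beltrami operator). The quaternionic stochastic area process of $(w(t))$ is the $\mathfrak{su}(2)\simeq\mathbb{R}^3$-valued process $$\mathfrak a(t)=\frac12\sum_{j=1}^n\int_0^t\frac{dw_j(s)\overline{w_j}(s)-w_j(s)d\overline{w_j}(s)}{1-|w(s)|^2},$$ the integrals being in the Stratonovich (equivalently Itô) sense. The north pole is $(0,\dots,0,1)\in\mathbb{H}^{n+1}$.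 The horizontal distribution of $\pi$ is the orthogonal complement of the tangent spaces to the fibers, equivalently the kernel of the $\mathfrak{su}(2)$-valued one-form $\alpha=\frac12\big(\sum_{i=1}^n(dq_i\overline{q_i}-q_id\overline{q_i})-(dq_{n+1}\overline{q_{n+1}}-q_{n+1}d\overline{q_{n+1}})\big)$. The horizontal stochastic lift of $w$ at the north pole is the semimartingale $X$ on $\mathbf{AdS}^{4n+3}(\mathbb{H})$ started at the north pole with $\pi(X(t))=w(t)$ and $\int_{X[0,t]}\alpha=0$ (Stratonovich) for all $t\ge0$. *)

(* Defs.v *)
From HB Require Import structures.
From mathcomp Require Import all_boot all_order all_algebra.
From mathcomp Require Import all_classical all_reals all_analysis.
From mathcomp Require Import ring lra.

Set Implicit Arguments.
Unset Strict Implicit.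
Unset Printing Implicit Defensive.
Import Order.TTheory GRing.Theory Num.Theory.
Import numFieldNormedType.Exports.

Local Open Scope classical_set_scope.
Local Open Scope ring_scope.

(* [Quat a b c d] is a + b I + c J + d K. *)
Record quat (R : realType) := Quat { qre : R; qi : R; qj : R; qk : R }.

Section QuaternionRing.
Variable R : realType.
Implicit Types p q r : quat R.

Definition quat_tuple q := (qre q, qi q, qj q, qk q).
Definition tuple_quat (x : R * R * R * R) := Quat x.1.1.1 x.1.1.2 x.1.2 x.2.
Lemma quat_tupleK : cancel quat_tuple tuple_quat. Proof. by case. Qed.
HB.instance Definition _ := Choice.copy (quat R) (can_type quat_tupleK).

Definition qzero : quat R := Quat 0 0 0 0.
Definition qone : quat R := Quat 1 0 0 0.
Definition qopp q := Quat (- qre q) (- qi q) (- qj q) (- qk q).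
Definition qadd p q :=
  Quat (qre p + qre q) (qi p + qi q) (qj p + qj q) (qk p + qk q).
Definition qmul p q := Quat
  (qre p * qre q - qi p * qi q - qj p * qj q - qk p * qk q)
  (qre p * qi q + qi p * qre q + qj p * qk q - qk p * qj q)
  (qre p * qj q - qi p * qk q + qj p * qre q + qk p * qi q)
  (qre p * qk q + qi p * qj q - qj p * qi q + qk p * qre q).
Definition qscale (a : R) q := Quat (a * qre q) (a * qi q) (a * qj q) (a * qk q).

Definition qconj q := Quat (qre q) (- qi q) (- qj q) (- qk q).
Definition qnormsq q := qre q ^+ 2 + qi q ^+ 2 + qj q ^+ 2 + qk q ^+ 2.
Definition qnorm q := Num.sqrt (qnormsq q).
Definition qinv q := qscale (qnormsq q)^-1 (qconj q).

Ltac quat_ring := move=> *; rewrite /qadd /qopp /qmul /qscale /qzero /qone /=; f_equal => /=; ring.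

Lemma qaddA : associative qadd. Proof. quat_ring. Qed.
Lemma qaddC : commutative qadd. Proof. quat_ring. Qed.
Lemma qadd0 : left_id qzero qadd. Proof. case=> *; quat_ring. Qed.
Lemma qaddN : left_inverse qzero qopp qadd. Proof. case=> *; quat_ring. Qed.
HB.instance Definition _ := GRing.isZmodule.Build (quat R) qaddA qaddC qadd0 qaddN.

Lemma qmulA : associative qmul. Proof. quat_ring. Qed.
Lemma qmul1l : left_id qone qmul. Proof. case=> *; quat_ring. Qed.
Lemma qmul1r : right_id qone qmul. Proof. case=> *; quat_ring. Qed.
Lemma qmulDl : left_distributive qmul qadd. Proof. quat_ring. Qed.
Lemma qmulDr : right_distributive qmul qadd. Proof. quat_ring. Qed.
Lemma qone_neq0 : qone != qzero.
Proof. by apply/eqP => -[/eqP]; rewrite oner_eq0. Qed.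
HB.instance Definition _ := GRing.Zmodule_isNzRing.Build (quat R)
  qmulA qmul1l qmul1r qmulDl qmulDr qone_neq0.

Lemma qscaleA a b q : qscale a (qscale b q) = qscale (a * b) q.
Proof. quat_ring. Qed.
Lemma qscale1 : left_id 1 qscale. Proof. case=> *; quat_ring. Qed.
Lemma qscaleDr : right_distributive qscale qadd. Proof. quat_ring. Qed.
Lemma qscaleDl q : {morph qscale^~ q : a b / a + b >-> qadd a b}. Proof. quat_ring. Qed.
HB.instance Definition _ := GRing.Zmodule_isLmodule.Build R (quat R)
  qscaleA qscale1 qscaleDr qscaleDl.

Lemma qnormsq_eq0 q : (qnormsq q == 0) = (q == 0).
Proof.
case: q => a b c d; rewrite /qnormsq /= !paddr_eq0 ?addr_ge0 ?sqr_ge0 //.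
rewrite !sqrf_eq0 -!andbA; apply/idP/eqP => [/and4P[]|[-> -> -> ->]].
  by do 4![move=> /eqP->].
by rewrite eqxx.
Qed.
Lemma qmulVq : {in [pred q : quat R | q != 0], left_inverse 1 qinv *%R}.
Proof.
move=> q; rewrite inE -qnormsq_eq0 /qnormsq => q0; change (qmul (qinv q) q = qone).
by rewrite /qmul /qone /qinv /qnormsq /qscale /=; f_equal; field.
Qed.
Lemma qmulqV : {in [pred q : quat R | q != 0], right_inverse 1 qinv *%R}.
Proof.
move=> q; rewrite inE -qnormsq_eq0 /qnormsq => q0; change (qmul q (qinv q) = qone).
by rewrite /qmul /qone /qinv /qnormsq /qscale /=; f_equal; field.
Qed.
Lemma qunitP p q : q * p = 1 /\ p * q = 1 -> p != 0.
Proof. by move=> [qp _]; apply: contra_eq_neq qp => ->; rewrite mulr0 eq_sym oner_neq0. Qed.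
Lemma qinv0 : {in [predC [pred q : quat R | q != 0]], qinv =1 id}.
Proof.
move=> q; rewrite !inE negbK => /eqP ->.
by change (qinv qzero = qzero); rewrite /qinv /qscale /qzero /=; f_equal; ring.
Qed.
HB.instance Definition _ := GRing.NzRing_hasMulInverse.Build (quat R)
  qmulVq qmulqV qunitP qinv0.

Definition qcoord (k : 'I_4) q : R := tnth [tuple qre q; qi q; qj q; qk q] k.

End QuaternionRing.

Section Geometry.
Variables (R : realType) (n : nat).

Definition rnormsq m (w : 'rV[quat R]_m) : R := \sum_j qnormsq (w 0 j).

(* H^{n+1} is 'rV_(n + 1): q_1, ..., q_n come first and q_{n+1} last. *)
Definition qinit (q : 'rV[quat R]_(n + 1)) (i : 'I_n) : quat R := q 0 (lshift 1 i).
Definition qlast (q : 'rV[quat R]_(n + 1)) : quat R := q 0 (rshift n 0).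

Definition AdS : set 'rV[quat R]_(n + 1) :=
  [set q | \sum_i qnormsq (qinit q i) - qnormsq (qlast q) = -1].

Definition north_pole : 'rV[quat R]_(n + 1) := row_mx 0 1%:M.

Definition hyp_proj (q : 'rV[quat R]_(n + 1)) : 'rV[quat R]_n :=
  \row_i ((qlast q)^-1 * qinit q i).

(* Forms take the base point first and the tangent vector second. *)
Definition contact_form (q u : 'rV[quat R]_(n + 1)) : quat R :=
  2^-1 *: (\sum_i (qinit u i * qconj (qinit q i) - qinit q i * qconj (qinit u i))
           - (qlast u * qconj (qlast q) - qlast q * qconj (qlast u))).

Definition area_form (w u : 'rV[quat R]_n) : quat R :=
  2^-1 *: \sum_j ((1 - rnormsq w)^-1 *:
                    (u 0 j * qconj (w 0 j) - w 0 j * qconj (u 0 j))).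

Definition real_coords (w : 'rV[quat R]_n) : 'rV[R]_(n * 4) :=
  mxvec (\matrix_(j < n, k < 4) qcoord k (w 0 j)).
Definition quat_coords (x : 'rV[R]_(n * 4)) : 'rV[quat R]_n :=
  \row_j let y := row j (vec_mx x) in Quat (y 0 0) (y 0 1) (y 0 2) (y 0 3).

Definition basis_vec (p : 'I_(n * 4)) : 'rV[R]_(n * 4) := delta_mx 0 p.

Definition hyp_metric (w u : 'rV[quat R]_n) : R :=
  rnormsq u / (1 - rnormsq w)
  + qnormsq (\sum_j u 0 j * qconj (w 0 j)) / (1 - rnormsq w) ^+ 2.

(* Gram matrix of the metric, obtained from the quadratic form by polarization. *)
Definition hyp_gram (x : 'rV[R]_(n * 4)) : 'M[R]_(n * 4) :=
  let Q u := hyp_metric (quat_coords x) (quat_coords u) in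
  \matrix_(p, q) ((Q (basis_vec p + basis_vec q) - Q (basis_vec p)
                   - Q (basis_vec q)) / 2).

Definition laplace_beltrami (f : 'rV[R]_(n * 4) -> R) (x : 'rV[R]_(n * 4)) : R :=
  let vol y := Num.sqrt (\det (hyp_gram y)) in
  let grad p y := \sum_q invmx (hyp_gram y) p q * 'D_(basis_vec q) f y in
  (vol x)^-1 * \sum_p 'D_(basis_vec p) (fun y => vol y * grad p y) x.

Definition iter_partial (l : seq 'I_(n * 4)) (f : 'rV[R]_(n * 4) -> R) :=
  foldr (fun p g x => 'D_(basis_vec p) g x) f l.

Definition smooth (f : 'rV[R]_(n * 4) -> R) := forall l,
  continuous (iter_partial l f) /\
  forall x p, derivable (iter_partial l f) x (basis_vec p).

Definition ball_supported (f : 'rV[R]_(n * 4) -> R) :=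
  exists2 r : R, r < 1 & forall x, r <= rnormsq (quat_coords x) -> f x = 0.

End Geometry.

(* A process is a function of time and outcome; only its values at times
   t >= 0 matter. *)
Section Processes.
Context d (Omega : measurableType d) (R : realType) (P : probability Omega R).
Implicit Types (F : R -> set (set Omega)).

Definition filtration F :=
  [/\ forall t, 0 <= t -> sigma_algebra setT (F t),
      forall t, 0 <= t -> F t `<=` measurable &
      forall s t, 0 <= s -> s <= t -> F s `<=` F t].

Definition sub_measurable (G : set (set Omega)) (Y : Omega -> R) :=
  forall B : set R, measurable B -> G (Y @^-1` B).

Definition adapted F (X : R -> Omega -> R) :=
  forall t, 0 <= t -> sub_measurable (F t) (X t).

Definition continuous_paths (X : R -> Omega -> R) :=
  forall omega, {within `[0, +oo[, continuous (X ^~ omega)}.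

Definition martingale F (M : R -> Omega -> R) :=
  [/\ adapted F M,
      forall t, 0 <= t -> P.-integrable setT (EFin \o M t) &
      forall s t A, 0 <= s -> s <= t -> F s A ->
        \int[P]_(omega in A) M t omega = \int[P]_(omega in A) M s omega].

(* The points of the partition a :: s of [a, b]. *)
Definition pt (a b : R) (s : seq R) (i : nat) : R := nth b (a :: s) i.

Definition mesh_lt (a b : R) (s : seq R) (delta : R) :=
  forall i, (i < size s)%N -> pt a b s i.+1 - pt a b s i < delta.

(* Continuous semimartingales in the sense of Bichteler and Protter: adapted
   continuous processes for which the elementary stochastic integral
   H |-> \sum_i H_i (X_{t_(i+1)} - X_{t_i}) is continuous from the uniform
   topology on elementary predictable integrands to convergence in probability.
   As the paths are continuous, integrands with deterministic times suffice. *)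
Definition semimartingale F (X : R -> Omega -> R) :=
  [/\ adapted F X, continuous_paths X &
      forall t, 0 <= t -> forall eps : R, 0 < eps ->
      exists2 delta : R, 0 < delta &
        forall s, itv_partition 0 t s ->
        forall H : nat -> Omega -> R,
          (forall i, (i < size s)%N -> sub_measurable (F (pt 0 t s i)) (H i)) ->
          (forall i omega, `|H i omega| <= delta) ->
          (P [set omega | (eps <= `|\sum_(0 <= i < size s) H i omega *
                (X (pt 0 t s i.+1) omega - X (pt 0 t s i) omega)|)%R]
            <= eps%:E)%E].

Definition qadapted F (Y : R -> Omega -> quat R) :=
  forall k, adapted F (fun t omega => qcoord k (Y t omega)).
Definition qcontinuous_paths (Y : R -> Omega -> quat R) :=
  forall k, continuous_paths (fun t omega => qcoord k (Y t omega)).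
Definition qsemimartingale F (Y : R -> Omega -> quat R) :=
  forall k, semimartingale F (fun t omega => qcoord k (Y t omega)).
Definition rsemimartingale F m (X : R -> Omega -> 'rV[quat R]_m) :=
  forall j, qsemimartingale F (fun t omega => X t omega 0 j).

(* The quaternion-valued one-form beta on V, given as base point then vector,
   integrated along the path x by the trapezoidal rule. *)
Definition trapezoid_sum (V : zmodType) (beta : V -> V -> quat R) (x : R -> V)
    (a b : R) (s : seq R) : quat R :=
  \sum_(0 <= i < size s)
    (let p := x (pt a b s i) in let q := x (pt a b s i.+1) in
     2^-1 *: (beta p (q - p) + beta q (q - p))).

(* S is the process of Stratonovich integrals of beta along X[0, t], in
   Fisk and Stratonovich's definition: S t is the limit in probability of the
   trapezoidal sums as the mesh of the partition of [0, t] tends to 0. *)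
Definition stratonovich_integral (V : zmodType) (beta : V -> V -> quat R)
    (X : R -> Omega -> V) (S : R -> Omega -> quat R) :=
  forall t, 0 <= t -> forall eps : R, 0 < eps ->
  exists2 delta : R, 0 < delta &
    forall s, itv_partition 0 t s -> mesh_lt 0 t s delta ->
      (P [set omega | (eps <= qnorm
            (trapezoid_sum beta (X ^~ omega) 0 t s - S t omega))%R]
        <= eps%:E)%E.

Variable n : nat.

(* Non-explosive solution, in the global chart, of the martingale problem for
   half the Laplace-Beltrami operator. *)
Definition brownian_motion_HH F (w : R -> Omega -> 'rV[quat R]_n) :=
  [/\ forall t omega, 0 <= t -> rnormsq (w t omega) < 1,
      rsemimartingale F w &
      forall f : 'rV[R]_(n * 4) -> R, smooth f -> ball_supported f ->
        martingale F (fun t omega =>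
          f (real_coords (w t omega)) - f (real_coords (w 0 omega))
          - 2^-1 * \int[lebesgue_measure]_(u in `[0, t])
                      laplace_beltrami f (real_coords (w u omega)))].

Definition stochastic_area F (w : R -> Omega -> 'rV[quat R]_n)
    (a : R -> Omega -> quat R) :=
  [/\ qadapted F a, qcontinuous_paths a &
      stratonovich_integral (@area_form R n) w a].

(* d Theta = Theta o da, read in the quaternions: SU(2) is the group of unit
   quaternions and su(2), where a lives since area_form is imaginary-valued, the
   space of imaginary quaternions. *)
Definition SU2_sde_solution F (a Theta : R -> Omega -> quat R) :=
  [/\ qsemimartingale F Theta,
      forall t omega, 0 <= t -> qnormsq (Theta t omega) = 1,
      {ae P, forall omega, Theta 0 omega = 1} &
      stratonovich_integral
        (fun x u : (quat R * quat R)%type => x.1 * u.2)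
        (fun t omega => (Theta t omega, a t omega))
        (fun t omega => Theta t omega - Theta 0 omega)].

Definition horizontal_lift F (w : R -> Omega -> 'rV[quat R]_n)
    (X : R -> Omega -> 'rV[quat R]_(n + 1)) :=
  [/\ rsemimartingale F X,
      forall t omega, 0 <= t -> AdS (X t omega),
      {ae P, forall omega, X 0 omega = @north_pole R n},
      {ae P, forall omega, forall t, 0 <= t -> hyp_proj (X t omega) = w t omega} &
      stratonovich_integral (@contact_form R n) X (fun _ _ => 0)].

(* The definite article: lifts are determined up to indistinguishability. *)
Definition is_the_horizontal_lift F (w : R -> Omega -> 'rV[quat R]_n)
    (X : R -> Omega -> 'rV[quat R]_(n + 1)) :=
  horizontal_lift F w X /\
  forall Y, horizontal_lift F w Y ->
    {ae P, forall omega, forall t, 0 <= t -> Y t omega = X t omega}.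

End Processes.

(* Main.v *)
(* Ito calculus is replaced by discrete sums over partitions.  A germ G s t stands
   for a one-step increment; it is negligible if its sums against tight adapted weights
   tend to 0 in probability with the mesh.  For continuous semimartingales, products
   of three increments are negligible, since the sums of squares are tight; and if
   the trapezoidal sums of a form tend to z, then, by comparing each step with its
   fine refinements, the one-step trapezoid and the increment of z differ by a
   negligible germ.  For X = rho Phi (w, 1) with |Phi| = 1, the one-step trapezoid of
   the contact form is Im <X_t, X_s>, and quaternion algebra gives, up to products of
   three increments, (M A - D) conj(M) with M and D the mean and the increment of Phi and A
   the trapezoid of the area form.  Hence X is horizontal if and only if
   d Phi = Phi o da.  The same SDE for Phi and Theta gives d (Phi conj(Theta)) = 0, because A is
   imaginary, and so uniqueness. *)

Require Import Defs.
From HB Require Import structures.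
From mathcomp Require Import all_boot all_order all_algebra.
From mathcomp Require Import all_classical all_reals all_analysis.
From mathcomp Require Import measurable_realfun ring lra.
Import Order.TTheory GRing.Theory Num.Theory.
Import numFieldNormedType.Exports.
Local Open Scope classical_set_scope.
Local Open Scope ring_scope.
Set Implicit Arguments.
Unset Strict Implicit.
Unset Printing Implicit Defensive.

(** * Convergence in probability along partitions *)

(** The hypotheses are global: for each fixed time, the trapezoidal sums over the whole interval
    converge in probability. The algebra is local: it rewrites one step and multiplies it by factors
    such as M or conj(M). Sewing carries the first kind of information to the second, and
    negligibility quantifies over all tight adapted weights precisely so that it survives such
    multiplications. The way back is cheap, as weights equal to 1 return the global sums.

    Horizontality only says that E conj(M) is negligible, where E = M A - D is the defect of the
    equation for Phi. The factor conj(M) is removed without inverting M: as |Phi| = 1, |M|^2 = 1 -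
    |D|^2 / 4, so E = E conj(M) M + |D|^2 E / 4, and the last term is a product of three increments.

    Every expansion is an exact identity between finitely many values of the processes, with an
    explicit remainder. This holds even for the factor 1 / sqrt(1 - |w|^2), whose second-order
    remainder is a rational expression in its two end values. *)

Section OuterProbability.
Context d (Omega : measurableType d) (R : realType) (P : probability Omega R).
Implicit Types (A B : set Omega) (e : R).

(* P is meaningless off the measurable sets, hence the measurable cover. *)
Definition outer_le A e :=
  exists E, [/\ measurable E, (P E <= e%:E)%E & A `<=` E].

Lemma outer_leS A B e : A `<=` B -> outer_le B e -> outer_le A e.
Proof. by move=> AB [E [mE PE BE]]; exists E; split=> //; apply: subset_trans BE. Qed.

Lemma outer_leW A e e' : e <= e' -> outer_le A e -> outer_le A e'.
Proof.
by move=> ee' [E [mE PE AE]]; exists E; split=> //; rewrite (le_trans PE) ?lee_fin.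
Qed.

Lemma outer_leU A B e e' : outer_le A e -> outer_le B e' -> outer_le (A `|` B) (e + e').
Proof.
move=> [E [mE PE AE]] [E' [mE' PE' BE']]; exists (E `|` E'); split.
- exact: measurableU.
- by rewrite (le_trans (measureU2 _ mE mE'))// EFinD leeD.
- exact: setUSS.
Qed.

Lemma outer_leU2 A B C e : A `<=` B `|` C ->
  outer_le B (e / 2) -> outer_le C (e / 2) -> outer_le A e.
Proof.
move=> ABC oB oC; apply: (outer_leS ABC); apply: (outer_leW _ (outer_leU oB oC)).
by lra.
Qed.

Lemma outer_le_bigU (A : nat -> set Omega) n e :
  (forall i, (i < n)%N -> outer_le (A i) e) ->
  outer_le [set omega | exists2 i, (i < n)%N & A i omega] (n%:R * e).
Proof.
elim: n => [|n IH] h.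
  exists set0; split => //; first by rewrite measure0 lee_fin mul0r.
  by move=> o [].
have {}IH := IH (fun i (ilt : (i < n)%N) => h i (ltnW ilt)).
rewrite mulrSr mulrDl mul1r; apply: outer_leS (outer_leU IH (h n (ltnSn n))).
move=> o [i]; rewrite ltnS leq_eqVlt => /orP[/eqP-> ?|ilt Ai]; first by right.
by left; exists i.
Qed.

Lemma outer_le_measurable A e : measurable A -> (P A <= e%:E)%E <-> outer_le A e.
Proof.
move=> mA; split=> [PA|[E [mE PE AE]]]; first by exists A; split.
by rewrite (le_trans _ PE)// le_measure ?inE.
Qed.

Lemma outer_le_ae (Q : Omega -> Prop) A e : 0 <= e ->
  {ae P, forall omega, Q omega} -> (forall omega, Q omega -> ~ A omega) -> outer_le A e.
Proof.
move=> e0 [E [mE PE QE]] QA; exists E; split=> //; first by rewrite PE lee_fin.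
by move=> o Ao; apply: QE => /QA.
Qed.

Lemma outer_le_negligible A : (forall e, 0 < e -> outer_le A e) -> P.-negligible A.
Proof.
move=> h; have hn n : exists E, [/\ measurable E, (P E <= (n.+1%:R^-1)%:E)%E & A `<=` E].
  by apply: h; rewrite invr_gt0.
have [E hE] := choice hn.
exists (\bigcap_n E n); split; last by move=> o Ao n _; have [_ _] := hE n; apply.
  by apply: bigcapT_measurable => n; have [] := hE n.
apply/eqP; rewrite eq_le measure_ge0 andbT; apply/lee_addgt0Pr => e e0.
rewrite add0e; have [n ne] : exists n, n.+1%:R^-1 < e.
  have := near_infty_natSinv_lt (PosNum e0).
  by case=> n _ /(_ n) h1; exists n; apply: h1 => /=.
have [mE PE _] := hE n.
rewrite (@le_trans _ _ (P (E n)))//; last by rewrite (le_trans PE)// lee_fin ltW.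
rewrite le_measure ?inE//; last by move=> o; apply.
by apply: bigcapT_measurable => k; have [] := hE k.
Qed.

(** Continuity from above. It turns what each path satisfies for its own constant into a statement
    with one constant, valid off a set of small probability. *)
Lemma outer_le_decreasing (A : nat -> set Omega) e : 0 < e ->
  (forall n, measurable (A n)) -> (forall n, A n.+1 `<=` A n) ->
  \bigcap_n A n = set0 -> exists n, outer_le (A n) e.
Proof.
move=> e0 mA dA A0.
have /fine_cvgP[_] : P \o A @ \oo --> 0%E.
  rewrite -(measure0 P) -A0; apply: nonincreasing_cvg_mu => //.
  - by rewrite (le_lt_trans (probability_le1 P _)) ?ltry.
  - exact: bigcapT_measurable.
  - by apply/nonincreasing_seqP => n; apply/subsetPset.
move=> /cvgrPdist_lt /(_ e e0)[n _ /(_ n (leqnn n)) /=].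
rewrite sub0r normrN => h; exists n, (A n); split => //.
have fP : P (A n) \is a fin_num by rewrite fin_num_measure.
by rewrite -(fineK fP) lee_fin ltW// (le_lt_trans (ler_norm _) h).
Qed.

End OuterProbability.

Section SubMeasurable.
Context d (Omega : measurableType d) (R : realType) (G : set (set Omega)).
Hypothesis sG : sigma_algebra setT G.
Implicit Types X Y : Omega -> R.

(** [G] is its own generated sigma-algebra, so ordinary measurability on [g_sigma_algebraType G]
    applies and the closure properties below come from those of measurable functions. *)
Lemma sub_measurableE X :
  sub_measurable G X <-> measurable_fun setT (X : g_sigma_algebraType G -> R).
Proof.
have GE (B : set Omega) : @measurable _ (g_sigma_algebraType G) B = G B.
  by rewrite /measurable /= (sigma_algebra_id sG).
split=> [h _ B mB|h B mB]; first by rewrite setTI GE; apply: h.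
by rewrite -GE -[_ @^-1` _]setTI; apply: h.
Qed.

Lemma sub_measurable_cst c : sub_measurable G (fun=> c : R).
Proof. by apply/sub_measurableE; apply: measurable_cst. Qed.

Lemma sub_measurableD X Y : sub_measurable G X -> sub_measurable G Y ->
  sub_measurable G (fun o => X o + Y o).
Proof. by move=> /sub_measurableE mX /sub_measurableE mY; apply/sub_measurableE; exact: measurable_funD. Qed.

Lemma sub_measurableM X Y : sub_measurable G X -> sub_measurable G Y ->
  sub_measurable G (fun o => X o * Y o).
Proof. by move=> /sub_measurableE mX /sub_measurableE mY; apply/sub_measurableE; exact: measurable_funM. Qed.

Lemma sub_measurable_max X Y : sub_measurable G X -> sub_measurable G Y ->
  sub_measurable G (fun o => Num.max (X o) (Y o)).
Proof. by move=> /sub_measurableE mX /sub_measurableE mY; apply/sub_measurableE; exact: measurable_maxr. Qed.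

Lemma sub_measurable_min X Y : sub_measurable G X -> sub_measurable G Y ->
  sub_measurable G (fun o => Num.min (X o) (Y o)).
Proof. by move=> /sub_measurableE mX /sub_measurableE mY; apply/sub_measurableE; exact: measurable_minr. Qed.

Lemma sub_measurable_comp (f : R -> R) X : measurable_fun setT f ->
  sub_measurable G X -> sub_measurable G (fun o => f (X o)).
Proof. by move=> mf mX B mB; rewrite -[_ @^-1` _]/(X @^-1` (f @^-1` B)); apply: mX; rewrite -[f @^-1` B]setTI; apply: mf. Qed.

Lemma sub_measurableN X : sub_measurable G X -> sub_measurable G (fun o => - X o).
Proof. by apply: sub_measurable_comp. Qed.

Lemma sub_measurableB X Y : sub_measurable G X -> sub_measurable G Y ->
  sub_measurable G (fun o => X o - Y o).
Proof. by move=> mX mY; apply: sub_measurableD => //; apply: sub_measurableN. Qed.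

Lemma sub_measurable_norm X : sub_measurable G X -> sub_measurable G (fun o => `|X o|).
Proof. by apply: sub_measurable_comp; apply: normr_measurable. Qed.

Lemma sub_measurable_sum (I : Type) (r : seq I) (X : I -> Omega -> R) :
  (forall i, sub_measurable G (X i)) -> sub_measurable G (fun o => \sum_(i <- r) X i o).
Proof.
move=> mX; elim: r => [|i r IH].
  by under eq_fun do rewrite big_nil; apply: sub_measurable_cst.
by under eq_fun do rewrite big_cons; apply: sub_measurableD.
Qed.

Lemma sub_measurable_ind (e : R) X : sub_measurable G X ->
  sub_measurable G (fun o => if `|X o| < e then 1 else 0 : R).
Proof.
move=> /sub_measurable_norm/sub_measurableE mX; apply/sub_measurableE.
apply: measurable_fun_ifT; rewrite ?measurable_cst//.
apply: (@measurable_fun_ltr _ (g_sigma_algebraType G) R setT _ (cst e)) => //.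
Qed.

Lemma sub_measurable_ge (e : R) X : sub_measurable G X -> G [set o | e <= X o].
Proof.
move=> mX; rewrite (_ : [set _ | _] = X @^-1` `[e, +oo[); first exact: mX.
by apply/seteqP; split=> o /=; rewrite in_itv /= andbT.
Qed.

End SubMeasurable.

Section Paths.
Context (R : realType).
Implicit Types (f : R -> R) (s t T e : R).

Lemma within_continuousP f : {within `[0, +oo[, continuous f} <->
  forall t e, 0 <= t -> 0 < e -> exists2 delta, 0 < delta &
    forall s, 0 <= s -> `|t - s| < delta -> `|f t - f s| < e.
Proof.
split=> [/subspace_continuousP cf t e t0 e0|cf].
  have /cvgrPdist_lt /(_ e e0) := cf t ltac:(by rewrite /= in_itv /= t0).
  rewrite /prop_near1 /within /= => /nbhs_ballP[delta /= d0 h].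
  by exists delta => // s s0 ts; apply: (h s) => //; rewrite in_itv /= s0.
apply/subspace_continuousP => t; rewrite /= in_itv /= andbT => t0.
apply/cvgrPdist_lt => e e0; have [delta d0 h] := cf t e t0 e0.
rewrite /prop_near1 /within /=; apply/nbhs_ballP; exists delta => //= s ts.
by rewrite in_itv /= andbT => s0; apply: h.
Qed.

(** Heine's theorem through the near-covering form of compactness: each time has a scale that is
    valid on a neighbourhood, hence one scale serves all of [[0, T]]. *)
Lemma within_unif_continuous f T e : {within `[0, +oo[, continuous f} -> 0 < e ->
  exists2 delta, 0 < delta & forall s t, 0 <= s <= T -> 0 <= t <= T ->
    `|s - t| < delta -> `|f s - f t| < e.
Proof.
move=> /within_continuousP cf e0.
have /near_covering_withinP := iffLR (compact_near_coveringP _) (@segment_compact R 0 T).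
pose Q delta s := forall t, 0 <= t -> `|s - t| < delta -> `|f s - f t| < e.
move=> /(_ _ 0^'+ Q _)[].
  move=> s; rewrite /= in_itv /= => /andP[s0 sT].
  have [delta d0 h] := cf s (e / 2) s0 ltac:(lra).
  exists (ball s (delta / 2), [set r | 0 < r < delta / 2]) => /=.
    split; first by apply: nbhsx_ballx; lra.
    near=> r; apply/andP; split; near: r; first exact: nbhs_right_gt.
    by apply: nbhs_right_lt; lra.
  move=> [s' r] /= [ss' /andP[r0 rd]]; rewrite in_itv /= => /andP[s'0 _] t t0 s't.
  rewrite -[f s' - f t](subrKA (f s)) (le_lt_trans (ler_normD _ _))//.
  have /= ss'2 : `|s - s'| < delta / 2 by [].
  have h1 : `|s - s'| < delta by lra.
  have h2 : `|s - t| < delta.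
    rewrite -(subrKA s') (le_lt_trans (ler_normD _ _))//; lra.
  have := h _ s'0 h1; have := h _ t0 h2; rewrite -(distrC (f s)); lra.
move=> r /= r0 h; exists (r / 2) => [|s t s0 /andP[t0 _] st]; first lra.
apply: (h (r / 2)) => //=; rewrite ?in_itv //= ?sub0r ?normrN ?gtr0_norm; lra.
Unshelve. all: by end_near. Qed.

Lemma within_bounded f T : {within `[0, +oo[, continuous f} ->
  exists M, forall s, 0 <= s <= T -> `|f s| <= M.
Proof.
move=> /within_continuousP cf.
have /near_covering_withinP := iffLR (compact_near_coveringP _) (@segment_compact R 0 T).
move=> /(_ _ (@pinfty_nbhs R) (fun M s => `|f s| <= M) _)[].
  move=> s; rewrite /= in_itv /= => /andP[s0 sT].
  have [delta d0 h] := cf s 1 s0 ltac:(lra).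
  exists (ball s delta, [set r | `|f s| + 1 < r]) => /=.
    split; first by apply: nbhsx_ballx.
    by exists (`|f s| + 1); split.
  move=> [s' r] /= [ss' rd]; rewrite in_itv /= => /andP[s'0 _].
  have := h _ s'0 ss'; rewrite distrC => h1.
  rewrite -(subrK (f s) (f s')) (le_trans (ler_normD _ _))//; lra.
move=> M [_ h]; exists (M + 1) => s s0.
by apply: (h (M + 1)); rewrite ?in_itv //; lra.
Qed.

End Paths.

Section PathModulus.
Context d (Omega : measurableType d) (R : realType) (P : probability Omega R).
Variables (x : R -> Omega -> R) (T : R).
Hypothesis T0 : 0 <= T.
Hypothesis mx : forall t, 0 <= t -> measurable_fun setT (x t).
Hypothesis cx : continuous_paths x.

(** Rational times moved into [[0, T]]: a countable dense set of times. Events about all times are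
    covered by countable unions over it, which are measurable. *)
Let clamp (q : rat) : R := Num.max 0 (Num.min (ratr q) T).

Let clamp_itv q : 0 <= clamp q <= T.
Proof. by rewrite /clamp le_max lexx /= ge_max T0 /= ge_min lexx orbT. Qed.

Let clamp_dense s e : 0 <= s <= T -> 0 < e -> exists q, `|s - clamp q| < e.
Proof.
move=> /andP[s0 sT] e0.
have /rat_in_itvoo[q] : s - e < s + e by lra.
rewrite in_itv /= => /andP[q1 q2]; exists q; rewrite /clamp ltr_norml.
case: (lerP (ratr q) T) => qT; case: (lerP 0 _) => q0; lra.
Qed.

Let measurable_set_at (Q : Prop) (X : Omega -> R) e : measurable_fun setT X ->
  measurable [set omega | Q /\ e <= `|X omega|].
Proof.
move=> mX; have [HQ|HQ] := pselect Q; last first.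
  by rewrite (_ : [set _ | _] = set0)//; apply/seteqP; split=> o //= -[].
rewrite (_ : [set _ | _] = (fun o => `|X o|) @^-1` `[e, +oo[).
  rewrite -[_ @^-1` _]setTI; apply: measurableT_comp => //.
apply/seteqP; split=> o /=; rewrite in_itv /= andbT; by [case|].
Qed.

Lemma modulus_outer e p : 0 < e -> 0 < p -> exists2 delta, 0 < delta &
  outer_le P [set omega | exists s t, [/\ 0 <= s <= T, 0 <= t <= T, `|s - t| < delta &
    e <= `|x s omega - x t omega|]] p.
Proof.
move=> e0 p0.
pose A k := \bigcup_p (\bigcup_q [set omega | `|clamp p - clamp q| < k.+1%:R^-1 /\
  e / 2 <= `|x (clamp p) omega - x (clamp q) omega|]).
have [||||k hk] := @outer_le_decreasing _ _ _ P A p.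
- by [].
- move=> k; apply: bigcupT_measurable_rat => p'; apply: bigcupT_measurable_rat => q.
  apply: measurable_set_at; apply: measurable_funB; apply: mx; by case/andP: (clamp_itv p'); case/andP: (clamp_itv q).
- move=> k o [p' _ [q _ [h1 h2]]]; exists p' => //; exists q => //; split => //.
  by rewrite (lt_le_trans h1)// lef_pV2 ?posrE// ler_nat.
- apply/seteqP; split=> // o h; have e20 : 0 < e / 2 by lra.
  have [delta d0 hd] := within_unif_continuous T (@cx o) e20.
  have [n _ /(_ n (leqnn n)) /= nd] := near_infty_natSinv_lt (PosNum d0).
  have [p' _ [q _ [h1]]] := h n I.
  by rewrite leNgt hd// (lt_trans h1).
exists k.+1%:R^-1; first by rewrite invr_gt0.
apply: outer_leS hk => o [s [t [sT tT st est]]].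
have e80 : 0 < e / 8 by lra.
have [c cE] : exists c : R, c = k.+1%:R^-1 by exists k.+1%:R^-1.
rewrite -cE in st.
have [delta d0 hd] := within_unif_continuous T (@cx o) e80.
(* The dense times replacing [s] and [t] must stay at distance less than [c], which spends the slack
   [c - |s - t|], and each replacement may move the value by less than [e / 8]; the gap of the
   values then remains above [e / 2]. *)
pose eta := Num.min delta ((c - `|s - t|) / 2).
have eta0 : 0 < eta by rewrite lt_min d0 /=; lra.
have [p' hp] := clamp_dense sT eta0; have [q hq] := clamp_dense tT eta0.
have [etad etak] : eta <= delta /\ eta <= (c - `|s - t|) / 2.
  by rewrite /eta !ge_min !lexx orbT.
exists p' => //; exists q => //; split; rewrite -?cE.
  have -> : clamp p' - clamp q = - (s - clamp p') + (s - t) + (t - clamp q) by ring.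
  apply: (le_lt_trans (ler_normD _ _)); have := ler_normD (- (s - clamp p')) (s - t).
  rewrite normrN; lra.
have h1 := hd _ _ sT (clamp_itv p') (lt_le_trans hp etad).
have h2 := hd _ _ tT (clamp_itv q) (lt_le_trans hq etad).
have := ler_normD (x s o - x (clamp p') o) ((x (clamp p') o - x (clamp q) o) - (x t o - x (clamp q) o)).
rewrite (_ : _ + (_ - (_ - _)) = x s o - x t o); last by ring.
have := ler_normB (x (clamp p') o - x (clamp q) o) (x t o - x (clamp q) o); lra.
Qed.

Lemma bounded_outer p : 0 < p -> exists2 K, 0 < K &
  outer_le P [set omega | exists s, 0 <= s <= T /\ K <= `|x s omega|] p.
Proof.
move=> p0.
pose A k := \bigcup_p [set omega | True /\ k%:R <= `|x (clamp p) omega|].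
have [||||k hk] := @outer_le_decreasing _ _ _ P A p.
- by [].
- move=> k; apply: bigcupT_measurable_rat => p'.
  by apply: measurable_set_at; apply: mx; case/andP: (clamp_itv p').
- move=> k o [p' _ [_ h]]; exists p' => //; split=> //.
  by rewrite (le_trans _ h)// ler_nat.
- apply/seteqP; split=> // o h; have [M hM] := within_bounded T (@cx o).
  have [p' _ [_]] := h (Num.trunc M).+1 I.
  have := hM _ (clamp_itv p'); have := truncnS_gt M; lra.
exists (k.+1%:R) => //; apply: outer_leS hk => o [s [sT Ks]].
have [delta d0 hd] := within_unif_continuous T (@cx o) ltr01.
have [q hq] := clamp_dense sT d0; exists q => //; split=> //.
have := hd _ _ sT (clamp_itv q) hq; rewrite -natr1 in Ks.
have := ler_normD (x s o - x (clamp q) o) (x (clamp q) o); rewrite subrK; lra.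
Qed.

End PathModulus.

(* A partition of [0, T] for each n; the points are continued by T. *)
Record pseq (R : realType) (T : R) := Pseq {
  psize : nat -> nat;
  ppt :> nat -> nat -> R;
  ppt0 : forall n, ppt n 0%N = 0;
  ppt_ltS : forall n i, (i < psize n)%N -> ppt n i < ppt n i.+1;
  ppt_end : forall n i, (psize n <= i)%N -> ppt n i = T }.

Section Partitions.
Context (R : realType) (T : R).
Implicit Type tau : pseq T.

Lemma ppt_leS tau n i : tau n i <= tau n i.+1.
Proof.
have [h|h] := ltnP i (psize tau n); first exact/ltW/ppt_ltS.
by rewrite !ppt_end// leqW.
Qed.

Lemma ppt_le tau n i j : (i <= j)%N -> tau n i <= tau n j.
Proof. by move=> /subnKC <-; elim: (j - i)%N => [|k IH]; rewrite ?addn0// addnS (le_trans IH)// ppt_leS. Qed.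

Lemma ppt_ge0 tau n i : 0 <= tau n i.
Proof. by rewrite -(ppt0 tau n) ppt_le. Qed.

Lemma ppt_leT tau n i : tau n i <= T.
Proof.
have h : tau n (psize tau n + i)%N = T by rewrite ppt_end ?leq_addr.
by rewrite -[leRHS]h ppt_le ?leq_addl.
Qed.

Lemma ppt_itv tau n i : 0 <= tau n i <= T.
Proof. by rewrite ppt_ge0 ppt_leT. Qed.

Definition mesh0 tau := forall delta, 0 < delta ->
  \forall n \near \oo, forall i, tau n i.+1 - tau n i < delta.

(** With [pseq_of_seq] below, the dictionary between sequences of partitions and the lists of points
    (without the initial 0) over which [semimartingale] and [stratonovich_integral] quantify. *)
Definition pseq_seq tau n := mkseq (fun i => tau n i.+1) (psize tau n).

Lemma size_pseq_seq tau n : size (pseq_seq tau n) = psize tau n.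
Proof. exact: size_mkseq. Qed.

Lemma pt_pseq_seq tau n i : pt 0 T (pseq_seq tau n) i = tau n i.
Proof.
rewrite /pt; case: i => [|i] /=; first by rewrite ppt0.
have [h|h] := ltnP i (psize tau n); first by rewrite nth_mkseq.
by rewrite nth_default ?size_mkseq// ppt_end// leqW.
Qed.

Lemma pseq_seq_partition tau n : itv_partition 0 T (pseq_seq tau n).
Proof.
split.
  apply/(pathP T) => i; rewrite size_pseq_seq => h.
  rewrite -[nth T (0 :: _) i]/(pt 0 T (pseq_seq tau n) i).
  rewrite -[nth T _ i]/(pt 0 T (pseq_seq tau n) i.+1) !pt_pseq_seq.
  exact: ppt_ltS.
rewrite (last_nth T) -[nth T (0 :: _) _]/(pt 0 T (pseq_seq tau n) _).
by rewrite pt_pseq_seq size_pseq_seq ppt_end.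
Qed.

Section FromSeq.
Variable s : nat -> seq R.
Hypothesis sP : forall n, itv_partition 0 T (s n).

Let pt0 n : pt 0 T (s n) 0 = 0. Proof. by []. Qed.
Let pt_lt n i : (i < size (s n))%N -> pt 0 T (s n) i < pt 0 T (s n) i.+1.
Proof. by case: (sP n) => /(pathP T) h _; apply: h. Qed.
Let pt_end n i : (size (s n) <= i)%N -> pt 0 T (s n) i = T.
Proof.
move=> h; rewrite /pt; move: h; rewrite leq_eqVlt => /orP[/eqP <-|h].
  by case: (sP n) => _ /eqP h; rewrite -(last_nth T).
by rewrite nth_default.
Qed.

Definition pseq_of_seq : pseq T := Pseq pt0 pt_lt pt_end.
End FromSeq.

End Partitions.

Section Arrays.
Context d (Omega : measurableType d) (R : realType) (P : probability Omega R).
Implicit Types (g h q : nat -> nat -> Omega -> R).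

(* An array is indexed by the partition and by the position in it; both notions
   are uniform in the position. *)
Definition cv0 g := forall e, 0 < e ->
  \forall n \near \oo, outer_le P [set omega | exists i, e <= `|g n i omega|] e.
Definition tight g := forall e, 0 < e -> exists2 K, 0 < K &
  \forall n \near \oo, outer_le P [set omega | exists i, K <= `|g n i omega|] e.
(** All partial sums at once: as [cv0] and [tight] are uniform in the position, a statement on
    [psum] is a maximal one, the discrete form of convergence in probability uniformly in time. *)
Definition psum g n k (omega : Omega) : R := \sum_(0 <= i < k) g n i omega.

Lemma psum0 g n omega : psum g n 0 omega = 0.
Proof. by rewrite /psum big_nil. Qed.
Lemma psumS g n k omega : psum g n k.+1 omega = psum g n k omega + g n k omega.
Proof. by rewrite /psum big_nat_recr. Qed.

(** The bounding position may differ from the bounded one and depend on the outcome. Thus a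
    subfamily of positions, such as sums read only at the multiples of [M n], inherits the
    convergence. *)
Lemma cv0_le_ae g h :
  {ae P, forall omega, forall n i, exists j, `|g n i omega| <= `|h n j omega|} ->
  cv0 h -> cv0 g.
Proof.
move=> gh ch e e0; have e20 : 0 < e / 2 by lra.
near=> n; pose Q omega := forall n i, exists j, `|g n i omega| <= `|h n j omega|.
apply: (@outer_leU2 _ _ _ _ _ [set o | ~ Q o] [set o | exists i, e / 2 <= `|h n i o|]).
- move=> o [i ei]; have [/(_ n i)[j hj]|Qo] := pselect (Q o); last by left.
  by right; exists j; lra.
- by apply: (outer_le_ae (ltW e20) gh) => o; rewrite /Q /= => + h'.
- by near: n; apply: ch.
Unshelve. all: by end_near. Qed.

Lemma cv0_le g h : (forall n i omega, `|g n i omega| <= `|h n i omega|) -> cv0 h -> cv0 g.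
Proof. by move=> gh; apply: cv0_le_ae; apply: aeW => o n i; exists i. Qed.

Lemma tight_le g h : (forall n i omega, exists j, `|g n i omega| <= `|h n j omega|) -> tight h -> tight g.
Proof.
move=> gh th e e0; have [K K0 hK] := th e e0; exists K => //.
near=> n; apply: (@outer_leS _ _ _ _ _ [set o | exists i, K <= `|h n i o|]).
  by move=> o [i Ki]; have [j hj] := gh n i o; exists j; apply: le_trans hj.
by near: n.
Unshelve. all: by end_near. Qed.

Lemma cv0_tight g : cv0 g -> tight g.
Proof.
move=> cg e e0; have m0 : 0 < Num.min e 1 by rewrite lt_min e0 ltr01.
exists (Num.min e 1) => //; near=> n; apply: (@outer_leW _ _ _ _ _ (Num.min e 1)).
  by rewrite ge_min lexx.
by near: n; apply: cg.
Unshelve. all: by end_near. Qed.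

Lemma tightD g h : tight g -> tight h -> tight (fun n i o => g n i o + h n i o).
Proof.
move=> tg th e e0; have e20 : 0 < e / 2 by lra.
have [K K0 hK] := tg _ e20; have [L L0 hL] := th _ e20; exists (K + L); first exact: addr_gt0.
near=> n; apply: (@outer_leU2 _ _ _ _ _ [set o | exists i, K <= `|g n i o|] [set o | exists i, L <= `|h n i o|]).
- move=> o [i]; have := ler_normD (g n i o) (h n i o).
  by have [?|?] := leP K `|g n i o|; [left; exists i|right; exists i; lra].
- by near: n.
- by near: n.
Unshelve. all: by end_near. Qed.

Lemma cv0D g h : cv0 g -> cv0 h -> cv0 (fun n i o => g n i o + h n i o).
Proof.
move=> tg th e e0; have e20 : 0 < e / 2 by lra.
near=> n; apply: (@outer_leU2 _ _ _ _ _ [set o | exists i, e / 2 <= `|g n i o|] [set o | exists i, e / 2 <= `|h n i o|]).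
- move=> o [i]; have := ler_normD (g n i o) (h n i o).
  by have [?|?] := leP (e / 2) `|g n i o|; [left; exists i|right; exists i; lra].
- by near: n; apply: tg.
- by near: n; apply: th.
Unshelve. all: by end_near. Qed.

Lemma tightM g h : tight g -> tight h -> tight (fun n i o => g n i o * h n i o).
Proof.
move=> tg th e e0; have e20 : 0 < e / 2 by lra.
have [K K0 hK] := tg _ e20; have [L L0 hL] := th _ e20; exists (K * L); first exact: mulr_gt0.
near=> n; apply: (@outer_leU2 _ _ _ _ _ [set o | exists i, K <= `|g n i o|] [set o | exists i, L <= `|h n i o|]).
- move=> o [i]; rewrite normrM => KL.
  have [?|gK] := leP K `|g n i o|; [by left; exists i|right; exists i].
  by rewrite -(ler_pM2l K0) (le_trans KL)// ler_wpM2r// ltW.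
- by near: n.
- by near: n.
Unshelve. all: by end_near. Qed.

Lemma cv0_tightM g h : tight g -> cv0 h -> cv0 (fun n i o => g n i o * h n i o).
Proof.
move=> tg th e e0; have e20 : 0 < e / 2 by lra.
have [K K0 hK] := tg _ e20; pose e' := Num.min (e / 2) (e / K).
have e'0 : 0 < e' by rewrite lt_min e20 divr_gt0.
have [e'e e'K] : e' <= e / 2 /\ e' <= e / K by rewrite /e' !ge_min !lexx orbT.
near=> n; apply: (@outer_leU2 _ _ _ _ _ [set o | exists i, K <= `|g n i o|] [set o | exists i, e' <= `|h n i o|]).
- move=> o [i]; rewrite normrM => KL.
  have [?|gK] := leP K `|g n i o|; [by left; exists i|right; exists i].
  rewrite (le_trans e'K)// ler_pdivrMr// (le_trans KL)// mulrC ler_wpM2l//.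
  exact: ltW.
- by near: n.
- by apply: outer_leW e'e _; near: n; apply: th.
Unshelve. all: by end_near. Qed.

Lemma tight_cst (c : R) : tight (fun _ _ _ => c).
Proof.
move=> e e0; exists (`|c| + 1); first by rewrite ltr_pwDr.
near=> n; exists set0; split; rewrite ?measure0 ?lee_fin ?(ltW e0)//.
by move=> o [_]; lra.
Unshelve. all: by end_near. Qed.

Lemma cv0_of_bound (c : nat -> R) g : c @ \oo --> 0 ->
  (forall n i omega, `|g n i omega| <= c n) -> cv0 g.
Proof.
move=> /cvgrPdist_lt c0 gc e e0; have h := c0 _ e0; near=> n; exists set0; split; rewrite ?measure0 ?lee_fin ?(ltW e0)//.
move=> o [i]; rewrite leNgt (le_lt_trans (gc _ _ _))// (le_lt_trans (ler_norm _))//.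
rewrite -normrN -sub0r; by near: n.
Unshelve. all: by end_near. Qed.

Lemma tight_bound (c : R) g : (forall n i omega, `|g n i omega| <= c) -> tight g.
Proof. by move=> gc; apply: (tight_le _ (@tight_cst c)) => n i o; exists 0%N; rewrite (le_trans (gc _ _ _))// ler_norm. Qed.

Lemma cv0Z c g : cv0 g -> cv0 (fun n i o => c * g n i o).
Proof. by move=> cg; apply: cv0_tightM => //; apply: tight_cst. Qed.

Lemma tightZ c g : tight g -> tight (fun n i o => c * g n i o).
Proof. by move=> cg; apply: tightM => //; apply: tight_cst. Qed.

Lemma cv0_ext g h : (forall n i o, g n i o = h n i o) -> cv0 h -> cv0 g.
Proof. by move=> gh; apply: cv0_le => n i o; rewrite gh. Qed.

Lemma tight_ext g h : (forall n i o, g n i o = h n i o) -> tight h -> tight g.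
Proof. by move=> gh; apply: tight_le => n i o; exists i; rewrite gh. Qed.

Lemma psum_norm_le g q n k omega (c : R) : 0 <= c ->
  (forall i, `|g n i omega| <= c * q n i omega) ->
  `|psum g n k omega| <= c * psum q n k omega.
Proof.
move=> c0 gq; elim: k => [|k IH]; first by rewrite !psum0 normr0 mulr0.
by rewrite !psumS (le_trans (ler_normD _ _))// mulrDr lerD.
Qed.

Section Domination.
Variables (g c q : nat -> nat -> Omega -> R).
Hypothesis q0 : forall n i omega, 0 <= q n i omega.
Hypothesis tq : tight (psum q).
Hypothesis gcq : forall n i omega, `|g n i omega| <= `|c n i omega| * q n i omega.

(** A sum is at most the largest [|c|] times the sum of the [q]. In the applications [q] consists of
    squared increments and [c] of one more increment or a weight. *)
Lemma psum_dom_cv0 : cv0 c -> cv0 (psum g).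
Proof.
move=> cc e e0; have e20 : 0 < e / 2 by lra.
have [K K0 hK] := tq e20; pose e' := Num.min (e / 2) (e / (2 * K)).
have e'0 : 0 < e' by rewrite lt_min e20 divr_gt0// mulr_gt0.
have [e'e e'K] : e' <= e / 2 /\ e' <= e / (2 * K) by rewrite /e' !ge_min !lexx orbT.
near=> n; apply: (@outer_leU2 _ _ _ _ _ [set o | exists i, e' <= `|c n i o|] [set o | exists i, K <= `|psum q n i o|]).
- move=> o [k gk]; have [?|cN] := pselect (exists i, e' <= `|c n i o|); first by left.
  right; exists k; have cs i : `|c n i o| <= e'.
    by rewrite leNgt; apply/negP => h; apply: cN; exists i; apply: ltW.
  have /(psum_norm_le k (ltW e'0)) : forall i, `|g n i o| <= e' * q n i o.
    by move=> i; rewrite (le_trans (gcq _ _ _))// ler_wpM2r.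
  have /(ler_wpM2r (ltW K0)) := e'K; 
  have -> : e / (2 * K) * K = e / 2 by field; rewrite gt_eqF.
  have := ler_norm (psum q n k o) => h1 h2 h3.
  rewrite -(ler_pM2l e'0) (le_trans _ (ler_wpM2l (ltW e'0) h1))//; lra.
- by apply: outer_leW e'e _; near: n; apply: cc.
- by near: n.
Unshelve. all: by end_near. Qed.

Lemma psum_dom_tight : tight c -> tight (psum g).
Proof.
move=> cc e e0; have e20 : 0 < e / 2 by lra.
have [K K0 hK] := tq e20; have [L L0 hL] := cc _ e20.
exists (L * K); first exact: mulr_gt0.
near=> n; apply: (@outer_leU2 _ _ _ _ _ [set o | exists i, L <= `|c n i o|] [set o | exists i, K <= `|psum q n i o|]).
- move=> o [k gk]; have [?|cN] := pselect (exists i, L <= `|c n i o|); first by left.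
  right; exists k; have cs i : `|c n i o| <= L.
    by rewrite leNgt; apply/negP => h; apply: cN; exists i; apply: ltW.
  have /(psum_norm_le k (ltW L0)) : forall i, `|g n i o| <= L * q n i o.
    by move=> i; rewrite (le_trans (gcq _ _ _))// ler_wpM2r.
  move=> h; rewrite -(ler_pM2l L0) (le_trans gk)// (le_trans h)//.
  by rewrite ler_wpM2l ?ler_norm// ltW.
- by near: n.
- by near: n.
Unshelve. all: by end_near. Qed.

End Domination.

End Arrays.

(** * Semimartingales as integrators *)

Section Integrators.
Context d (Omega : measurableType d) (R : realType) (P : probability Omega R).
Variable F : R -> set (set Omega).
Hypothesis hF : filtration F.

Lemma filtration_sigma t : 0 <= t -> sigma_algebra setT (F t).
Proof. by case: hF => h _ _; apply: h. Qed.

Lemma sub_measurable_mono s t (X : Omega -> R) : 0 <= s -> s <= t ->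
  sub_measurable (F s) X -> sub_measurable (F t) X.
Proof. by case: hF => _ _ h s0 st mX B mB; apply: (h s t) => //; apply: mX. Qed.

Lemma sub_measurable_fun t (X : Omega -> R) : 0 <= t ->
  sub_measurable (F t) X -> measurable_fun setT X.
Proof. by case: hF => _ h _ t0 mX _ B mB; rewrite setTI; apply: (h t t0); apply: mX. Qed.

Section FixedPartitions.
Context (T : R) (tau : pseq T).
Implicit Types g h q : nat -> nat -> Omega -> R.

Let tau_sigma n i : sigma_algebra setT (F (tau n i)).
Proof. exact/filtration_sigma/ppt_ge0. Qed.

Definition arr_adapted g := forall n i, sub_measurable (F (tau n i)) (g n i).
Definition incr_adapted g := forall n i, sub_measurable (F (tau n i.+1)) (g n i).

Lemma arr_adapted_incr g : arr_adapted g -> incr_adapted g.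
Proof. by move=> ag n i; apply: sub_measurable_mono (ag n i); rewrite ?ppt_ge0 ?ppt_leS. Qed.

Lemma arr_adaptedM g h : arr_adapted g -> arr_adapted h -> arr_adapted (fun n i o => g n i o * h n i o).
Proof. by move=> ag ah n i; apply: sub_measurableM. Qed.

Lemma incr_adaptedM g h : incr_adapted g -> incr_adapted h -> incr_adapted (fun n i o => g n i o * h n i o).
Proof. by move=> ag ah n i; apply: sub_measurableM. Qed.

Lemma arr_adapted_cst c : arr_adapted (fun _ _ _ => c).
Proof. by move=> n i; apply: sub_measurable_cst. Qed.

Lemma psum_adapted g : incr_adapted g -> arr_adapted (psum g).
Proof.
move=> ag n; elim=> [|k IH].
  by rewrite (funext (psum0 g n)); apply: sub_measurable_cst.
rewrite (funext (psumS g n k)); apply: sub_measurableD => //.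
by apply: sub_measurable_mono IH; rewrite ?ppt_ge0 ?ppt_leS.
Qed.

(** The good-integrator property along one sequence of partitions: small adapted weights give small
    sums, and tight ones give tight sums. *)
Definition integ g := (forall h, arr_adapted h -> cv0 P h ->
    cv0 P (psum (fun n i o => h n i o * g n i o))) /\
  (forall h, arr_adapted h -> tight P h ->
    tight P (psum (fun n i o => h n i o * g n i o))).

Definition negl g := forall h, arr_adapted h -> tight P h ->
  cv0 P (psum (fun n i o => h n i o * g n i o)).

Lemma integ_ext g h : (forall n i o, g n i o = h n i o) -> integ h -> integ g.
Proof.
move=> gh [h1 h2]; have -> // : g = h.
by apply/funext => n; apply/funext => i; apply/funext => o.
Qed.

Lemma negl_integ g : negl g -> integ g.
Proof.
by move=> ng; split=> h ah th; [apply: ng (cv0_tight th)|apply/cv0_tight/ng].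
Qed.

Lemma psumD g h n k o : psum (fun n i o => g n i o + h n i o) n k o = psum g n k o + psum h n k o.
Proof. by rewrite /psum big_split. Qed.

Lemma integD g g' : integ g -> integ g' -> integ (fun n i o => g n i o + g' n i o).
Proof.
move=> [c1 t1] [c2 t2]; split=> h ah ch.
  by apply: cv0_ext (cv0D (c1 _ ah ch) (c2 _ ah ch)) => n k o; rewrite -psumD; apply: eq_bigr => i _; rewrite mulrDr.
by apply: tight_ext (tightD (t1 _ ah ch) (t2 _ ah ch)) => n k o; rewrite -psumD; apply: eq_bigr => i _; rewrite mulrDr.
Qed.

Lemma neglD g g' : negl g -> negl g' -> negl (fun n i o => g n i o + g' n i o).
Proof.
move=> c1 c2 h ah ch.
by apply: cv0_ext (cv0D (c1 _ ah ch) (c2 _ ah ch)) => n k o; rewrite -psumD; apply: eq_bigr => i _; rewrite mulrDr.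
Qed.

Lemma integ_weight a g : arr_adapted a -> tight P a -> integ g -> integ (fun n i o => a n i o * g n i o).
Proof.
move=> aa ta [c t]; split=> h ah ch.
  have := c _ (arr_adaptedM ah aa) ; rewrite (_ : (fun n i o => h n i o * a n i o * g n i o) = (fun n i o => h n i o * (a n i o * g n i o))).
    by apply; apply: cv0_ext (cv0_tightM ta ch) => n i o; rewrite mulrC.
  by apply/funext => n; apply/funext => i; apply/funext => o; rewrite mulrA.
have := t _ (arr_adaptedM ah aa) ; rewrite (_ : (fun n i o => h n i o * a n i o * g n i o) = (fun n i o => h n i o * (a n i o * g n i o))).
  by apply; apply: tightM.
by apply/funext => n; apply/funext => i; apply/funext => o; rewrite mulrA.
Qed.

Lemma negl_weight a g : arr_adapted a -> tight P a -> negl g -> negl (fun n i o => a n i o * g n i o).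
Proof.
move=> aa ta ng h ah th; have := ng _ (arr_adaptedM ah aa) (tightM th ta).
by apply: cv0_ext => n k o; apply: eq_bigr => i _; rewrite mulrA.
Qed.

Lemma integ_dom g c q : (forall n i o, 0 <= q n i o) -> tight P (psum q) -> tight P c ->
  (forall n i o, `|g n i o| <= `|c n i o| * q n i o) -> integ g.
Proof.
move=> q0 tq tc gcq; split=> h ah th.
  apply: (psum_dom_cv0 (c := fun n i o => c n i o * h n i o) q0 tq); last exact: cv0_tightM.
  by move=> n i o; rewrite !normrM mulrAC [leLHS]mulrC ler_wpM2r.
apply: (psum_dom_tight (c := fun n i o => h n i o * c n i o) q0 tq); last exact: tightM.
by move=> n i o; rewrite !normrM -mulrA ler_wpM2l.
Qed.

Lemma negl_dom g c q : (forall n i o, 0 <= q n i o) -> tight P (psum q) -> cv0 P c ->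
  (forall n i o, `|g n i o| <= `|c n i o| * q n i o) -> negl g.
Proof.
move=> q0 tq cc gcq h ah th.
apply: (psum_dom_cv0 (c := fun n i o => h n i o * c n i o) q0 tq); last exact: cv0_tightM.
by move=> n i o; rewrite !normrM -mulrA ler_wpM2l.
Qed.

(* Summation by parts: negligible sums make small adapted weights for g. *)
Lemma negl_integM e g : incr_adapted e -> incr_adapted g -> negl e -> integ g ->
  negl (fun n i o => e n i o * g n i o).
Proof.
move=> ae ag ne ig h ah th.
pose S := psum (fun n i o => 1 * e n i o).
have cS : cv0 P S by apply: ne; [apply: arr_adapted_cst|apply: tight_cst].
have ae1 : incr_adapted (fun n i o => 1 * e n i o).
  by apply: incr_adaptedM => //; apply/arr_adapted_incr/arr_adapted_cst.
have aS : arr_adapted S by apply: psum_adapted.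
pose U := psum (fun n i o => h n i o * g n i o).
have tU : tight P U by apply: ig.2.
have aU : arr_adapted U by apply/psum_adapted/incr_adaptedM => //; apply: arr_adapted_incr.
have c1 := cv0_tightM tU cS.
have c2 := ne _ aU tU.
have c3 := ig.1 _ (arr_adaptedM ah aS) (cv0_tightM th cS).
(* Discrete product rule for [U S]: the sum of [h e g] equals [U S] minus the sum of [U e] minus the
   sum of [h S g], with [U] and [S] taken at the left ends in the last two sums. *)
apply: cv0_ext (cv0D c1 (cv0Z (-1) (cv0D c2 c3))) => n k o.
elim: k => [|k IH]; first by rewrite !psum0 /U psum0; ring.
by rewrite !psumS IH /U /S !psumS; ring.
Qed.

(** The integrands allowed by [semimartingale] have a deterministic bound, whereas adapted arrays
    are bounded only with high probability; truncation changes them on the exceptional event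
    alone. *)
Definition clip (K x : R) : R := Num.max (- K) (Num.min K x).

Lemma clip_le K x : 0 <= K -> `|clip K x| <= K.
Proof. by move=> K0; rewrite /clip ler_norml le_max lexx /= ge_max ge_min lexx /=; lra. Qed.

Lemma clip_id K x : `|x| < K -> clip K x = x.
Proof. by rewrite ltr_norml => /andP[? ?]; rewrite /clip min_r 1?max_r//; lra. Qed.

Lemma clip_adapted K g : arr_adapted g -> arr_adapted (fun n i o => clip K (g n i o)).
Proof.
move=> ag n i; have s := tau_sigma n i.
apply: (@sub_measurable_max _ _ _ _ s (fun=> - K)); first exact: sub_measurable_cst.
by apply: (@sub_measurable_min _ _ _ _ s (fun=> K)) => //; exact: sub_measurable_cst.
Qed.

(* The maximal inequality is free: stop the weights when the sum exceeds e. *)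
Lemma integ_of_eps g : incr_adapted g -> (forall n i o, (psize tau n <= i)%N -> g n i o = 0) ->
  (forall e, 0 < e -> exists2 delta, 0 < delta &
    forall n (h : nat -> Omega -> R), (forall i, sub_measurable (F (tau n i)) (h i)) ->
      (forall i o, `|h i o| <= delta) ->
      outer_le P [set o | e <= `|\sum_(0 <= i < psize tau n) h i o * g n i o|] e) ->
  integ g.
Proof.
move=> ag g0 hg.
have hmax e : 0 < e -> exists2 delta, 0 < delta & forall n (h : nat -> Omega -> R),
    (forall i, sub_measurable (F (tau n i)) (h i)) -> (forall i o, `|h i o| <= delta) ->
    outer_le P [set o | exists k, e <= `|\sum_(0 <= i < k) h i o * g n i o|] e.
  move=> e0; have [delta d0 hd] := hg e e0; exists delta => // n h ah bh.
  pose S k o := \sum_(0 <= i < k) h i o * g n i o.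
  (* The indicator that no sum up to position [k] has reached [e]. It depends only on what is known
     at [tau n k], so [J k * h k] is still an admissible weight for the next increment. *)
  pose J := fix J k (o : Omega) := if k is k'.+1 then J k' o * (if `|S k o| < e then 1 else 0) else 1 : R.
  have aS k : sub_measurable (F (tau n k)) (S k).
    elim: k => [|k IH].
      by rewrite /S; under eq_fun do rewrite big_nil; apply: sub_measurable_cst.
    rewrite /S; under eq_fun do rewrite big_nat_recr//=.
    have s := tau_sigma n k.+1.
    apply: sub_measurableD => //.
      by apply: sub_measurable_mono IH; rewrite ?ppt_ge0 ?ppt_leS.
    apply: sub_measurableM => //.
    by apply: sub_measurable_mono (ah k); rewrite ?ppt_ge0 ?ppt_leS.
  have aJ k : sub_measurable (F (tau n k)) (J k).
    elim: k => [|k IH] /=; first exact: sub_measurable_cst.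
    apply: sub_measurableM; first exact: tau_sigma.
      by apply: sub_measurable_mono IH; rewrite ?ppt_ge0 ?ppt_leS.
    by apply: sub_measurable_ind; [exact: tau_sigma|exact: (aS k.+1)].
  have J01 k o : 0 <= J k o <= 1.
    elim: k => [|k /andP[IH0 IH1]] /=; first by rewrite ler01 lexx.
    by case: ifP => _; rewrite ?mulr1 ?mulr0 ?IH0 ?lexx ?ler01.
  apply: outer_leS (hd n (fun i o => J i o * h i o) _ _) => /=.
  (* Reduce to the first [k] at which the sum reaches [e]. There [J] is 1 before [k] and 0 from [k]
     on, so the complete stopped sum is [S k]. This [k] lies inside the partition, because [g]
     vanishes beyond its end. *)
  - move=> o [k]; elim/ltn_ind: k => k IH ek.
    have [[j jk ej]|nj] := pselect (exists2 j, (j < k)%N & e <= `|S j o|); first exact: IH ej.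
    have J1 j : (j < k)%N -> J j o = 1.
      elim: j => [//|j IHj jk] /=; rewrite IHj ?(ltnW jk)// mul1r ifT// ltNge.
      by apply/negP => h'; apply: nj; exists j.+1.
    have kN : (k <= psize tau n)%N.
      rewrite leqNgt; apply/negP => Nk; apply: nj; exists (psize tau n) => //.
      move: ek; rewrite (big_cat_nat (n := psize tau n)) ?(ltnW Nk)//=.
      rewrite [X in `|_ + X|]big_nat_cond [X in `|_ + X|]big1 ?addr0// => i /andP[/andP[Ni _] _].
      by rewrite g0// mulr0.
    rewrite /= (big_cat_nat (n := k))//=.
    rewrite [X in _ + X]big_nat_cond [X in _ + X]big1; last first.
      move=> i /andP[/andP[ki _] _]; suff -> : J i o = 0 by rewrite !mul0r.
      rewrite -(subnKC ki); elim: (i - k)%N => [|l IHl]; last by rewrite addnS /= IHl mul0r.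
      rewrite addn0; case: (k) ek => [|k'] ek /=.
        by move: ek; rewrite big_nil normr0 leNgt e0.
      by rewrite ifF ?mulr0//; apply/negbTE; rewrite -leNgt.
    rewrite addr0 [X in `|X|](_ : _ = S k o)//.
    rewrite /S big_nat_cond [RHS]big_nat_cond; apply: eq_bigr => i /andP[/andP[_ ik] _].
    by rewrite J1// mul1r.
  - by move=> i; apply: sub_measurableM => //; exact: tau_sigma.
  - move=> i o; rewrite normrM; have /andP[j0 j1] := J01 i o; rewrite (ger0_norm j0).
    by rewrite (le_trans _ (bh i o))// ler_piMl.
split=> h ah ch e e0.
  have e20 : 0 < e / 2 by lra.
  have [delta d0 hd] := hmax _ e20; near=> n.
  apply: (@outer_leU2 _ _ _ _ _ [set o | exists i, Num.min delta (e / 2) <= `|h n i o|]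
    [set o | exists k, e / 2 <= `|\sum_(0 <= i < k) clip delta (h n i o) * g n i o|]).
  + move=> o [k ek]; have [hi|hN] := pselect (exists i, Num.min delta (e / 2) <= `|h n i o|); first by left.
    right; exists k; apply: (@le_trans _ _ e); first lra.
    apply: (le_trans ek); rewrite le_eqVlt /psum; apply/orP; left; apply/eqP; congr (`| _ |).
    apply: eq_bigr => i _; rewrite clip_id// ltNge; apply/negP => h'; apply: hN; exists i.
    by rewrite (le_trans _ h')// ge_min lexx.
  + apply: (@outer_leW _ _ _ _ _ (Num.min delta (e / 2))); first by rewrite ge_min lexx orbT.
    by near: n; apply: ch; rewrite lt_min d0.
  + by apply: hd => [i|i o]; [apply: (clip_adapted _ ah)|apply: clip_le; apply: ltW].
have e20 : 0 < e / 2 by lra.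
have [delta d0 hd] := hmax _ e20; have [K K0 hK] := ch _ e20.
(* Weights cut off at [K] and rescaled by [delta / K] fall under the bound [delta]; undoing the
   scaling multiplies the threshold [e / 2] by [K / delta]. *)
exists (K / delta * (e / 2)) => [|]; first by rewrite mulr_gt0// divr_gt0.
near=> n; apply: (@outer_leU2 _ _ _ _ _ [set o | exists i, K <= `|h n i o|]
    [set o | exists k, e / 2 <= `|\sum_(0 <= i < k) (delta / K * clip K (h n i o)) * g n i o|]).
+ move=> o [k ek]; have [hi|hN] := pselect (exists i, K <= `|h n i o|); first by left.
  right; exists k; have Kd0 : 0 < K / delta by rewrite divr_gt0.
  rewrite -(ler_pM2l Kd0); apply: (le_trans ek).
  rewrite -[X in X * `|_|](gtr0_norm Kd0) -normrM mulr_sumr le_eqVlt; apply/orP; left; apply/eqP.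
  congr (`| _ |); apply: eq_bigr => i _; rewrite clip_id.
    by field; rewrite !gt_eqF.
  by rewrite ltNge; apply/negP => h'; apply: hN; exists i.
+ by near: n.
+ apply: hd => [i|i o].
    apply: sub_measurableM; first exact: tau_sigma.
      by apply: sub_measurable_cst; exact: tau_sigma.
    exact: (clip_adapted _ ah).
  rewrite normrM gtr0_norm ?divr_gt0// -[leRHS](@divfK _ K) ?gt_eqF//.
  by rewrite ler_wpM2l ?clip_le ?ltW ?divr_gt0.
Unshelve. all: by end_near. Qed.

End FixedPartitions.

Definition incr (T : R) (tau : pseq T) (x : R -> Omega -> R) :=
  fun n i o => x (tau n i.+1) o - x (tau n i) o.

Definition at_pts (T : R) (tau : pseq T) (x : R -> Omega -> R) :=
  fun n i o => x (tau n i) o.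

Lemma at_pts_adapted T (tau : pseq T) x : adapted F x -> arr_adapted tau (at_pts tau x).
Proof. by move=> ax n i; apply: ax; apply: ppt_ge0. Qed.

Lemma at_pts_tight T (tau : pseq T) x : 0 <= T -> adapted F x -> continuous_paths x ->
  tight P (at_pts tau x).
Proof.
move=> T0 ax cx e e0.
have mx t : 0 <= t -> measurable_fun setT (x t) by move=> t0; apply: sub_measurable_fun (ax t t0).
have [K K0 hK] := bounded_outer P T0 mx cx e0; exists K => //.
near=> n; apply: outer_leS hK => o [i Ki]; exists (tau n i); split => //.
exact: ppt_itv.
Unshelve. all: by end_near. Qed.

Lemma incr_cv0 T (tau : pseq T) x : 0 <= T -> adapted F x -> continuous_paths x ->
  mesh0 tau -> cv0 P (incr tau x).
Proof.
move=> T0 ax cx m e e0.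
have mx t : 0 <= t -> measurable_fun setT (x t) by move=> t0; apply: sub_measurable_fun (ax t t0).
have [delta d0 hK] := modulus_outer P T0 mx cx e0 e0.
near=> n; apply: outer_leS hK => o [i Ki]; exists (tau n i.+1), (tau n i).
split; rewrite ?ppt_itv//.
rewrite ger0_norm ?subr_ge0 ?ppt_leS//.
by move: i {Ki}; near: n; exact: m.
Unshelve. all: by end_near. Qed.

Lemma incr_incr_adapted T (tau : pseq T) x : adapted F x -> incr_adapted tau (incr tau x).
Proof.
move=> ax n i; apply: sub_measurableB; first exact/filtration_sigma/ppt_ge0.
  by apply: ax; apply: ppt_ge0.
by apply: sub_measurable_mono (ax _ (ppt_ge0 tau n i)); rewrite ?ppt_ge0 ?ppt_leS.
Qed.

Lemma semimartingale_integ x T (tau : pseq T) : 0 <= T -> semimartingale P F x ->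
  integ tau (incr tau x).
Proof.
move=> T0 [ax cx ix]; apply: integ_of_eps; first exact: incr_incr_adapted.
  by move=> n i o Ni; rewrite /incr !ppt_end// ?subrr// leqW.
move=> e e0; have [delta d0 hd] := ix T T0 e e0; exists delta => // n h ah bh.
have := hd _ (pseq_seq_partition tau n) h; rewrite size_pseq_seq.
move=> /(_ (fun i _ => _) bh) /=.
have mS : measurable [set o | e <= `|\sum_(0 <= i < psize tau n) h i o * incr tau x n i o|].
  have [_ FT _] := hF; apply: (FT T T0); apply: sub_measurable_ge.
  apply: sub_measurable_norm.
  apply: (sub_measurable_sum (filtration_sigma T0)) => i.
  have s := filtration_sigma T0; apply: sub_measurableM => //.
    by apply: sub_measurable_mono (ah i); rewrite ?ppt_ge0 ?ppt_leT.
  by apply: sub_measurable_mono (incr_incr_adapted tau ax n i); rewrite ?ppt_ge0 ?ppt_leT.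
move=> hh; apply/outer_le_measurable => //.
rewrite (_ : [set _ | _] = [set omega | e <=
   `|\sum_(0 <= i < psize tau n)
        h i omega *
        (x (pt 0 T (pseq_seq tau n) i.+1) omega - x (pt 0 T (pseq_seq tau n) i) omega)|]).
  by apply: hh => i; rewrite pt_pseq_seq.
apply/funext => o /=; congr (is_true (_ <= `|_|)).
by apply: eq_bigr => i _; rewrite !pt_pseq_seq.
Qed.

(** If no [delta] works for [e], then for each [n] some partition and some weights bounded by 1 / (n
    + 1) violate the estimate; together they form a vanishing array that contradicts [integ]. The
    mesh of these partitions is not under control, which is why [integ] is asked for along every
    sequence of partitions. *)
Lemma integ_semimartingale x : adapted F x -> continuous_paths x ->
  (forall T (tau : pseq T), 0 <= T -> integ tau (incr tau x)) -> semimartingale P F x.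
Proof.
move=> ax cx ix; split=> // T T0 e e0; apply: contrapT => nex.
have bad n : exists sH : seq R * (nat -> Omega -> R),
   [/\ itv_partition 0 T sH.1,
     forall i, (i < size sH.1)%N -> sub_measurable (F (pt 0 T sH.1 i)) (sH.2 i),
     forall i omega, `|sH.2 i omega| <= n.+1%:R^-1 &
     ~ (P [set omega | (e <= `|\sum_(0 <= i < size sH.1) sH.2 i omega *
                (x (pt 0 T sH.1 i.+1) omega - x (pt 0 T sH.1 i) omega)|)%R] <= e%:E)%E].
  apply: contrapT => nbad; apply: nex; exists n.+1%:R^-1; first by rewrite invr_gt0.
  move=> s sP H mH bH; apply: contrapT => nP; apply: nbad; exists (s, H); split=> //.
have [sH hsH] := choice bad.
have sP n : itv_partition 0 T (sH n).1 by case: (hsH n).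
pose tau := pseq_of_seq sP.
(* The weights are known to be adapted only inside the partition, so they are replaced by 0 beyond
   it. *)
pose h n i o := if (i < psize tau n)%N then (sH n).2 i o else 0.
have ah : arr_adapted tau h.
  move=> n i; rewrite /h; have [iN|iN] := boolP (i < psize tau n)%N.
    by case: (hsH n) => _ + _ _; apply.
  by apply: sub_measurable_cst; apply: filtration_sigma; apply: ppt_ge0.
have ch : cv0 P h.
  apply: (@cv0_of_bound _ _ _ _ (fun n => n.+1%:R^-1)); first exact: cvg_harmonic.
  move=> n i o; rewrite /h; case: ifP => _; first by case: (hsH n).
  by rewrite normr0 invr_ge0.
have [/(_ h ah ch e e0) [n _ /(_ n (leqnn n)) /= ho] _] := ix T tau T0.
have [_ _ _ []] := hsH n.
apply/outer_le_measurable; last first.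
  apply: outer_leS ho => o /= ho; exists (size (sH n).1).
  move: ho; rewrite /psum big_nat_cond [X in _ -> _ <= `|X|]big_nat_cond.
  rewrite (eq_bigr (fun i => h n i o * incr tau x n i o))// => i /andP[/andP[_ iN] _].
  by rewrite /h iN.
have [_ FT _] := hF; apply: (FT T T0); apply: sub_measurable_ge.
apply: sub_measurable_norm.
rewrite (_ : (fun _ => _) = psum (fun n i o => h n i o * incr tau x n i o) n (size (sH n).1)).
  have := psum_adapted (incr_adaptedM (arr_adapted_incr ah) (incr_incr_adapted tau ax)).
  by move=> /(_ n (size (sH n).1)); apply: sub_measurable_mono; rewrite ?ppt_ge0 ?ppt_leT.
apply/funext => o; rewrite /psum big_nat_cond [RHS]big_nat_cond.
by apply: eq_bigr => i /andP[/andP[_ iN] _]; rewrite /h iN.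
Qed.

(** The sum of squared increments is [x_k^2 - x_0^2 - 2 sum x_i (x_(i+1) - x_i)]; the last sum is
    tight because [x] is an integrator, and the other terms because its paths are bounded on
    [[0, T]]. *)
Lemma qv_tight x T (tau : pseq T) : 0 <= T -> adapted F x -> continuous_paths x ->
  integ tau (incr tau x) -> tight P (psum (fun n i o => incr tau x n i o ^+ 2)).
Proof.
move=> T0 ax cx ix; have tx := at_pts_tight tau T0 ax cx; have aax := at_pts_adapted tau ax.
pose x0 n (i : nat) o := at_pts tau x n 0%N o.
have tx0 : tight P x0 by apply: tight_le tx => n i o; exists 0%N.
have := tightD (tightD (tightM tx tx) (tightZ (-1) (tightM tx0 tx0))) (tightZ (-2) (ix.2 _ aax tx)).
apply: tight_ext => n; elim=> [|k IH] o; rewrite ?psum0 ?psumS ?IH.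
  by rewrite /x0; ring.
by rewrite /incr /at_pts /x0; ring.
Qed.

End Integrators.

(** * Stability of semimartingales under sums, products and the inverse square root *)

Section Semimartingales.
Context d (Omega : measurableType d) (R : realType) (P : probability Omega R).
Variable F : R -> set (set Omega).
Hypothesis hF : filtration F.
Implicit Types x y u : R -> Omega -> R.

Lemma continuous_pathsD x y : continuous_paths x -> continuous_paths y ->
  continuous_paths (fun t o => x t o + y t o).
Proof. by move=> cx cy o t; apply: cvgD; [exact: cx|exact: cy]. Qed.

Lemma continuous_pathsM x y : continuous_paths x -> continuous_paths y ->
  continuous_paths (fun t o => x t o * y t o).
Proof. by move=> cx cy o t; apply: cvgM; [exact: cx|exact: cy]. Qed.

Lemma continuous_paths_comp (f : R -> R) x : (forall t o, 0 <= t -> {for x t o, continuous f}) ->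
  continuous_paths x -> continuous_paths (fun t o => f (x t o)).
Proof.
move=> cf cx o; apply/subspace_continuousP => t t0.
have /subspace_continuousP /(_ t t0) h := cx o.
apply: continuous_cvg h; apply: cf.
by move: t0; rewrite /= in_itv /= andbT.
Qed.

Lemma adaptedD x y : adapted F x -> adapted F y -> adapted F (fun t o => x t o + y t o).
Proof. by move=> ax ay t t0; apply: sub_measurableD (ax t t0) (ay t t0); apply: filtration_sigma. Qed.

Lemma adaptedM x y : adapted F x -> adapted F y -> adapted F (fun t o => x t o * y t o).
Proof. by move=> ax ay t t0; apply: sub_measurableM (ax t t0) (ay t t0); apply: filtration_sigma. Qed.

Lemma semimartingale_cst c : semimartingale P F (fun _ _ => c).
Proof.
apply: (integ_semimartingale hF).
- by move=> t t0; apply: sub_measurable_cst; apply: filtration_sigma.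
- by move=> o t; apply: cvg_cst.
- move=> T tau T0; apply: negl_integ => h _ _.
  apply: (@cv0_of_bound _ _ _ _ (fun=> 0)) => [|n k o]; first exact: cvg_cst.
  by rewrite /psum big1 ?normr0// => i _; rewrite /incr subrr mulr0.
Qed.

Lemma semimartingaleD x y : semimartingale P F x -> semimartingale P F y ->
  semimartingale P F (fun t o => x t o + y t o).
Proof.
move=> sx sy; have [ax cx _] := sx; have [ay cy _] := sy.
apply: (integ_semimartingale hF); [exact: adaptedD|exact: continuous_pathsD|].
move=> T tau T0.
have := integD (semimartingale_integ hF tau T0 sx) (semimartingale_integ hF tau T0 sy).
by apply: integ_ext => n i o; rewrite /incr; ring.
Qed.

(** The increment of [x y] is [x dy + y dx + dx dy]: two weighted integrators, and a term dominated
    by the squares of the increments. *)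
Lemma semimartingaleM x y : semimartingale P F x -> semimartingale P F y ->
  semimartingale P F (fun t o => x t o * y t o).
Proof.
move=> sx sy; have [ax cx _] := sx; have [ay cy _] := sy.
apply: (integ_semimartingale hF); [exact: adaptedM|exact: continuous_pathsM|].
move=> T tau T0.
have ix := semimartingale_integ hF tau T0 sx; have iy := semimartingale_integ hF tau T0 sy.
have i1 := integ_weight hF (at_pts_adapted tau ax) (at_pts_tight P hF tau T0 ax cx) iy.
have i2 := integ_weight hF (at_pts_adapted tau ay) (at_pts_tight P hF tau T0 ay cy) ix.
have i3 : integ P F tau (fun n i o => incr tau x n i o * incr tau y n i o).
  apply: (@integ_dom _ _ _ _ _ _ _ _ (fun _ _ _ => 1)
     (fun n i o => incr tau x n i o ^+ 2 + incr tau y n i o ^+ 2)).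
  - by move=> n i o; rewrite addr_ge0// sqr_ge0.
  - have := tightD (qv_tight hF T0 ax cx ix) (qv_tight hF T0 ay cy iy).
    by apply: tight_ext => n i o; rewrite psumD.
  - exact: tight_cst.
  - move=> n i o; rewrite normr1 mul1r ler_norml; set a := incr _ _ _ _ _; set b := incr _ _ _ _ _.
    have := sqr_ge0 (a + b); have := sqr_ge0 (a - b); have := sqr_ge0 a; have := sqr_ge0 b.
    by move=> h1 h2 h3 h4; apply/andP; split; nra.
by apply: integ_ext (integD (integD i1 i2) i3) => n i o; rewrite /incr /at_pts; ring.
Qed.

Lemma semimartingaleZ c x : semimartingale P F x -> semimartingale P F (fun t o => c * x t o).
Proof. by apply: semimartingaleM; apply: semimartingale_cst. Qed.

Lemma semimartingaleB x y : semimartingale P F x -> semimartingale P F y ->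
  semimartingale P F (fun t o => x t o - y t o).
Proof.
move=> sx sy; have := semimartingaleD sx (semimartingaleZ (-1) sy).
rewrite (_ : (fun _ _ => _) = fun t o => x t o - y t o)//.
by apply/funext => t; apply/funext => o; rewrite mulN1r.
Qed.

Lemma semimartingale_sum (I : Type) (r : seq I) (x : I -> R -> Omega -> R) :
  (forall i, semimartingale P F (x i)) ->
  semimartingale P F (fun t o => \sum_(i <- r) x i t o).
Proof.
move=> sx; elim: r => [|i r IH].
  rewrite (_ : (fun _ _ => _) = fun _ _ => 0); first exact: semimartingale_cst.
  by apply/funext => t; apply/funext => o; rewrite big_nil.
rewrite (_ : (fun _ _ => _) = fun t o => x i t o + \sum_(j <- r) x j t o).
  exact: semimartingaleD.
by apply/funext => t; apply/funext => o; rewrite big_cons.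
Qed.

(** Taylor's formula for [r = u^(-1/2)], whose derivative is [- r^3 / 2]: the linear term is a
    weighted integrator, and the remainder is dominated by the squared increments of [u] with a
    tight coefficient. *)
Lemma semimartingale_invsqrt u : (forall t o, 0 <= t -> 0 < u t o) ->
  semimartingale P F u -> semimartingale P F (fun t o => (Num.sqrt (u t o))^-1).
Proof.
move=> u0 su; have [au cu _] := su; set r := fun t o => _.
have ar : adapted F r.
  move=> t t0; pose f := (fun z : R => (Num.sqrt z)^-1) \_ `]0, +oo[.
  have rf o : r t o = f (u t o) by rewrite /f patchE mem_set// /= in_itv /= u0.
  rewrite (funext rf); apply: sub_measurable_comp (au t t0).
  apply: (iffLR (measurable_restrictT (fun z : R => (Num.sqrt z)^-1) (measurable_itv `]0, +oo[))).
  apply: open_continuous_measurable_fun; first exact: itv_open_ends_open.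
  move=> z.
  rewrite inE /= in_itv /= andbT => z0; apply: cvgV; first by rewrite gt_eqF ?sqrtr_gt0.
  exact: sqrt_continuous.
have cr : continuous_paths r.
  apply: (@continuous_paths_comp (fun z => (Num.sqrt z)^-1)) cu => t o t0.
  apply: cvgV; first by rewrite gt_eqF// sqrtr_gt0 u0.
  exact: sqrt_continuous.
apply: (integ_semimartingale hF) => // T tau T0.
have iu := semimartingale_integ hF tau T0 su.
have tr := at_pts_tight P hF tau T0 ar cr; have aar := at_pts_adapted tau ar.
have tr1 : tight P (fun n i o => r (tau n i.+1) o) by apply: tight_le tr => n i o; exists i.+1.
have i1 := integ_weight hF (arr_adaptedM hF (@arr_adapted_cst _ _ _ _ hF _ tau (- 2^-1)) (arr_adaptedM hF aar (arr_adaptedM hF aar aar)))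
  (tightM (tight_cst P (- 2^-1)) (tightM tr (tightM tr tr))) iu.
have i2 : integ P F tau (fun n i o => incr tau r n i o + 2^-1 * r (tau n i) o ^+ 3 * incr tau u n i o).
  apply: (@integ_dom _ _ _ _ _ _ _ _ (fun n i o => (at_pts tau r n i o * at_pts tau r n i o)
       * ((at_pts tau r n i o * at_pts tau r n i o) * r (tau n i.+1) o))
     (fun n i o => incr tau u n i o ^+ 2)).
  - by move=> n i o; rewrite sqr_ge0.
  - exact: (qv_tight hF T0 au cu iu).
  - by apply: tightM; [exact: tightM|apply: tightM => //; exact: tightM].
  - move=> n i o; rewrite /incr /at_pts.
    have rE t : 0 <= t -> 0 < r t o /\ u t o = (r t o ^+ 2)^-1.
      move=> t0; rewrite /r invr_gt0 sqrtr_gt0 u0// exprVn invrK sqr_sqrtr//.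
      by apply/ltW/u0.
    have [a0 ->] := rE _ (ppt_ge0 tau n i); have [b0 ->] := rE _ (ppt_ge0 tau n i.+1).
    move: (r (tau n i) o) (r (tau n i.+1) o) a0 b0 => a b a0 b0.
    (* Substituting [u = r^-2] makes the remainder rational in the end values [a], [b] of [r], with
       the squared increment of [u] as a factor. The middle quotient lies in [0, 1], so [a^4 b]
       bounds the coefficient, and no positive lower bound for [u] is required. *)
    have -> : b - a + 2^-1 * a ^+ 3 * ((b ^+ 2)^-1 - (a ^+ 2)^-1) =
      (a * a * (a * a * b)) * ((b * (a + 2 * b)) / (2 * (a + b) ^+ 2)) * ((b ^+ 2)^-1 - (a ^+ 2)^-1) ^+ 2.
      by field; rewrite !gt_eqF//= addr_gt0.
    have p0 : 0 < a * a * (a * a * b) by rewrite !mulr_gt0.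
    have ab : 0 < (a + b) ^+ 2 by rewrite exprn_gt0// addr_gt0.
    have q00 : 0 <= b * (a + 2 * b) / (2 * (a + b) ^+ 2).
      apply: divr_ge0; last by rewrite mulr_ge0// ltW.
      by apply: mulr_ge0; lra.
    have q01 : b * (a + 2 * b) / (2 * (a + b) ^+ 2) <= 1.
      have ab2 : 0 < 2 * (a + b) ^+ 2 by rewrite mulr_gt0.
      rewrite ler_pdivrMr // mul1r.
      have := mulr_gt0 a0 b0; have := mulr_gt0 a0 a0; nra.
    have s0 := sqr_ge0 ((b ^+ 2)^-1 - (a ^+ 2)^-1).
    move: p0 q00 q01 s0; set A := a * a * _; set Q := b * _ / _; set D := _ ^+ 2 => p0 q00 q01 s0.
    rewrite normrM (ger0_norm s0) ler_wpM2r// normrM (ger0_norm q00) (gtr0_norm p0).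
    by rewrite ler_piMr// ltW.
by apply: integ_ext (integD i1 i2) => n i o; rewrite /incr /at_pts; ring.
Qed.

End Semimartingales.

(** * Germs and sewing *)

Section Germs.
Context d (Omega : measurableType d) (R : realType) (P : probability Omega R).
Variable F : R -> set (set Omega).
Hypothesis hF : filtration F.
Implicit Types (x y z : R -> Omega -> R) (G H K : R -> R -> Omega -> R).

Definition germ_arr T (tau : pseq T) G := fun n i o => G (tau n i) (tau n i.+1) o.
Definition dgerm x := fun s t o => x t o - x s o.
Definition mgerm x := fun s t o => 2^-1 * (x s o + x t o).

Definition germ_adapted G := forall s t, 0 <= s -> s <= t -> sub_measurable (F t) (G s t).

(* First-order germs; products of two behave like brackets, and products of
   three are negligible. *)
Definition first_order G := germ_adapted G /\
  forall T (tau : pseq T), 0 <= T -> mesh0 tau ->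
  [/\ integ P F tau (germ_arr tau G),
      tight P (psum (fun n i o => germ_arr tau G n i o ^+ 2)) &
      cv0 P (germ_arr tau G)].

Definition negligible_germ G := germ_adapted G /\
  forall T (tau : pseq T), 0 <= T -> mesh0 tau -> negl P F tau (germ_arr tau G).

(** Weights are described by their effect, as multipliers of both classes. Values at the left end
    qualify by adaptedness; values at the right end, which are not known at the start of the step,
    qualify as left value plus increment. *)
Definition germ_weight K := [/\ germ_adapted K,
  forall G, first_order G -> first_order (fun s t o => K s t o * G s t o) &
  forall G, negligible_germ G -> negligible_germ (fun s t o => K s t o * G s t o)].

Lemma germ_ext (C : (R -> R -> Omega -> R) -> Prop) G H :
  (forall s t o, G s t o = H s t o) -> C H -> C G.
Proof.
move=> GH CH; rewrite (_ : G = H)//.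
by apply/funext => s; apply/funext => t; apply/funext => o.
Qed.

Lemma germ_arr_adapted G T (tau : pseq T) : germ_adapted G -> incr_adapted F tau (germ_arr tau G).
Proof. by move=> aG n i; apply: aG; rewrite ?ppt_ge0 ?ppt_leS. Qed.

Lemma germ_adaptedD G H : germ_adapted G -> germ_adapted H ->
  germ_adapted (fun s t o => G s t o + H s t o).
Proof.
move=> aG aH s t s0 st; apply: sub_measurableD (aG s t s0 st) (aH s t s0 st).
exact: filtration_sigma (le_trans s0 st).
Qed.

Lemma germ_adaptedM G H : germ_adapted G -> germ_adapted H ->
  germ_adapted (fun s t o => G s t o * H s t o).
Proof.
move=> aG aH s t s0 st; apply: sub_measurableM (aG s t s0 st) (aH s t s0 st).
exact: filtration_sigma (le_trans s0 st).
Qed.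

Lemma germ_adapted_left x : adapted F x -> germ_adapted (fun s t o => x s o).
Proof. by move=> ax s t s0 st; apply: (sub_measurable_mono hF s0 st); apply: ax. Qed.

Lemma germ_adapted_right x : adapted F x -> germ_adapted (fun s t o => x t o).
Proof. by move=> ax s t s0 st; apply: ax; apply: le_trans st. Qed.

Lemma germ_adapted_cst c : germ_adapted (fun _ _ _ => c).
Proof. by move=> s t s0 st; apply: sub_measurable_cst; apply: (filtration_sigma hF (le_trans s0 st)). Qed.

Lemma negligibleD G H : negligible_germ G -> negligible_germ H ->
  negligible_germ (fun s t o => G s t o + H s t o).
Proof.
move=> [aG nG] [aH nH]; split; first exact: germ_adaptedD.
by move=> T tau T0 m; apply: neglD; [exact: nG|exact: nH].
Qed.

Lemma negligible_first_orderM G H : negligible_germ G -> first_order H ->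
  negligible_germ (fun s t o => G s t o * H s t o).
Proof.
move=> [aG nG] [aH fH]; split; first exact: germ_adaptedM.
move=> T tau T0 m; have [iH _ _] := fH T tau T0 m.
by apply: (negl_integM hF) (nG T tau T0 m) iH; apply: germ_arr_adapted.
Qed.

(** A negligible germ is in particular an integrator, so summation by parts against itself makes
    even the sums of its squares tend to 0. A single term is small as the difference of two
    consecutive partial sums. *)
Lemma negligible_first_order G : negligible_germ G -> first_order G.
Proof.
move=> [aG nG]; split=> // T tau T0 m; have ng := nG T tau T0 m; split.
- exact: negl_integ.
- have aga := germ_arr_adapted tau aG.
  have := negl_integM hF aga aga ng (negl_integ ng).
  move=> /(_ _ (@arr_adapted_cst _ _ _ _ hF T tau 1) (tight_cst P 1))/cv0_tight.
  by apply: tight_ext => n k o; apply: eq_bigr => i _; rewrite mul1r.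
- have c1 : cv0 P (psum (germ_arr tau G)).
    have := ng _ (@arr_adapted_cst _ _ _ _ hF T tau 1) (tight_cst P 1).
    by apply: cv0_ext => n k o; apply: eq_bigr => i _; rewrite mul1r.
  have c2 : cv0 P (fun n i o => psum (germ_arr tau G) n i.+1 o).
    by apply: cv0_le_ae c1; apply: aeW => o n i; exists i.+1.
  by apply: cv0_ext (cv0D c2 (cv0Z (-1) c1)) => n i o; rewrite psumS; ring.
Qed.

Lemma first_orderD G H : first_order G -> first_order H ->
  first_order (fun s t o => G s t o + H s t o).
Proof.
move=> [aG nG] [aH nH]; split; first exact: germ_adaptedD.
move=> T tau T0 m; have [iG qG cG] := nG T tau T0 m; have [iH qH cH] := nH T tau T0 m; split.
- exact: integD.
- apply: tight_le (tightD (tightZ 2 qG) (tightZ 2 qH)) => n k o; exists k.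
  rewrite /psum ger0_norm; last by apply: sumr_ge0 => i _; apply: sqr_ge0.
  rewrite (le_trans _ (ler_norm _))// !mulr_sumr -big_split /=.
  apply: ler_sum => i _; rewrite /germ_arr.
  set a := G _ _ _; set b := H _ _ _; have := sqr_ge0 (a - b); rewrite sqrrB sqrrD; lra.
- exact: cv0D.
Qed.

Lemma first_orderM G H : first_order G -> first_order H ->
  first_order (fun s t o => G s t o * H s t o).
Proof.
move=> [aG nG] [aH nH]; split; first exact: germ_adaptedM.
move=> T tau T0 m; have [iG qG cG] := nG T tau T0 m; have [iH qH cH] := nH T tau T0 m; split.
- apply: (@integ_dom _ _ _ _ _ _ _ _ (fun _ _ _ => 1)
     (fun n i o => germ_arr tau G n i o ^+ 2 + germ_arr tau H n i o ^+ 2)).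
  + by move=> n i o; rewrite addr_ge0// sqr_ge0.
  + by apply: tight_ext (tightD qG qH) => n i o; rewrite psumD.
  + exact: tight_cst.
  + move=> n i o; rewrite normr1 mul1r ler_norml /germ_arr; set a := G _ _ _; set b := H _ _ _.
    have := sqr_ge0 (a + b); have := sqr_ge0 (a - b); have := sqr_ge0 a; have := sqr_ge0 b.
    by move=> h1 h2 h3 h4; apply/andP; split; nra.
- apply: (psum_dom_tight (c := fun n i o => germ_arr tau G n i o * germ_arr tau G n i o)
     _ qH) => [n i o|n i o|]; first exact: sqr_ge0.
    by rewrite /germ_arr exprMn normrM -expr2 (@ger0_norm _ (H _ _ _ ^+ 2)) ?sqr_ge0.
  by apply: tightM; apply: cv0_tight.
- by apply: cv0_tightM => //; apply: cv0_tight.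
Qed.

Lemma negligible3 G H K : first_order G -> first_order H -> first_order K ->
  negligible_germ (fun s t o => G s t o * H s t o * K s t o).
Proof.
move=> [aG nG] [aH nH] [aK nK]; split; first by apply: germ_adaptedM => //; exact: germ_adaptedM.
move=> T tau T0 m; have [iG qG cG] := nG T tau T0 m; have [iH qH cH] := nH T tau T0 m.
have [iK qK cK] := nK T tau T0 m.
apply: (@negl_dom _ _ _ _ _ _ _ _ (germ_arr tau G)
     (fun n i o => germ_arr tau H n i o ^+ 2 + germ_arr tau K n i o ^+ 2)) => //.
- by move=> n i o; rewrite addr_ge0// sqr_ge0.
- by apply: tight_ext (tightD qH qK) => n i o; rewrite psumD.
- move=> n i o; rewrite /germ_arr -mulrA normrM ler_wpM2l// ler_norml.
  set a := H _ _ _; set b := K _ _ _.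
  have := sqr_ge0 (a + b); have := sqr_ge0 (a - b); have := sqr_ge0 a; have := sqr_ge0 b.
  by move=> h1 h2 h3 h4; apply/andP; split; nra.
Qed.

Lemma negligible_ae G : germ_adapted G ->
  {ae P, forall o, forall s t, 0 <= s -> s <= t -> G s t o = 0} -> negligible_germ G.
Proof.
move=> aG G0; split=> // T tau T0 m h ah th.
have c0 : cv0 P (fun (_ _ : nat) (_ : Omega) => 0 : R).
  by apply: (@cv0_of_bound _ _ _ _ (fun=> 0)) => [|n i o]; [exact: cvg_cst|rewrite normr0].
apply: cv0_le_ae c0; apply: filterS G0 => o Go n k; exists 0%N.
rewrite normr0 /psum big1 ?normr0// => i _.
by rewrite /germ_arr Go ?mulr0 ?ppt_ge0 ?ppt_leS.
Qed.

Lemma weightD G H : germ_weight G -> germ_weight H -> germ_weight (fun s t o => G s t o + H s t o).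
Proof.
move=> [aG fG nG] [aH fH nH]; split; first exact: germ_adaptedD.
- move=> K fK; apply: germ_ext (first_orderD (fG K fK) (fH K fK)) => s t o; exact: mulrDl.
- move=> K fK; apply: germ_ext (negligibleD (nG K fK) (nH K fK)) => s t o; exact: mulrDl.
Qed.

Lemma weightM G H : germ_weight G -> germ_weight H -> germ_weight (fun s t o => G s t o * H s t o).
Proof.
move=> [aG fG nG] [aH fH nH]; split; first exact: germ_adaptedM.
- move=> K fK; apply: germ_ext (fG _ (fH K fK)) => s t o; by rewrite mulrA.
- move=> K fK; apply: germ_ext (nG _ (nH K fK)) => s t o; by rewrite mulrA.
Qed.

Lemma first_order_weight G : first_order G -> germ_weight G.
Proof.
move=> fG; split; first by case: fG.
- by move=> K; apply: first_orderM.
- move=> K nK; apply: germ_ext (negligible_first_orderM nK fG) => s t o; exact: mulrC.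
Qed.

Lemma weight_left x : adapted F x -> continuous_paths x -> germ_weight (fun s t o => x s o).
Proof.
move=> ax cx; have aL := germ_adapted_left ax; split=> // G [aG hG]; split; try exact: germ_adaptedM.
- move=> T tau T0 m; have [iG qG cG] := hG T tau T0 m.
  have tx := at_pts_tight P hF tau T0 ax cx; split.
  + by apply: (integ_weight hF) iG => //; apply: at_pts_adapted.
  + apply: (psum_dom_tight (c := fun n i o => at_pts tau x n i o * at_pts tau x n i o)
     _ qG) => [n i o|n i o|]; [exact: sqr_ge0| |exact: tightM].
    by rewrite /germ_arr /at_pts exprMn normrM -expr2 (@ger0_norm _ (G _ _ _ ^+ 2)) ?sqr_ge0.
  + by apply: cv0_tightM cG.
- move=> T tau T0 m; have nG := hG T tau T0 m.
  have tx := at_pts_tight P hF tau T0 ax cx.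
  by apply: (negl_weight hF) nG => //; apply: at_pts_adapted.
Qed.

Lemma weight_cst c : germ_weight (fun _ _ _ => c).
Proof.
apply: (@weight_left (fun _ _ => c)); last by move=> o t; apply: cvg_cst.
by move=> t t0; apply: sub_measurable_cst; apply: filtration_sigma.
Qed.

Lemma first_order_dgerm x : semimartingale P F x -> first_order (dgerm x).
Proof.
move=> sx; have [ax cx _] := sx; split.
  move=> s t s0 st; apply: sub_measurableB; first exact: (filtration_sigma hF (le_trans s0 st)).
    by apply: ax; apply: le_trans st.
  exact: (sub_measurable_mono hF s0 st (ax s s0)).
move=> T tau T0 m; have ix := semimartingale_integ hF tau T0 sx; split=> //.
  exact: (qv_tight hF T0 ax cx ix).
exact: (incr_cv0 P hF T0 ax cx m).
Qed.

Lemma weight_right x : semimartingale P F x -> germ_weight (fun s t o => x t o).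
Proof.
move=> sx; have [ax cx _] := sx.
have := weightD (weight_left ax cx) (first_order_weight (first_order_dgerm sx)).
by apply: germ_ext => s t o; rewrite /dgerm; ring.
Qed.

Lemma weight_mgerm x : semimartingale P F x -> germ_weight (mgerm x).
Proof.
move=> sx; have [ax cx _] := sx; apply: weightM (weight_cst _) _.
exact: weightD (weight_left ax cx) (weight_right sx).
Qed.

Lemma negligibleZ c G : negligible_germ G -> negligible_germ (fun s t o => c * G s t o).
Proof. by have [_ _] := weight_cst c; apply. Qed.

Lemma first_orderZ c G : first_order G -> first_order (fun s t o => c * G s t o).
Proof. by have [_ + _] := weight_cst c; apply. Qed.

(** The one-step trapezoids of [x o dy], closed under sums and negligible errors. Being inductive,
    the class reduces its properties, above all coherence under refinement, to the base germs. *)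
Inductive stratonovich_germ : (R -> R -> Omega -> R) -> Prop :=
| strat_base x y : semimartingale P F x -> semimartingale P F y ->
    stratonovich_germ (fun s t o => mgerm x s t o * dgerm y s t o)
| strat_add G H : stratonovich_germ G -> stratonovich_germ H ->
    stratonovich_germ (fun s t o => G s t o + H s t o)
| strat_negligible G H : stratonovich_germ G ->
    negligible_germ (fun s t o => H s t o - G s t o) -> stratonovich_germ H.

Lemma strat_first_order G : stratonovich_germ G -> first_order G.
Proof.
elim=> {G} [x y sx sy|G H _ fG _ fH|G H _ fG nH].
- by have [_ + _] := weight_mgerm sx; apply; apply: first_order_dgerm.
- exact: first_orderD.
- apply: germ_ext (first_orderD fG (negligible_first_order nH)) => s t o; ring.
Qed.

(** The product of the means of [x] and [y] differs from the mean of [x y] by [- dx dy / 4], which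
    becomes a product of three increments once multiplied by [dz]. *)
Lemma strat_mgerm x G : semimartingale P F x -> stratonovich_germ G ->
  stratonovich_germ (fun s t o => mgerm x s t o * G s t o).
Proof.
move=> sx; elim=> {G} [y z sy sz|G H _ fG _ fH|G H _ fG nH].
- apply: (strat_negligible (strat_base (semimartingaleM hF sx sy) sz)).
  have := negligibleZ (- 4^-1) (negligible3 (first_order_dgerm sx) (first_order_dgerm sy) (first_order_dgerm sz)).
  by apply: germ_ext => s t o; rewrite /mgerm /dgerm; field.
- by apply: germ_ext (strat_add fG fH) => s t o; rewrite mulrDr.
- apply: strat_negligible fG _; have [_ _ /(_ _ nH)] := weight_mgerm sx.
  by apply: germ_ext => s t o; rewrite mulrBr.
Qed.

Lemma strat_cstM c G : stratonovich_germ G -> stratonovich_germ (fun s t o => c * G s t o).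
Proof.
move=> sG; apply: germ_ext (strat_mgerm (semimartingale_cst P hF c) sG) => s t o.
by rewrite /mgerm; field.
Qed.

End Germs.

(** * Refinement of partitions and sewing *)

Lemma sum_shift (R : realType) (f : nat -> R) a m :
  \sum_(a <= l < a + m) f l = \sum_(0 <= j < m) f (a + j)%N.
Proof. by rewrite -{1}[a]add0n big_addn addKn; apply: eq_bigr => j _; rewrite addnC. Qed.

Section Refinement.
Context (R : realType).
Implicit Types (t : nat -> R) (M l i j : nat).

(* Each interval of the partition t is cut into M equal pieces. *)
Definition refine_pt t M l : R :=
  t (l %/ M)%N + (l %% M)%:R / M%:R * (t (l %/ M).+1 - t (l %/ M)%N).

Lemma refine_ptE t M i j : (0 < M)%N -> (j <= M)%N ->
  refine_pt t M (i * M + j) = t i + j%:R / M%:R * (t i.+1 - t i).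
Proof.
move=> M0; rewrite leq_eqVlt => /orP[/eqP -> |jM].
  rewrite -mulSnr /refine_pt mulnK// modnMl mul0r mul0r addr0 divff ?mul1r.
    by ring.
  by rewrite pnatr_eq0 -lt0n.
by rewrite /refine_pt divnMDl// divn_small// addn0 modnMDl modn_small.
Qed.

Lemma refine_ptM t M i : (0 < M)%N -> refine_pt t M (i * M) = t i.
Proof. by move=> M0; have := refine_ptE t i M0 (leq0n M); rewrite addn0 !mul0r addr0. Qed.

Lemma refine_ptS t M l : (0 < M)%N -> refine_pt t M l.+1 - refine_pt t M l =
  (t (l %/ M).+1 - t (l %/ M)%N) / M%:R.
Proof.
move=> M0; have jM := ltn_pmod l M0.
have := refine_ptE t (l %/ M)%N M0 jM; rewrite addnS -divn_eq => ->.
have := refine_ptE t (l %/ M)%N M0 (ltnW jM); rewrite -divn_eq => ->.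
rewrite -[(l %% M).+1%:R]natr1; field.
by rewrite pnatr_eq0 -lt0n.
Qed.

Variables (T : R) (tau : pseq T) (M : nat -> nat).
Hypothesis M0 : forall n, (0 < M n)%N.

Let rpt n l := refine_pt (tau n) (M n) l.

Let rpt0 n : rpt n 0%N = 0.
Proof. by rewrite /rpt -(mul0n (M n)) refine_ptM// ppt0. Qed.

Let rpt_lt n l : (l < psize tau n * M n)%N -> rpt n l < rpt n l.+1.
Proof.
move=> lN; rewrite -subr_gt0 /rpt refine_ptS// divr_gt0 ?ltr0n//.
by rewrite subr_gt0 ppt_ltS// ltn_divLR.
Qed.

Let rpt_end n l : (psize tau n * M n <= l)%N -> rpt n l = T.
Proof.
move=> Nl; have h : (psize tau n <= l %/ M n)%N by rewrite leq_divRL.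
by rewrite /rpt /refine_pt !ppt_end ?subrr ?mulr0 ?addr0// leqW.
Qed.

Definition refine : pseq T := Pseq rpt0 rpt_lt rpt_end.

Lemma refineM n i : refine n (i * M n) = tau n i.
Proof. exact: refine_ptM. Qed.

Lemma refine_itv n l : tau n (l %/ M n)%N <= refine n l <= tau n (l %/ M n).+1.
Proof.
apply/andP; split.
  by rewrite -[leLHS]refineM; apply: ppt_le; apply: leq_trunc_div.
by rewrite -[leRHS]refineM; apply: ppt_le; apply/ltnW/ltn_ceil.
Qed.

Lemma refine_mesh0 : mesh0 tau -> mesh0 refine.
Proof.
move=> m delta d0; near=> n => l.
rewrite /= /rpt refine_ptS// ltr_pdivrMr ?ltr0n//.
apply: (@lt_le_trans _ _ delta); last by rewrite ler_pMr// ler1n.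
by move: (l %/ M n)%N; near: n; apply: m.
Unshelve. all: by end_near. Qed.

Lemma sum_refine (a : nat -> R) n k :
  \sum_(0 <= l < k * M n) a l = \sum_(0 <= i < k) \sum_(0 <= j < M n) a (i * M n + j)%N.
Proof.
elim: k => [|k IH]; first by rewrite mul0n !big_nil.
rewrite big_nat_recr//= -IH mulSnr (@big_cat_nat _ _ _ (k * M n)) ?leq_addr//=; congr (_ + _).
by rewrite (sum_shift _ (k * M n)).
Qed.

End Refinement.

Section RefineStart.
Context (R : realType) (T : R) (tau : pseq T) (n i : nat).
Hypothesis iN : (i <= psize tau n)%N.

Let spt m l := refine_pt (tau n) m.+1 (minn l (i * m.+1)).

Let spt0 m : spt m 0%N = 0.
Proof. by rewrite /spt min0n -(mul0n m.+1) refine_ptM// ppt0. Qed.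

Let spt_lt m l : (l < i * m.+1)%N -> spt m l < spt m l.+1.
Proof.
move=> lN; rewrite /spt (minn_idPl lN) (minn_idPl (ltnW lN)) -subr_gt0 refine_ptS// divr_gt0 ?ltr0n//.
by rewrite subr_gt0 ppt_ltS// ltn_divLR// (leq_trans lN)// leq_mul2r iN orbT.
Qed.

Let spt_end m l : (i * m.+1 <= l)%N -> spt m l = tau n i.
Proof. by move=> Nl; rewrite /spt (minn_idPr Nl) refine_ptM. Qed.

(* The refinements of the first i intervals of one fixed partition. *)
Definition refine_start : pseq (tau n i) := Pseq spt0 spt_lt spt_end.

Lemma refine_startE m l : (l <= i * m.+1)%N -> refine_start m l = refine_pt (tau n) m.+1 l.
Proof. by move=> h; rewrite /= /spt (minn_idPl h). Qed.

Lemma refine_start_mesh0 : mesh0 refine_start.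
Proof.
move=> delta d0; have T0 : 0 <= T by rewrite (le_trans (ppt_ge0 tau n 0)) ?ppt_leT.
have c0 : 0 < delta / (T + 1) by rewrite divr_gt0// ltr_wpDl.
near=> m => l; have [lN|lN] := ltnP l (i * m.+1).
  rewrite !refine_startE ?(ltnW lN)// refine_ptS// ltr_pdivrMr//.
  have h : m.+1%:R^-1 < delta / (T + 1).
    by near: m; exact: (near_infty_natSinv_lt (PosNum c0)).
  have h1 : T + 1 < delta * m.+1%:R.
    by move: h; rewrite ltr_pdivlMr ?ltr_wpDl// ltr_pdivrMl// mulrC.
  have := ppt_leT tau n (l %/ m.+1).+1; have := ppt_ge0 tau n (l %/ m.+1)%N; lra.
rewrite (ppt_end (p := refine_start) (leqW lN)) (ppt_end (p := refine_start) lN).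
by rewrite subrr.
Unshelve. all: by end_near. Qed.

End RefineStart.

Section Sewing.
Context d (Omega : measurableType d) (R : realType) (P : probability Omega R).
Variable F : R -> set (set Omega).
Hypothesis hF : filtration F.
Implicit Types (x y z : R -> Omega -> R) (G H K : R -> R -> Omega -> R).

(** The numbers of pieces [M n] are arbitrary, without any bound in terms of [tau n]: sewing picks
    them only after the partitions are given. *)
Definition coherent G := forall T (tau : pseq T) M (M0 : forall n, (0 < M n)%N),
  0 <= T -> mesh0 tau -> negl P F tau (fun n i o => germ_arr tau G n i o -
    \sum_(0 <= j < M n) germ_arr (refine tau M0) G n (i * M n + j) o).

Lemma fine_weight T (tau : pseq T) M (M0 : forall n, (0 < M n)%N) h :
  arr_adapted F tau h -> arr_adapted F (refine tau M0) (fun n l => h n (l %/ M n)%N).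
Proof.
move=> ah n l; have /andP[h1 _] := refine_itv tau M0 n l.
by apply: (sub_measurable_mono hF (ppt_ge0 tau n _) h1); apply: ah.
Qed.

Lemma fine_tight (h : nat -> nat -> Omega -> R) (M : nat -> nat) :
  tight P h -> tight P (fun n l => h n (l %/ M n)%N).
Proof. by apply: tight_le => n l o; exists (l %/ M n)%N. Qed.

Lemma coherent_negligible G : negligible_germ P F G -> coherent G.
Proof.
move=> [aG nG] T tau M M0 T0 m h ah th.
have c1 := nG T tau T0 m h ah th.
have := nG T _ T0 (refine_mesh0 M0 m) _ (fine_weight M0 ah) (fine_tight M th).
set S := psum _ => cS.
have cS' : cv0 P (fun n k => S n (k * M n)%N).
  by apply: cv0_le_ae cS; apply: aeW => o n k; exists (k * M n)%N.
apply: cv0_ext (cv0D c1 (cv0Z (-1) cS')) => n k o.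
rewrite /S /psum sum_refine mulN1r -sumrB; apply: eq_bigr => i _.
rewrite mulrBr mulr_sumr; congr (_ - _).
apply: eq_big_nat => j /andP[_ jM].
by rewrite divnMDl// divn_small// addn0.
Qed.

Lemma coherentD G H : coherent G -> coherent H -> coherent (fun s t o => G s t o + H s t o).
Proof.
move=> cG cH T tau M M0 T0 m h ah th.
have := neglD (cG T tau M M0 T0 m) (cH T tau M M0 T0 m) ah th.
apply: cv0_ext => n k o; apply: eq_bigr => i _; congr (_ * _).
rewrite /germ_arr big_split /=; ring.
Qed.

Lemma dev_cv0 x T (tau : pseq T) M (M0 : forall n, (0 < M n)%N) : 0 <= T -> mesh0 tau ->
  adapted F x -> continuous_paths x ->
  cv0 P (fun n l o => x (refine tau M0 n l) o - x (tau n (l %/ M n)%N) o).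
Proof.
move=> T0 m ax cx e e0.
have mx t : 0 <= t -> measurable_fun setT (x t) by move=> t0; apply: (sub_measurable_fun hF t0 (ax t t0)).
have [delta d0 hK] := modulus_outer P T0 mx cx e0 e0.
near=> n; apply: outer_leS hK => o [i Ki]; exists (refine tau M0 n i), (tau n (i %/ M n)%N).
split; rewrite ?ppt_itv//.
have /andP[h1 h2] := refine_itv tau M0 n i.
rewrite ger0_norm ?subr_ge0// (@le_lt_trans _ _ (tau n (i %/ M n).+1 - tau n (i %/ M n)%N)) ?lerB//.
by move: (i %/ M n)%N; near: n; exact: m.
Unshelve. all: by end_near. Qed.

(** A coarse trapezoid minus its fine ones is the signed area between chord and polygon, the sum of
    [((y - y_i) dx - (x - x_i) dy) / 2] over the fine steps, with [x_i], [y_i] the values at the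
    start of the coarse step. These deviations are adapted and vanish uniformly, and [x], [y] are
    integrators. *)
Lemma coherent_base x y : semimartingale P F x -> semimartingale P F y ->
  coherent (fun s t o => mgerm x s t o * dgerm y s t o).
Proof.
move=> sx sy; have [ax cx _] := sx; have [ay cy _] := sy.
move=> T tau M M0 T0 m h ah th; pose r := refine tau M0.
have dev_ad z : adapted F z -> arr_adapted F r (fun n l o => z (r n l) o - z (tau n (l %/ M n)%N) o).
  move=> az n l; have s := filtration_sigma hF (ppt_ge0 r n l).
  apply: (sub_measurableB s); first exact: az (ppt_ge0 _ _ _).
  have /andP[h1 _] := refine_itv tau M0 n l.
  by apply: (sub_measurable_mono hF (ppt_ge0 tau n _) h1); apply: az; apply: ppt_ge0.
have c1 := (semimartingale_integ hF r T0 sx).1 _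
  (arr_adaptedM hF (fine_weight M0 ah) (dev_ad y ay))
  (cv0_tightM (fine_tight M th) (dev_cv0 M0 T0 m ay cy)).
have c2 := (semimartingale_integ hF r T0 sy).1 _
  (arr_adaptedM hF (fine_weight M0 ah) (dev_ad x ax))
  (cv0_tightM (fine_tight M th) (dev_cv0 M0 T0 m ax cx)).
have := cv0D (cv0Z 2^-1 c1) (cv0Z (- 2^-1) c2); set S := (fun n i o => _) => cS.
have cS' : cv0 P (fun n k => S n (k * M n)%N).
  by apply: cv0_le_ae cS; apply: aeW => o n k; exists (k * M n)%N.
apply: cv0_ext cS' => n k o; rewrite /S /psum !sum_refine !mulr_sumr -big_split /=.
apply: eq_bigr => i _; rewrite !mulr_sumr -big_split /=.
have key j : (j <= M n)%N -> mgerm x (tau n i) (r n (i * M n + j)%N) o * dgerm y (tau n i) (r n (i * M n + j)%N) o -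
   \sum_(0 <= j' < j) germ_arr r (fun s t o => mgerm x s t o * dgerm y s t o) n (i * M n + j') o =
  \sum_(0 <= j' < j) (2^-1 * ((y (r n (i * M n + j')%N) o - y (tau n i) o) * incr r x n (i * M n + j') o)
    - 2^-1 * ((x (r n (i * M n + j')%N) o - x (tau n i) o) * incr r y n (i * M n + j') o)).
  elim: j => [_|j IH jM].
    by rewrite addn0 refineM !big_nil /dgerm; ring.
  rewrite !big_nat_recr//= -IH ?(ltnW jM)// /incr /germ_arr /mgerm /dgerm addnS.
  by field.
have := key (M n) (leqnn _); rewrite -mulSnr (refineM tau M0 n i.+1).
rewrite -[X in X - _]/(germ_arr tau (fun s t o => mgerm x s t o * dgerm y s t o) n i o) => ->.
rewrite mulr_sumr; apply: eq_big_nat => j /andP[_ jM].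
by rewrite divnMDl// divn_small// addn0 /r; ring.
Qed.

Lemma strat_coherent G : stratonovich_germ P F G -> coherent G.
Proof.
elim=> {G} [x y sx sy|G H _ fG _ fH|G H _ fG nH].
- exact: coherent_base.
- exact: coherentD.
- suff -> : H = fun s t o => G s t o + (H s t o - G s t o).
    by apply: coherentD => //; apply: coherent_negligible.
  by apply/funext => s; apply/funext => t; apply/funext => o; ring.
Qed.

Definition sums_to G z := forall T (tau : pseq T), 0 <= T -> mesh0 tau ->
  cv0 P (fun n _ o => psum (germ_arr tau G) n (psize tau n) o - z T o).

Lemma near_all_le (Q : nat -> nat -> Prop) N : (forall i, (i <= N)%N -> \forall m \near \oo, Q i m) ->
  exists m, forall i, (i <= N)%N -> Q i m.
Proof.
move=> h; suff : \forall m \near \oo, forall i, (i <= N)%N -> Q i m.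
  by move=> [m _ /(_ m (leqnn m)) ?]; exists m.
elim: N h => [|N IH] h.
  by apply: filterS (h 0%N (leqnn _)) => m Qm i; rewrite leqn0 => /eqP ->.
have {}IH := IH (fun i iN => h i (leqW iN)).
apply: filterS (filterI IH (h _ (leqnn _))) => m [h1 h2] i.
by rewrite leq_eqVlt => /orP[/eqP ->//|]; apply: h1.
Qed.

(* Coherence compares a one-step germ with its sums over fine refinements of the
   step, and these sums are close to the increment of z by assumption. *)
Lemma sewing G z : germ_adapted F G -> adapted F z -> (forall t o, G t t o = 0) -> coherent G ->
  sums_to G z -> negligible_germ P F (fun s t o => G s t o - dgerm z s t o).
Proof.
move=> aG az G0 cG Gz; split.
  move=> s t s0 st; have sig := filtration_sigma hF (le_trans s0 st).
  apply: (sub_measurableB sig); first exact: aG.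
  apply: (sub_measurableB sig); first exact: az (le_trans s0 st).
  exact: (sub_measurable_mono hF s0 st (az s s0)).
move=> T tau T0 m.
(* A tolerance shared by the [psize tau n + 1] points of the partition: the exceptional
   probabilities, and also the errors, add up to at most 1 / (n + 1). *)
pose eta n : R := n.+1%:R^-1 * (psize tau n).+1%:R^-1.
have eta0 n : 0 < eta n by rewrite mulr_gt0 ?invr_gt0.
have hM n : exists M, (0 < M)%N /\ forall i, (i <= psize tau n)%N -> outer_le P
   [set o | eta n <= `|\sum_(0 <= l < i * M) G (refine_pt (tau n) M l) (refine_pt (tau n) M l.+1) o
      - z (tau n i) o|] (eta n).
  pose Q i M := outer_le P [set o | eta n <= `|\sum_(0 <= l < i * M.+1) G (refine_pt (tau n) M.+1 l) (refine_pt (tau n) M.+1 l.+1) o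
      - z (tau n i) o|] (eta n).
  suff /near_all_le[k hk] : forall i, (i <= psize tau n)%N -> \forall k \near \oo, Q i k by exists k.+1.
  move=> i iN; have := Gz _ (refine_start iN) (ppt_ge0 tau n i) (refine_start_mesh0 iN) _ (eta0 n).
  apply: filterS => k; apply: outer_leS => o /= h; exists 0%N; move: h.
  congr (is_true (_ <= `|_ - _|)); apply: eq_big_nat => l /andP[_ lN].
  by rewrite /germ_arr !refine_startE// ltnW.
have {hM} [M hM] := choice hM.
have M0 n : (0 < M n)%N by case: (hM n).
move=> h ah th; have c1 := cG T tau M M0 T0 m h ah th.
(* The error at the [i]-th point of [tau n] of the fine sums as an approximation of [z], frozen
   beyond the last point. *)
pose D n i o := if (i <= psize tau n)%N then \sum_(0 <= l < i * M n) germ_arr (refine tau M0) G n l o - z (tau n i) o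
  else \sum_(0 <= l < psize tau n * M n) germ_arr (refine tau M0) G n l o - z T o.
have cD : cv0 P (fun n i o => (psize tau n).+1%:R * D n i o).
  move=> e e0; near=> n.
  apply: outer_leS; last first.
    apply: (@outer_leW _ _ _ _ _ ((psize tau n).+1%:R * eta n)); last first.
      by apply: outer_le_bigU => i; rewrite ltnS; case: (hM n) => _; apply.
    rewrite /eta mulrCA divff ?mulr1 ?pnatr_eq0//; apply/ltW.
    by near: n; exact: (near_infty_natSinv_lt (PosNum e0)).
  move=> o [i ei]; have ne : n.+1%:R^-1 < e by near: n; exact: (near_infty_natSinv_lt (PosNum e0)).
  exists (minn i (psize tau n)); first by rewrite ltnS geq_minr.
  rewrite /= /eta -(ler_pM2l (x := (psize tau n).+1%:R))// mulrCA divff ?mulr1 ?pnatr_eq0//.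
  rewrite (le_trans (ltW ne))// (le_trans ei)// normrM normr_nat ler_wpM2l//.
  rewrite /D; case: (leqP i (psize tau n)) => iN; first by rewrite /refine.
  by rewrite ppt_end.
have cD1 : cv0 P (fun n i o => (psize tau n).+1%:R * D n i.+1 o).
  by apply: cv0_le_ae cD; apply: aeW => o n i; exists i.+1.
(* No cancellation is used here: each difference is small even after multiplication by
   [psize tau n + 1], so it is dominated with [q] the inverse of that number, whose sum over the
   partition is at most 1. *)
have c2 : cv0 P (psum (fun n i o => h n i o * (D n i.+1 o - D n i o))).
  apply: (psum_dom_cv0 (c := fun n i o => h n i o * ((psize tau n).+1%:R * D n i.+1 o + -1 * ((psize tau n).+1%:R * D n i o)))
     (q := fun n i o => if (i < psize tau n)%N then (psize tau n).+1%:R^-1 else 0)).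
  - by move=> n i o; case: ifP.
  - apply: (@tight_bound _ _ _ _ 1) => n k o.
    have q0 : 0 <= psum (fun n i (o : Omega) => if (i < psize tau n)%N then (psize tau n).+1%:R^-1 : R else 0) n k o.
      by apply: sumr_ge0 => i _; case: ifP.
    rewrite ger0_norm// /psum -big_mkcond /=.
    apply: (@le_trans _ _ (\sum_(0 <= i < psize tau n) (psize tau n).+1%:R^-1)).
      rewrite big_mkcond /= (big_nat_widen _ _ (maxn k (psize tau n))) ?leq_maxl//=.
      rewrite -big_mkcondr /= (big_nat_widen 0 (psize tau n) (maxn k (psize tau n))) ?leq_maxr//=.
      rewrite [leLHS]big_mkcond [leRHS]big_mkcond /=; apply: ler_sum => i _.
      by do 2 case: ifP; rewrite ?lexx ?invr_ge0//; case: (i < k)%N.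
    rewrite sumr_const_nat subn0 -[leLHS]mulr_natr mulrC ler_pdivrMr ?mul1r ?ler_nat//.
  - move=> n i o; case: ifP => iN.
      have -> : h n i o * ((psize tau n).+1%:R * D n i.+1 o + -1 * ((psize tau n).+1%:R * D n i o)) =
        (psize tau n).+1%:R * (h n i o * (D n i.+1 o - D n i o)) by ring.
      by rewrite [X in _ <= X * _]normrM normr_nat mulrAC divff ?mul1r ?pnatr_eq0.
    suff -> : D n i.+1 o = D n i o by rewrite subrr mulr0 normr0 mulr0.
    rewrite /D; move: iN => /negbT; rewrite -leqNgt => Ni.
    rewrite ifF ?ltnNge ?Ni//; case: ifP => // iN.
    have -> : i = psize tau n by apply/eqP; rewrite eqn_leq iN Ni.
    by rewrite [tau n _]ppt_end.
  - by apply: cv0_tightM => //; apply: cv0D cD1 (cv0Z _ cD).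
(* One step splits as [G - dz = (G - fine sum) + (fine sum - dz)]: the first part is coherence, and
   the second is the increment of [D]. *)
apply: cv0_ext (cv0D c1 c2) => n k o; rewrite -psumD; apply: eq_bigr => i _.
rewrite -mulrDr; congr (_ * _); rewrite /dgerm /germ_arr /D.
have [iN|Ni] := ltnP i (psize tau n).
  rewrite (ltnW iN) mulSnr [X in _ = _ + (X - _ - _)](@big_cat_nat _ _ _ (i * M n)) ?leq_addr//=.
  rewrite (sum_shift _ (i * M n)) /germ_arr /=; ring.
(* Beyond the end of the partition all intervals, coarse and fine, are reduced to the point [T], and
   [G] vanishes on the diagonal. *)
rewrite big1_seq; last first.
  move=> j _; rewrite /= /refine_pt; case: (hM n) => _ _.
  have ij : (psize tau n <= (i * M n + j) %/ M n)%N by rewrite divnMDl// (leq_trans Ni)// leq_addr.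
  have ij1 : (psize tau n <= (i * M n + j).+1 %/ M n)%N by rewrite (leq_trans ij)// leq_div2r.
  by rewrite !ppt_end ?subrr ?mulr0 ?addr0// ?G0// leqW.
rewrite !ppt_end ?G0// ?leqW//; case: ifP => iN; last by ring.
have -> : i = psize tau n by apply/eqP; rewrite eqn_leq iN Ni.
by ring.
Unshelve. all: by end_near. Qed.

End Sewing.

(** * Quaternion-valued germs *)

Section QuaternionCoordinates.
Context (R : realType).
Implicit Types p q : quat R.

Lemma qaddE p q : p + q = qadd p q. Proof. by []. Qed.
Lemma qoppE p : - p = qopp p. Proof. by []. Qed.
Lemma qmulE p q : p * q = qmul p q. Proof. by []. Qed.
Lemma qscaleE (c : R) p : c *: p = qscale c p. Proof. by []. Qed.
Lemma qoneE : 1 = qone R. Proof. by []. Qed.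

Definition quatE := (qaddE, qoppE, qmulE, qscaleE, qoneE).

Lemma qcoordP (Q : 'I_4 -> Prop) : Q (inord 0) -> Q (inord 1) -> Q (inord 2) -> Q (inord 3) -> forall k, Q k.
Proof.
move=> Q0 Q1 Q2 Q3 k; rewrite -(inord_val k).
by case: k => -[|[|[|[|//]]]].
Qed.

Lemma qcoordE p : (qcoord (inord 0) p = qre p) * (qcoord (inord 1) p = qi p) *
  (qcoord (inord 2) p = qj p) * (qcoord (inord 3) p = qk p).
Proof. by rewrite /qcoord !(tnth_nth 0) !inordK. Qed.

Lemma qcoordD k p q : qcoord k (p + q) = qcoord k p + qcoord k q.
Proof. by elim/qcoordP: k; rewrite !qcoordE. Qed.

Lemma qcoordN k p : qcoord k (- p) = - qcoord k p.
Proof. by elim/qcoordP: k; rewrite !qcoordE. Qed.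

Lemma qcoordB k p q : qcoord k (p - q) = qcoord k p - qcoord k q.
Proof. by rewrite qcoordD qcoordN. Qed.

Lemma qcoordZ k (c : R) p : qcoord k (c *: p) = c * qcoord k p.
Proof. by elim/qcoordP: k; rewrite !qcoordE. Qed.

Lemma qcoord0 k : qcoord k (0 : quat R) = 0.
Proof. by elim/qcoordP: k; rewrite !qcoordE. Qed.

Lemma qcoord_sum k (I : Type) (r : seq I) (f : I -> quat R) :
  qcoord k (\sum_(i <- r) f i) = \sum_(i <- r) qcoord k (f i).
Proof. by elim: r => [|i r IH]; rewrite ?big_nil ?qcoord0// !big_cons qcoordD IH. Qed.

Lemma quatP p q : (forall k, qcoord k p = qcoord k q) -> p = q.
Proof.
case: p q => [a b c e] [a' b' c' e'] h.
have := (h (inord 0), h (inord 1), h (inord 2), h (inord 3)).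
by rewrite !qcoordE /= => -[[[-> ->] ->] ->].
Qed.

Definition qbasis (l : 'I_4) : quat R :=
  Quat (l == inord 0)%:R (l == inord 1)%:R (l == inord 2)%:R (l == inord 3)%:R.
(** The structure constants of the quaternions; through them, closure of a class of germs under
    quaternion products reduces to real products of coordinates. *)
Definition qmul_coef k l m : R := qcoord k (qbasis l * qbasis m).
Definition qconj_coef (k : 'I_4) : R := if k == inord 0 then 1 else -1.

Lemma big_qcoord (f : 'I_4 -> R) : \sum_l f l = f (inord 0) + f (inord 1) + f (inord 2) + f (inord 3).
Proof.
rewrite !big_ord_recl big_ord0 addr0 !addrA; congr (f _ + f _ + f _ + f _);
  by apply/val_inj; rewrite /= inordK.
Qed.

Lemma qcoordM k p q : qcoord k (p * q) = \sum_l \sum_m qmul_coef k l m * (qcoord l p * qcoord m q).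
Proof.
have e (i j : nat) : (i < 4)%N -> (j < 4)%N -> ((inord i : 'I_4) == inord j) = (i == j).
  by move=> i4 j4; apply/eqP/eqP => [/(congr1 val)|->//]; rewrite /= !inordK.
rewrite !big_qcoord /qmul_coef !qmulE.
by elim/qcoordP: k; rewrite !qcoordE /= !e//=; ring.
Qed.

Lemma qcoord_conj k p : qcoord k (qconj p) = qconj_coef k * qcoord k p.
Proof.
have e (i j : nat) : (i < 4)%N -> (j < 4)%N -> ((inord i : 'I_4) == inord j) = (i == j).
  by move=> i4 j4; apply/eqP/eqP => [/(congr1 val)|->//]; rewrite /= !inordK.
by elim/qcoordP: k; rewrite !qcoordE /qconj_coef !e//=; ring.
Qed.

Lemma qnormsqE p : qnormsq p = \sum_k qcoord k p ^+ 2.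
Proof. by rewrite big_qcoord !qcoordE. Qed.

Lemma qnormsq_ge0 p : 0 <= qnormsq p.
Proof. by rewrite qnormsqE sumr_ge0// => k _; exact: sqr_ge0. Qed.

Lemma qcoord_le_norm k p : `|qcoord k p| <= qnorm p.
Proof.
rewrite -sqrtr_sqr ler_wsqrtr// qnormsqE (bigD1 k)//= lerDl sumr_ge0// => i _.
exact: sqr_ge0.
Qed.

Lemma qnorm_le_coord p : qnorm p <= \sum_k `|qcoord k p|.
Proof.
have s0 : 0 <= \sum_k `|qcoord k p| by apply: sumr_ge0.
rewrite -[leRHS]ger0_norm// -sqrtr_sqr ler_wsqrtr// qnormsqE !big_qcoord.
have := (normr_ge0 (qcoord (inord 0) p), normr_ge0 (qcoord (inord 1) p), normr_ge0 (qcoord (inord 2) p), normr_ge0 (qcoord (inord 3) p)).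
rewrite -(real_normK (num_real (qcoord (inord 0) p))) -(real_normK (num_real (qcoord (inord 1) p))).
rewrite -(real_normK (num_real (qcoord (inord 2) p))) -(real_normK (num_real (qcoord (inord 3) p))).
move: `|_| `|_| `|_| `|_| => a b c e [[[a0 b0] c0] e0].
have := (mulr_ge0 a0 b0, mulr_ge0 a0 c0, mulr_ge0 a0 e0, mulr_ge0 b0 c0, mulr_ge0 b0 e0, mulr_ge0 c0 e0).
move=> [[[[[h1 h2] h3] h4] h5] h6]; nra.
Qed.

Lemma qnormsqM p q : qnormsq (p * q) = qnormsq p * qnormsq q.
Proof. by rewrite qmulE /qnormsq /=; ring. Qed.

Lemma qnormsqZ (c : R) p : qnormsq (c *: p) = c ^+ 2 * qnormsq p.
Proof. by rewrite qscaleE /qnormsq /=; ring. Qed.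

Lemma quat_unit p : p != 0 -> p \is a GRing.unit.
Proof. by []. Qed.

Lemma qconjM p q : qconj (p * q) = qconj q * qconj p.
Proof. by rewrite /qconj !quatE /qmul /=; congr Quat; ring. Qed.

Lemma qconjD p q : qconj (p + q) = qconj p + qconj q.
Proof. by rewrite /qconj !quatE /qadd /=; congr Quat; ring. Qed.

Lemma qconjB p q : qconj (p - q) = qconj p - qconj q.
Proof. by rewrite /qconj !quatE /qadd /qopp /=; congr Quat; ring. Qed.

Lemma qconjZ (c : R) p : qconj (c *: p) = c *: qconj p.
Proof. by rewrite /qconj !quatE /qscale /=; congr Quat; ring. Qed.

Lemma qconjK p : qconj (qconj p) = p.
Proof. by case: p => *; rewrite /qconj /= !opprK. Qed.

Lemma qconj_sum (I : Type) (r : seq I) (f : I -> quat R) :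
  qconj (\sum_(i <- r) f i) = \sum_(i <- r) qconj (f i).
Proof.
elim: r => [|i r IH]; last by rewrite !big_cons qconjD IH.
by rewrite !big_nil; apply: quatP => k; rewrite qcoord_conj qcoord0 mulr0.
Qed.

Lemma scaler_quatAl (c : R) p q : (c *: p) * q = c *: (p * q).
Proof. by rewrite !quatE /qmul /qscale /=; congr Quat; ring. Qed.

Lemma scaler_quatAr (c : R) p q : p * (c *: q) = c *: (p * q).
Proof. by rewrite !quatE /qmul /qscale /=; congr Quat; ring. Qed.

End QuaternionCoordinates.

(** * Stratonovich integrals as limits of sums of germs *)

Section StratonovichSums.
Context d (Omega : measurableType d) (R : realType) (P : probability Omega R).
Variable F : R -> set (set Omega).
Hypothesis hF : filtration F.

Definition qcoord_germ (k : 'I_4) (G : R -> R -> Omega -> quat R) := fun s t o => qcoord k (G s t o).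
Definition qcoord_proc (k : 'I_4) (z : R -> Omega -> quat R) := fun t o => qcoord k (z t o).

Definition trap_germ (V : zmodType) (beta : V -> V -> quat R) (X : R -> Omega -> V) :=
  fun s t o => 2^-1 *: (beta (X s o) (X t o - X s o) + beta (X t o) (X t o - X s o)).

Variables (V : zmodType) (beta : V -> V -> quat R) (X : R -> Omega -> V) (S : R -> Omega -> quat R).
Hypothesis aX : forall k, germ_adapted F (qcoord_germ k (trap_germ beta X)).
Hypothesis aS : qadapted F S.

(** [stratonovich_integral] applies [P] itself to this event, and the arrays use [outer_le];
    measurability makes the two bounds equivalent. *)
Lemma measurable_qnorm_ge T (tau : pseq T) n e : 0 <= T ->
  measurable [set o | e <= qnorm (\sum_(0 <= i < psize tau n)
    trap_germ beta X (tau n i) (tau n i.+1) o - S T o)].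
Proof.
move=> T0; have [_ FT _] := hF; apply: (FT T T0); apply: sub_measurable_ge.
have s := filtration_sigma hF T0.
apply: (@sub_measurable_comp _ _ _ _ Num.sqrt) => //.
  exact: (continuous_measurable_fun (@sqrt_continuous R)).
rewrite (_ : (fun _ => _) = fun o => \sum_(k : 'I_4)
    (psum (germ_arr tau (qcoord_germ k (trap_germ beta X))) n (psize tau n) o - qcoord k (S T o)) ^+ 2); last first.
  apply/funext => o; rewrite qnormsqE; apply: eq_bigr => k _.
  by rewrite qcoordB qcoord_sum.
apply: (sub_measurable_sum s) => k; under eq_fun do rewrite expr2.
have m : sub_measurable (F T) (fun o => psum (germ_arr tau (qcoord_germ k (trap_germ beta X))) n (psize tau n) o - qcoord k (S T o)).
  apply: (sub_measurableB s); last exact: (aS k T0).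
  have := psum_adapted hF (germ_arr_adapted tau (aX k)) n (psize tau n).
  by apply: (sub_measurable_mono hF); rewrite ?ppt_ge0 ?ppt_leT.
exact: (sub_measurableM s m m).
Qed.

Lemma trapezoid_sum_pseq T (tau : pseq T) n s o : size s = psize tau n ->
  (forall i, pt 0 T s i = tau n i) ->
  trapezoid_sum beta (X ^~ o) 0 T s = \sum_(0 <= i < psize tau n) trap_germ beta X (tau n i) (tau n i.+1) o.
Proof. by move=> <- e; rewrite /trapezoid_sum; apply: eq_bigr => i _; rewrite !e. Qed.

(** From sequences to all partitions: were there no [delta] for [e], bad partitions of mesh below 1
    / (n + 1) would form a sequence with mesh tending to 0 along which the sums do not converge. *)
Lemma sums_to_stratonovich :
  (forall k, sums_to P (qcoord_germ k (trap_germ beta X)) (qcoord_proc k S)) ->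
  stratonovich_integral P beta X S.
Proof.
move=> hS T T0 e e0; apply: contrapT => nex.
have bad n : exists s : seq R, [/\ itv_partition 0 T s, mesh_lt 0 T s n.+1%:R^-1 &
   ~ (P [set o | (e <= qnorm (trapezoid_sum beta (X ^~ o) 0 T s - S T o))%R] <= e%:E)%E].
  apply: contrapT => nbad; apply: nex; exists n.+1%:R^-1; first by rewrite invr_gt0.
  by move=> s sP ms; apply: contrapT => nP; apply: nbad; exists s.
have [s hs] := choice bad.
have sP n : itv_partition 0 T (s n) by case: (hs n).
pose tau := pseq_of_seq sP.
have m : mesh0 tau.
  move=> delta d0; near=> n => i; have [iN|iN] := ltnP i (size (s n)).
    have [_ /(_ i iN) h _] := hs n; apply: (lt_trans h).
    by near: n; exact: (near_infty_natSinv_lt (PosNum d0)).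
  by rewrite !(ppt_end (p := tau)) ?subrr//= leqW.
(* One quarter for each real coordinate: the norm is at most the sum of the four absolute values,
   and the four exceptional probabilities add up. *)
have e40 : 0 < e / 4 by lra.
have h4 i : (i < 4)%N -> \forall n \near \oo, outer_le P [set o | exists j : nat, e / 4 <=
    `|psum (germ_arr tau (qcoord_germ (inord i) (trap_germ beta X))) n (psize tau n) o - qcoord_proc (inord i) S T o|] (e / 4).
  by move=> _; apply: (hS _ _ tau T0 m).
have [n hn] : exists n, forall i, (i <= 3)%N -> outer_le P [set o | exists j : nat, e / 4 <=
    `|psum (germ_arr tau (qcoord_germ (inord i) (trap_germ beta X))) n (psize tau n) o - qcoord_proc (inord i) S T o|] (e / 4).
  exact: near_all_le h4.
have [_ _] := hs n; apply.
have E : (fun o => trapezoid_sum beta (X ^~ o) 0 T (s n) - S T o) = (fun o => \sum_(0 <= i < psize tau n)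
    trap_germ beta X (tau n i) (tau n i.+1) o - S T o).
  by apply/funext => o; rewrite (@trapezoid_sum_pseq _ tau n).
rewrite (_ : [set _ | _] = [set o | e <= qnorm (\sum_(0 <= i < psize tau n)
    trap_germ beta X (tau n i) (tau n i.+1) o - S T o)]); last first.
  by apply/funext => o /=; rewrite (congr1 (fun f => f o) E).
apply/outer_le_measurable; first exact: measurable_qnorm_ge.
have := @outer_le_bigU _ _ _ P (fun i => [set o | exists j : nat, e / 4 <=
    `|psum (germ_arr tau (qcoord_germ (inord i) (trap_germ beta X))) n (psize tau n) o - qcoord_proc (inord i) S T o|]) 4 _ hn.
have -> : 4%:R * (e / 4) = e by field.
apply: outer_leS => o /= eo; apply: contrapT => no.
have hk i : (i < 4)%N -> `|psum (germ_arr tau (qcoord_germ (inord i) (trap_germ beta X))) n (psize tau n) o - qcoord_proc (inord i) S T o| < e / 4.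
  by move=> i4; rewrite ltNge; apply/negP => h; apply: no; exists i => //; exists 0%N.
have := qnorm_le_coord (\sum_(0 <= i < psize tau n) trap_germ beta X (tau n i) (tau n i.+1) o - S T o).
rewrite big_qcoord !qcoordB !qcoord_sum.
have := (hk 0%N isT, hk 1%N isT, hk 2%N isT, hk 3%N isT) => -[[[h0 h1] h2] h3].
rewrite /psum /germ_arr /qcoord_germ /qcoord_proc in h0 h1 h2 h3; lra.
Unshelve. all: by end_near. Qed.

Lemma stratonovich_sums_to : stratonovich_integral P beta X S ->
  forall k, sums_to P (qcoord_germ k (trap_germ beta X)) (qcoord_proc k S).
Proof.
move=> hS k T tau T0 m e e0; have [delta d0 hd] := hS T T0 e e0.
near=> n; have mn : mesh_lt 0 T (pseq_seq tau n) delta.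
  move=> i _; rewrite !pt_pseq_seq.
  by move: i; near: n; apply: m.
have := hd _ (pseq_seq_partition tau n) mn.
rewrite (_ : [set _ | _] = [set o | e <= qnorm (\sum_(0 <= i < psize tau n)
    trap_germ beta X (tau n i) (tau n i.+1) o - S T o)]); last first.
  apply/funext => o /=; rewrite (@trapezoid_sum_pseq _ tau n) ?size_pseq_seq// => i.
  by rewrite pt_pseq_seq.
move=> /(outer_le_measurable _ _ (measurable_qnorm_ge _ _ _ T0)).
apply: outer_leS => o /= [_ h]; apply: (le_trans h).
have := qcoord_le_norm k (\sum_(0 <= i < psize tau n) trap_germ beta X (tau n i) (tau n i.+1) o - S T o).
by rewrite qcoordB qcoord_sum.
Unshelve. all: by end_near. Qed.

End StratonovichSums.

(** * Closure properties of quaternion-valued germs *)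

Section QuaternionGerms.
Context d (Omega : measurableType d) (R : realType) (P : probability Omega R).
Variable F : R -> set (set Omega).
Hypothesis hF : filtration F.
Implicit Types (G H K : R -> R -> Omega -> quat R) (p q : R -> Omega -> quat R).
Implicit Type C : (R -> R -> Omega -> R) -> Prop.

Lemma sums_to_negligible (G H : R -> R -> Omega -> R) z : negligible_germ P F (fun s t o => H s t o - G s t o) ->
  sums_to P G z -> sums_to P H z.
Proof.
move=> [_ nG] Gz T tau T0 m.
have c1 := nG T tau T0 m _ (@arr_adapted_cst _ _ _ _ hF T tau 1) (tight_cst P 1).
have c1' : cv0 P (fun n (_ : nat) o => psum (fun n i o => 1 * germ_arr tau (fun s t o => H s t o - G s t o) n i o) n (psize tau n) o).
  by apply: cv0_le_ae c1; apply: aeW => o n _; exists (psize tau n).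
apply: cv0_ext (cv0D (Gz T tau T0 m) c1') => n _ o.
rewrite addrAC -psumD; congr (_ - _); apply: eq_bigr => i _; rewrite /germ_arr; ring.
Qed.

Lemma negligible_sums_to (G : R -> R -> Omega -> R) : negligible_germ P F G -> sums_to P G (fun _ _ => 0).
Proof.
move=> nG; apply: (@sums_to_negligible (fun _ _ _ => 0)).
  by apply: germ_ext nG => s t o; rewrite subr0.
move=> T tau T0 m; apply: (@cv0_of_bound _ _ _ _ (fun=> 0)) => [|n i o]; first exact: cvg_cst.
by rewrite /psum big1 ?subr0 ?normr0.
Qed.

(** What the adapted, first-order, negligible, weight and Stratonovich germs have in common;
    quaternion sums, conjugates and products are treated once for all of them. *)
Definition germ_linear C := (forall G H : R -> R -> Omega -> R, C G -> C H -> C (fun s t o => G s t o + H s t o)) /\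
  (forall c (G : R -> R -> Omega -> R), C G -> C (fun s t o => c * G s t o)).

Lemma negligible_linear : germ_linear (negligible_germ P F).
Proof. by split=> [G H|c G]; [exact: negligibleD|exact: negligibleZ]. Qed.

Lemma first_order_linear : germ_linear (first_order P F).
Proof. by split=> [G H|c G]; [exact: first_orderD|exact: first_orderZ]. Qed.

Lemma weight_linear : germ_linear (germ_weight P F).
Proof.
split=> [G H|c G wG]; first exact: weightD.
by apply: weightM => //; exact: weight_cst.
Qed.

Lemma strat_linear : germ_linear (stratonovich_germ P F).
Proof. by split=> [G H|c G]; [exact: strat_add|exact: strat_cstM]. Qed.

Lemma germ_adapted_linear : germ_linear (germ_adapted F).
Proof.
split=> [G H|c G aG]; first exact: germ_adaptedD.
by apply: germ_adaptedM => //; exact: germ_adapted_cst.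
Qed.

Definition qall C G := forall k, C (qcoord_germ k G).

Section Linear.
Variable C : (R -> R -> Omega -> R) -> Prop.
Hypothesis lC : germ_linear C.

Lemma germ_linear_sum4 (G : 'I_4 -> R -> R -> Omega -> R) : (forall l, C (G l)) ->
  C (fun s t o => \sum_l G l s t o).
Proof.
move=> hG; apply: (@germ_ext _ _ _ C _ (fun s t o => G (inord 0) s t o + G (inord 1) s t o + G (inord 2) s t o + G (inord 3) s t o)).
  by move=> s t o; rewrite big_qcoord.
by do 3 (apply: lC.1 => //).
Qed.

Lemma qall_ext G H : (forall s t o, G s t o = H s t o) -> qall C H -> qall C G.
Proof. by move=> GH cH k; apply: germ_ext (cH k) => s t o; rewrite /qcoord_germ GH. Qed.

Lemma qallD G H : qall C G -> qall C H -> qall C (fun s t o => G s t o + H s t o).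
Proof. by move=> cG cH k; apply: germ_ext (lC.1 _ _ (cG k) (cH k)) => s t o; rewrite /qcoord_germ qcoordD. Qed.

Lemma qallZ c G : qall C G -> qall C (fun s t o => c *: G s t o).
Proof. by move=> cG k; apply: germ_ext (lC.2 c _ (cG k)) => s t o; rewrite /qcoord_germ qcoordZ. Qed.

Lemma qallN G : qall C G -> qall C (fun s t o => - G s t o).
Proof. by move=> /(qallZ (-1)); apply: qall_ext => s t o; rewrite scaleN1r. Qed.

Lemma qallB G H : qall C G -> qall C H -> qall C (fun s t o => G s t o - H s t o).
Proof. by move=> cG cH; apply: qallD => //; apply: qallN. Qed.

Lemma qall_conj G : qall C G -> qall C (fun s t o => qconj (G s t o)).
Proof. by move=> cG k; apply: germ_ext (lC.2 (qconj_coef R k) _ (cG k)) => s t o; rewrite /qcoord_germ qcoord_conj. Qed.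

Lemma qallM G H : (forall l m, C (fun s t o => qcoord l (G s t o) * qcoord m (H s t o))) ->
  qall C (fun s t o => G s t o * H s t o).
Proof.
move=> h k; apply: (@germ_ext _ _ _ C _ (fun s t o => \sum_l \sum_m qmul_coef R k l m * (qcoord l (G s t o) * qcoord m (H s t o)))).
  by move=> s t o; rewrite /qcoord_germ qcoordM.
by do 2 (apply: germ_linear_sum4 => ?); apply: lC.2; apply: h.
Qed.

Lemma qall_sum (I : Type) (r : seq I) (G : I -> R -> R -> Omega -> quat R) : C (fun _ _ _ => 0) ->
  (forall i, qall C (G i)) -> qall C (fun s t o => \sum_(i <- r) G i s t o).
Proof.
move=> C0 hG; elim: r => [|i r IH].
  by move=> k; apply: germ_ext C0 => s t o; rewrite /qcoord_germ big_nil qcoord0.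
by apply: qall_ext (qallD (hG i) IH) => s t o; rewrite big_cons.
Qed.

End Linear.

Definition qnegligible := qall (negligible_germ P F).
Definition qfirst_order := qall (first_order P F).
Definition qweight := qall (germ_weight P F).
Definition qstrat := qall (stratonovich_germ P F).

Definition qmid p := fun s t o => 2^-1 *: (p s o + p t o).
Definition qdelta p := fun s t o => p t o - p s o.

Lemma qnegligible_weightl K G : qweight K -> qnegligible G -> qnegligible (fun s t o => K s t o * G s t o).
Proof. by move=> wK nG; apply: (qallM negligible_linear) => l m; have [_ _] := wK l; apply; apply: nG. Qed.

Lemma qnegligible_weightr K G : qweight K -> qnegligible G -> qnegligible (fun s t o => G s t o * K s t o).
Proof.
move=> wK nG; apply: (qallM negligible_linear) => l m; have [_ _ h] := wK m.
by apply: germ_ext (h _ (nG l)) => s t o; rewrite mulrC.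
Qed.

Lemma qnegligible_scale (r : R -> R -> Omega -> R) G : germ_weight P F r -> qnegligible G ->
  qnegligible (fun s t o => r s t o *: G s t o).
Proof.
move=> [_ _ wr] nG k; apply: germ_ext (wr _ (nG k)) => s t o.
by rewrite /qcoord_germ qcoordZ.
Qed.

Lemma qfirst_order_weightl K G : qweight K -> qfirst_order G -> qfirst_order (fun s t o => K s t o * G s t o).
Proof. by move=> wK nG; apply: (qallM first_order_linear) => l m; have [_ + _] := wK l; apply; apply: nG. Qed.

Lemma qfirst_order_weightr K G : qweight K -> qfirst_order G -> qfirst_order (fun s t o => G s t o * K s t o).
Proof.
move=> wK nG; apply: (qallM first_order_linear) => l m; have [_ h _] := wK m.
by apply: germ_ext (h _ (nG l)) => s t o; rewrite mulrC.
Qed.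

Lemma qnegligible3 G H K : qfirst_order G -> qfirst_order H -> qfirst_order K ->
  qnegligible (fun s t o => G s t o * H s t o * K s t o).
Proof.
move=> fG fH fK; apply: (qallM negligible_linear) => l m.
(* With the coordinate of the third factor fixed, the [g] that it makes negligible form a linear
   class, so the product rule for quaternions applies again to the first two factors. *)
pose C' (g : R -> R -> Omega -> R) := negligible_germ P F (fun s t o => g s t o * qcoord m (K s t o)).
have lC' : germ_linear C'.
  split=> [g h|c g] ng; first by move=> nh; apply: germ_ext (negligibleD hF ng nh) => s t o; rewrite mulrDl.
  by apply: germ_ext (negligibleZ hF c ng) => s t o; rewrite mulrA.
apply: (qallM lC' (G := G) (H := H)) => i j; rewrite /C'.
exact: (negligible3 hF (fG i) (fH j) (fK m)).
Qed.

Lemma qnegligible_scale2 (g h : R -> R -> Omega -> R) G : first_order P F g -> first_order P F h ->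
  qfirst_order G -> qnegligible (fun s t o => (g s t o * h s t o) *: G s t o).
Proof.
move=> fg fh fG k; apply: germ_ext (negligible3 hF fg fh (fG k)) => s t o.
by rewrite /qcoord_germ qcoordZ.
Qed.

Lemma qfirst_order_delta p : qsemimartingale P F p -> qfirst_order (qdelta p).
Proof.
move=> sp k; apply: germ_ext (first_order_dgerm hF (sp k)) => s t o.
by rewrite /qcoord_germ qcoordB.
Qed.

Lemma qweight_mid p : qsemimartingale P F p -> qweight (qmid p).
Proof.
move=> sp k; apply: germ_ext (weight_mgerm hF (sp k)) => s t o.
by rewrite /qcoord_germ qcoordZ qcoordD.
Qed.

Lemma qstrat_midl p G : qsemimartingale P F p -> qstrat G -> qstrat (fun s t o => qmid p s t o * G s t o).
Proof.
move=> sp sG; apply: (qallM strat_linear) => l m.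
apply: germ_ext (strat_mgerm hF (sp l) (sG m)) => s t o.
by rewrite qcoordZ qcoordD.
Qed.

Lemma qstrat_mid_delta p q : qsemimartingale P F p -> qsemimartingale P F q ->
  qstrat (fun s t o => qmid p s t o * qdelta q s t o).
Proof.
move=> sp sq; apply: (qallM strat_linear) => l m.
apply: germ_ext (strat_base (sp l) (sq m)) => s t o.
by rewrite qcoordZ qcoordD qcoordB.
Qed.

Lemma qstrat_delta_mid p q : qsemimartingale P F p -> qsemimartingale P F q ->
  qstrat (fun s t o => qdelta p s t o * qmid q s t o).
Proof.
move=> sp sq; apply: (qallM strat_linear) => l m.
apply: germ_ext (strat_base (sq m) (sp l)) => s t o.
by rewrite qcoordZ qcoordD qcoordB mulrC.
Qed.

Lemma qstrat_first_order G : qstrat G -> qfirst_order G.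
Proof. by move=> sG k; apply: strat_first_order. Qed.

Lemma qsemimartingaleM p q : qsemimartingale P F p -> qsemimartingale P F q ->
  qsemimartingale P F (fun t o => p t o * q t o).
Proof.
move=> sp sq k; rewrite (_ : (fun _ _ => _) = fun t o => \sum_l \sum_m qmul_coef R k l m * (qcoord l (p t o) * qcoord m (q t o))).
  do 2 (apply: (semimartingale_sum hF) => ?); apply: (semimartingaleZ hF).
  exact: (semimartingaleM hF).
by apply/funext => t; apply/funext => o; rewrite qcoordM.
Qed.

Lemma qsemimartingaleZ (r : R -> Omega -> R) p : semimartingale P F r -> qsemimartingale P F p ->
  qsemimartingale P F (fun t o => r t o *: p t o).
Proof.
move=> sr sp k; rewrite (_ : (fun _ _ => _) = fun t o => r t o * qcoord k (p t o)).
  exact: (semimartingaleM hF).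
by apply/funext => t; apply/funext => o; rewrite qcoordZ.
Qed.

Lemma qsemimartingale_conj p : qsemimartingale P F p -> qsemimartingale P F (fun t o => qconj (p t o)).
Proof.
move=> sp k; rewrite (_ : (fun _ _ => _) = fun t o => qconj_coef R k * qcoord k (p t o)).
  exact: (semimartingaleZ hF).
by apply/funext => t; apply/funext => o; rewrite qcoord_conj.
Qed.

Lemma semimartingale_qnormsq p : qsemimartingale P F p -> semimartingale P F (fun t o => qnormsq (p t o)).
Proof.
move=> sp; rewrite (_ : (fun _ _ => _) = fun t o => \sum_k (qcoord k (p t o) * qcoord k (p t o))).
  by apply: (semimartingale_sum hF) => k; apply: (semimartingaleM hF).
by apply/funext => t; apply/funext => o; rewrite qnormsqE.
Qed.

End QuaternionGerms.

(** * Horizontal lifts *)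

Section ContactAlgebra.
Context (R : realType).

(* The correction terms are products of three increments, except for the last
   one, which vanishes when a and b have the same norm. *)
Lemma contact_algebra (a b W : quat R) (x y N : R) : x != 0 -> y != 0 ->
  qre W = 1 - (x^-1 ^+ 2 + y^-1 ^+ 2 + N) / 2 ->
  let B := 2^-1 *: (W - qconj W) in
  let M := 2^-1 *: (a + b) in let D := b - a in
  2^-1 *: ((x * y) *: (b * (W - 1) * qconj a - qconj (b * (W - 1) * qconj a))) =
  (M * ((2^-1 * (x * x + y * y)) *: B) - D) * qconj M +
  (- 2^-1 *: (((y - x) * (y - x)) *: (M * B * qconj M))
   - (4^-1 * (x * y)) *: (D * B * qconj D)
   + 4^-1 *: (((y - x) * (y^-1 - x^-1)) *: (D * qconj M - M * qconj D))
   - (4^-1 * (x * y)) *: (N *: (D * qconj M - M * qconj D))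
   + (2^-1 * (qnormsq b - qnormsq a)) *: qone R).
Proof.
(* [kappa] is [1 - Re W], and [x y kappa = 1 - (y - x)(1/y - 1/x) / 2 + x y N / 2]. Its leading 1
   produces [-(D conj(M) - M conj(D)) / 2], which is [- D conj(M)] up to half of [|b|^2 - |a|^2].
   Likewise [x y] is the mean of the squares minus [(y - x)^2 / 2]. *)
move=> x0 y0 rW; pose kappa := (x^-1 ^+ 2 + y^-1 ^+ 2 + N) / 2.
have eW : W - 1 = 2^-1 *: (W - qconj W) - kappa *: qone R.
  case: W rW => [W0 W1 W2 W3] /= ->; rewrite -/kappa.
  by rewrite !quatE /qmul /qadd /qscale /qconj /qopp /qone /=; congr Quat; field.
move=> B M D; have cB : qconj B = - B by rewrite /B qconjZ qconjB qconjK -scalerN opprB.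
have ea : a = M - 2^-1 *: D by apply: quatP => k; rewrite !(qcoordD, qcoordN, qcoordZ); field.
have eb : b = M + 2^-1 *: D by apply: quatP => k; rewrite !(qcoordD, qcoordN, qcoordZ); field.
have c1 : qconj (qone R) = qone R by rewrite /qconj /=; congr Quat; ring.
have e1 : b * (W - 1) * qconj a - qconj (b * (W - 1) * qconj a) =
    2 *: (M * B * qconj M) - 2^-1 *: (D * B * qconj D) - kappa *: (D * qconj M - M * qconj D).
  rewrite eW -/B !qconjM qconjK qconjB cB qconjZ c1 ea eb.
  move: (M) (D) (B) (kappa) => m u v c.
  rewrite !qconjB !qconjD !qconjZ !mulrA !(mulrDl, mulrDr, mulrBl, mulrBr, scaler_quatAl, scaler_quatAr, mulNr, mulrN) -!qoneE !mulr1.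
  by apply: quatP => k; rewrite !(qcoordD, qcoordN, qcoordZ); field.
have e2 : (qnormsq b - qnormsq a) *: qone R = D * qconj M + M * qconj D.
  rewrite /M /D {e1 ea eb M D}; case: a b => [a0 a1 a2 a3] [b0 b1 b2 b3].
  by rewrite !quatE /qnormsq /qmul /qadd /qscale /qconj /qopp /qone /=; congr Quat; field.
clearbody B M D.
rewrite e1 -[(2^-1 * (_ - _)) *: _]scalerA e2 mulrBl scaler_quatAr scaler_quatAl.
move: (M * B * qconj M) (D * B * qconj D) (D * qconj M) (M * qconj D) => p q u v.
apply: quatP => k; rewrite !(qcoordD, qcoordN, qcoordZ) /kappa.
by field; rewrite x0 y0.
Qed.

(** Twice the imaginary part of [p_t conj(p_s)]. The expression [dp conj(p) - p conj(dp)] at the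
    increment takes this value from either end of the step, so the trapezoid of the contact form is
    exact. *)
Definition qwedge (T S : Type) (p : T -> S -> quat R) s t o := p t o * qconj (p s o) - p s o * qconj (p t o).

Lemma qre_mul_conj (p q : quat R) : qre (q * qconj p) = 2^-1 * (qnormsq q + qnormsq p - qnormsq (q - p)).
Proof. by rewrite !quatE /qnormsq /=; field. Qed.

End ContactAlgebra.

Section Lift.
Context d (Omega : measurableType d) (R : realType) (P : probability Omega R).
Variable F : R -> set (set Omega).
Hypothesis hF : filtration F.
Variable n : nat.

(** In terms of the mean [M] and the increment [D] of [p], the wedge is [D conj(M) - M conj(D)]. *)
Lemma qstrat_wedge (p : R -> Omega -> quat R) : qsemimartingale P F p -> qstrat P F (qwedge p).
Proof.
move=> sp; have sc := qsemimartingale_conj hF sp.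
have lS := strat_linear P hF.
have := qallB lS (qstrat_delta_mid hF sp sc) (qstrat_mid_delta hF sp sc).
apply: qall_ext => s t o; rewrite /qwedge /qdelta /qmid; move: (p s o) (p t o) => [a0 a1 a2 a3] [b0 b1 b2 b3].
by rewrite !quatE /qmul /qadd /qscale /qconj /qopp /=; congr Quat; field.
Qed.

Lemma strat_germ0 : stratonovich_germ P F (fun _ _ _ => 0).
Proof.
have s0 := semimartingale_cst P hF 0.
by apply: germ_ext (strat_base s0 s0) => s t o; rewrite /mgerm /dgerm subrr mulr0.
Qed.

Lemma trap_contact (X : R -> Omega -> 'rV[quat R]_(n + 1)) s t o :
  trap_germ (@contact_form R n) X s t o =
  2^-1 *: (\sum_i qwedge (fun t o => qinit (X t o) i) s t o - qwedge (fun t o => qlast (X t o)) s t o).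
Proof.
have e (p q : quat R) : (q - p) * qconj p - p * qconj (q - p) = q * qconj p - p * qconj q.
  by rewrite qconjB mulrBl mulrBr opprB addrA subrK.
have e' (p q : quat R) : (q - p) * qconj q - q * qconj (q - p) = q * qconj p - p * qconj q.
  by rewrite qconjB mulrBl mulrBr opprB addrC addrA subrK.
have c1 (x y : 'rV[quat R]_(n + 1)) : contact_form x (y - x) = 2^-1 *: (\sum_i (qinit y i * qconj (qinit x i) - qinit x i * qconj (qinit y i))
   - (qlast y * qconj (qlast x) - qlast x * qconj (qlast y))).
  rewrite /contact_form /qinit /qlast; congr (_ *: (_ - _)); last by rewrite !mxE e.
  by apply: eq_bigr => i _; rewrite !mxE e.
have c2 (x y : 'rV[quat R]_(n + 1)) : contact_form y (y - x) = 2^-1 *: (\sum_i (qinit y i * qconj (qinit x i) - qinit x i * qconj (qinit y i))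
   - (qlast y * qconj (qlast x) - qlast x * qconj (qlast y))).
  rewrite /contact_form /qinit /qlast; congr (_ *: (_ - _)); last by rewrite !mxE e'.
  by apply: eq_bigr => i _; rewrite !mxE e'.
have h : 2^-1 + 2^-1 = 1 :> R by field.
by rewrite /trap_germ c1 c2 -scalerDl h scale1r.
Qed.

Lemma qstrat_trap_contact X : rsemimartingale P F X -> qstrat P F (trap_germ (@contact_form R n) X).
Proof.
move=> sX; have lS := strat_linear P hF.
apply: (qall_ext (trap_contact X)); apply: (qallZ lS); apply: (qallB lS).
  apply: (@qall_sum _ _ _ _ lS _ _ (fun i => qwedge (fun t o => qinit (X t o) i)) strat_germ0) => i.
  by apply: qstrat_wedge; apply: sX.
by apply: qstrat_wedge; apply: sX.
Qed.

Variable w : R -> Omega -> 'rV[quat R]_n.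
Hypothesis w1 : forall t o, 0 <= t -> rnormsq (w t o) < 1.
Hypothesis sw : rsemimartingale P F w.

Definition rho t o : R := (Num.sqrt (1 - rnormsq (w t o)))^-1.
(** Equal to [1 / rho] at times [t >= 0], but written as a product so that it is visibly a
    semimartingale. *)
Definition rhoinv t o : R := (1 - rnormsq (w t o)) * rho t o.
Definition wprod s t o : quat R := \sum_j w t o 0 j * qconj (w s o 0 j).
Definition wim s t o : quat R := 2^-1 *: (wprod s t o - qconj (wprod s t o)).
(** The trapezoid of the area form, in the shape of a mean times a Stratonovich germ; the agreement,
    [trap_area], is for nonnegative times, where [rho^2] is the inverse of [1 - |w|^2]. *)
Definition area_germ s t o : quat R := (2^-1 * (rho s o * rho s o + rho t o * rho t o)) *: wim s t o.
Definition lift (Phi : R -> Omega -> quat R) t o : 'rV[quat R]_(n + 1) :=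
  (rho t o *: Phi t o) *: row_mx (w t o) 1%:M.

Lemma rho_gt0 t o : 0 <= t -> 0 < rho t o.
Proof. by move=> t0; rewrite invr_gt0 sqrtr_gt0 subr_gt0 w1. Qed.

Lemma rho_sqr t o : 0 <= t -> rho t o * rho t o = (1 - rnormsq (w t o))^-1.
Proof. by move=> t0; rewrite -expr2 exprVn sqr_sqrtr// ltW// subr_gt0 w1. Qed.

Lemma rhoinvE t o : 0 <= t -> rhoinv t o = (rho t o)^-1.
Proof.
move=> t0; have r0 := rho_gt0 o t0; have u0 : 1 - rnormsq (w t o) != 0 by rewrite gt_eqF// subr_gt0 w1.
apply: (mulfI (lt0r_neq0 r0)).
by rewrite /rhoinv mulrCA rho_sqr// !divff// lt0r_neq0.
Qed.

Lemma semimartingale_rnormsq : semimartingale P F (fun t o => 1 - rnormsq (w t o)).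
Proof.
apply: (semimartingaleB hF (semimartingale_cst P hF 1)).
apply: (semimartingale_sum hF) => j; apply: (semimartingale_qnormsq hF); exact: sw.
Qed.

Lemma semimartingale_rho : semimartingale P F rho.
Proof. by apply: (semimartingale_invsqrt hF) semimartingale_rnormsq => t o t0; rewrite subr_gt0 w1. Qed.

Lemma semimartingale_rhoinv : semimartingale P F rhoinv.
Proof. exact: (semimartingaleM hF semimartingale_rnormsq semimartingale_rho). Qed.

Lemma wimE s t o : wim s t o = 2^-1 *: \sum_j qwedge (fun t o => w t o 0 j) s t o.
Proof.
rewrite /wim /wprod qconj_sum sumrB; congr (_ *: (_ - _)).
by apply: eq_bigr => j _; rewrite qconjM qconjK.
Qed.

Lemma qstrat_wim : qstrat P F wim.
Proof.
have lS := strat_linear P hF; apply: (qall_ext wimE); apply: (qallZ lS).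
apply: (@qall_sum _ _ _ _ lS _ _ (fun j => qwedge (fun t o => w t o 0 j)) strat_germ0) => j.
by apply: qstrat_wedge; apply: sw.
Qed.

Lemma qstrat_area : qstrat P F area_germ.
Proof.
move=> k; have sr := semimartingaleM hF semimartingale_rho semimartingale_rho.
apply: germ_ext (strat_mgerm hF sr (qstrat_wim k)) => s t o.
by rewrite /qcoord_germ /area_germ qcoordZ.
Qed.

Lemma qconj_wim s t o : qconj (wim s t o) = - wim s t o.
Proof. by rewrite /wim qconjZ qconjB qconjK -scalerN opprB. Qed.

Lemma qconj_area s t o : qconj (area_germ s t o) = - area_germ s t o.
Proof. by rewrite /area_germ qconjZ qconj_wim scalerN. Qed.

Lemma area_germ_diag t o : area_germ t t o = 0.
Proof. by rewrite /area_germ wimE big1 ?scaler0// => j _; rewrite /qwedge subrr. Qed.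

Lemma trap_area s t o : 0 <= s -> 0 <= t ->
  trap_germ (@area_form R n) w s t o = area_germ s t o.
Proof.
move=> s0 t0; rewrite /area_germ !rho_sqr// wimE /trap_germ /area_form -!scaler_sumr.
set a := (1 - rnormsq _)^-1; set b := (1 - rnormsq _)^-1.
have e1 : \sum_j ((w t o - w s o) 0 j * qconj (w s o 0 j) - w s o 0 j * qconj ((w t o - w s o) 0 j)) =
   \sum_j qwedge (fun t o => w t o 0 j) s t o.
  apply: eq_bigr => j _; rewrite !mxE /qwedge; move: (w t o 0 j) (w s o 0 j) => [? ? ? ?] [? ? ? ?].
  by rewrite !quatE /qmul /qadd /qconj /qopp /=; congr Quat; ring.
have e2 : \sum_j ((w t o - w s o) 0 j * qconj (w t o 0 j) - w t o 0 j * qconj ((w t o - w s o) 0 j)) =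
   \sum_j qwedge (fun t o => w t o 0 j) s t o.
  apply: eq_bigr => j _; rewrite !mxE /qwedge; move: (w t o 0 j) (w s o 0 j) => [? ? ? ?] [? ? ? ?].
  by rewrite !quatE /qmul /qadd /qconj /qopp /=; congr Quat; ring.
by rewrite e1 e2 !scalerA -scalerDl scalerA; congr (_ *: _); ring.
Qed.

Lemma qinit_lift Phi t o i : qinit (lift Phi t o) i = rho t o *: (Phi t o * w t o 0 i).
Proof. by rewrite /qinit /lift mxE row_mxEl scaler_quatAl. Qed.

Lemma qlast_lift Phi t o : qlast (lift Phi t o) = rho t o *: Phi t o.
Proof. by rewrite /qlast /lift mxE row_mxEr mxE eqxx mulr1. Qed.

Lemma rsemimartingale_lift Phi : qsemimartingale P F Phi -> rsemimartingale P F (lift Phi).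
Proof.
move=> sPhi j; rewrite -[j](@fintype.splitK n 1 j); case: (fintype.split j) => i /=.
  rewrite (_ : (fun _ _ => _) = fun t o => rho t o *: (Phi t o * w t o 0 i)).
    apply: (qsemimartingaleZ hF) semimartingale_rho _; apply: (qsemimartingaleM hF) => //; exact: sw.
  by apply/funext => t; apply/funext => o; exact: qinit_lift.
rewrite (_ : (fun _ _ => _) = fun t o => rho t o *: Phi t o).
  exact: (qsemimartingaleZ hF semimartingale_rho).
by apply/funext => t; apply/funext => o; rewrite -(qlast_lift Phi) (ord1 i).
Qed.

Lemma AdS_lift Phi t o : 0 <= t -> qnormsq (Phi t o) = 1 -> AdS (lift Phi t o).
Proof.
move=> t0 u; rewrite /AdS /= qlast_lift qnormsqZ u mulr1.
under eq_bigr do rewrite qinit_lift qnormsqZ qnormsqM u mul1r.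
rewrite -mulr_sumr -/(rnormsq _) expr2 rho_sqr//.
by field; rewrite gt_eqF// subr_gt0 w1.
Qed.

Lemma hyp_proj_lift Phi t o : 0 <= t -> qnormsq (Phi t o) = 1 -> hyp_proj (lift Phi t o) = w t o.
Proof.
move=> t0 u; apply/rowP => i; rewrite mxE qinit_lift qlast_lift -scaler_quatAl mulKr//.
apply: quat_unit; rewrite -qnormsq_eq0 qnormsqZ u mulr1 sqrf_eq0 gt_eqF//.
exact: rho_gt0.
Qed.

Lemma trap_contact_lift Phi s t o : trap_germ (@contact_form R n) (lift Phi) s t o =
  2^-1 *: ((rho s o * rho t o) *: (Phi t o * (wprod s t o - 1) * qconj (Phi s o) -
     qconj (Phi t o * (wprod s t o - 1) * qconj (Phi s o)))).
Proof.
rewrite trap_contact; congr (_ *: _).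
have e1 : \sum_i qwedge (fun t o => qinit (lift Phi t o) i) s t o =
  (rho s o * rho t o) *: (Phi t o * wprod s t o * qconj (Phi s o) - Phi s o * qconj (wprod s t o) * qconj (Phi t o)).
  rewrite /wprod qconj_sum !mulr_sumr !mulr_suml -sumrB scaler_sumr; apply: eq_bigr => i _.
  rewrite /qwedge !qinit_lift !qconjZ !qconjM qconjK scaler_quatAl scaler_quatAr scaler_quatAl scaler_quatAr.
  by rewrite !scalerA scalerBr [rho t o * _]mulrC !mulrA.
rewrite e1 /qwedge !qlast_lift !qconjZ !qconjM qconjK qconjB scaler_quatAl scaler_quatAr scaler_quatAl scaler_quatAr.
have -> : qconj (1 : quat R) = 1 by rewrite quatE /qconj /=; congr Quat; ring.
rewrite !mulrA !(mulrBl, mulrBr) !mulr1.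
by apply: quatP => k; rewrite !(qcoordD, qcoordN, qcoordZ); ring.
Qed.

(** Polarization, with [|w|^2 = 1 - rho^-2]. This is the premise on [qre W] in [contact_algebra],
    with [N] the squared length of the increment of [w]. *)
Lemma wprod_re s t o : 0 <= s -> 0 <= t ->
  qre (wprod s t o) = 1 - ((rho s o)^-1 ^+ 2 + (rho t o)^-1 ^+ 2 +
     \sum_j qnormsq (w t o 0 j - w s o 0 j)) / 2.
Proof.
move=> s0 t0; have rV t' : 0 <= t' -> (rho t' o)^-1 ^+ 2 = 1 - rnormsq (w t' o).
  by move=> t'0; rewrite exprVn expr2 rho_sqr// invrK.
rewrite !rV// /wprod -(qcoordE _).1.1.1 qcoord_sum (eq_bigr (fun j => 2^-1 * (qnormsq (w t o 0 j) + qnormsq (w s o 0 j)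
   - qnormsq (w t o 0 j - w s o 0 j)))); last by move=> j _; rewrite qcoordE qre_mul_conj.
by rewrite -mulr_sumr sumrB big_split /= -!/(rnormsq _); field.
Qed.

(* Up to negligible germs, the defect in d Phi = Phi o da. *)
Definition sde_germ (Phi : R -> Omega -> quat R) s t o : quat R :=
  qmid Phi s t o * area_germ s t o - qdelta Phi s t o.

Lemma qfirst_order_sde_germ Phi : qsemimartingale P F Phi -> qfirst_order P F (sde_germ Phi).
Proof.
move=> sPhi; apply: (qallB (first_order_linear P hF)); last exact: qfirst_order_delta.
apply: (qfirst_order_weightl hF (qweight_mid hF sPhi)).
exact: (qstrat_first_order hF qstrat_area).
Qed.

(** The sigma-algebras [F t] are not assumed to contain the null sets, so almost sure equality does
    not transport measurability; the adaptedness of [G] is a separate premise. *)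
Lemma qnegligible_ae (G H : R -> R -> Omega -> quat R) : qall (germ_adapted F) G -> qnegligible P F H ->
  {ae P, forall o, forall s t, 0 <= s -> s <= t -> G s t o = H s t o} -> qnegligible P F G.
Proof.
move=> aG nH GH k; have nd : negligible_germ P F (fun s t o => qcoord k (G s t o) + -1 * qcoord k (H s t o)).
  apply: negligible_ae.
    apply: (germ_adaptedD hF); first exact: aG.
    by apply: (germ_adaptedM hF); [exact: germ_adapted_cst|have [] := nH k].
  apply: filterS GH => o GH s t s0 st; rewrite GH//; ring.
apply: germ_ext (negligibleD hF nd (nH k)) => s t o; rewrite /qcoord_germ; ring.
Qed.

Lemma germ_adapted_of_first_order G : qfirst_order P F G -> qall (germ_adapted F) G.
Proof. by move=> fG k; have [] := fG k. Qed.

Lemma qnormsq_mid_delta (a b : quat R) : qnormsq (2^-1 *: (a + b)) + 4^-1 * qnormsq (b - a) = 2^-1 * (qnormsq a + qnormsq b).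
Proof. by rewrite !quatE /qnormsq /=; field. Qed.

Lemma contact_lift Phi X : qsemimartingale P F Phi -> rsemimartingale P F X ->
  {ae P, forall o, forall t, 0 <= t -> qnormsq (Phi t o) = 1 /\ X t o = lift Phi t o} ->
  qnegligible P F (fun s t o => trap_germ (@contact_form R n) X s t o
     - sde_germ Phi s t o * qconj (qmid Phi s t o)).
Proof.
move=> sPhi sX hPhi.
have lN := negligible_linear P hF; have lFO := first_order_linear P hF; have lW := weight_linear P hF.
have wM := qweight_mid hF sPhi; have wMc := qall_conj lW wM.
have fD := qfirst_order_delta hF sPhi; have fDc := qall_conj lFO fD.
have fB := qstrat_first_order hF qstrat_wim.
have frho := first_order_dgerm hF semimartingale_rho; have frhoi := first_order_dgerm hF semimartingale_rhoinv.
have sr := semimartingale_rho; have [ar cr _] := sr.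
have wrr : germ_weight P F (fun s t o => 4^-1 * (rho s o * rho t o)).
  apply: (weightM hF (weight_cst P hF _)); apply: (weightM hF); [exact: weight_left|exact: weight_right].
have fDM : qfirst_order P F (fun s t o => qdelta Phi s t o * qconj (qmid Phi s t o) - qmid Phi s t o * qconj (qdelta Phi s t o)).
  by apply: (qallB lFO); [exact: (qfirst_order_weightr hF wMc fD)|exact: (qfirst_order_weightl hF wM fDc)].
(* The corrections of [contact_algebra], arranged so that each term shows three first-order factors:
   increments of [rho], [rhoinv], [Phi] or the coordinates of [w], and the germ [wim]. *)
pose H s t o := - 2^-1 *: ((dgerm rho s t o * dgerm rho s t o) *: (qmid Phi s t o * wim s t o * qconj (qmid Phi s t o)))
   - (4^-1 * (rho s o * rho t o)) *: (qdelta Phi s t o * wim s t o * qconj (qdelta Phi s t o))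
   + 4^-1 *: ((dgerm rho s t o * dgerm rhoinv s t o) *: (qdelta Phi s t o * qconj (qmid Phi s t o) - qmid Phi s t o * qconj (qdelta Phi s t o)))
   - (4^-1 * (rho s o * rho t o)) *: (\sum_j \sum_k ((dgerm (fun t o => qcoord k (w t o 0 j)) s t o * dgerm (fun t o => qcoord k (w t o 0 j)) s t o) *:
       (qdelta Phi s t o * qconj (qmid Phi s t o) - qmid Phi s t o * qconj (qdelta Phi s t o)))).
have nH : qnegligible P F H.
  apply: (qallB lN); last first.
    apply: (qnegligible_scale wrr).
    pose E j k s t o := (dgerm (fun t o => qcoord k (w t o 0 j)) s t o * dgerm (fun t o => qcoord k (w t o 0 j)) s t o) *:
       (qdelta Phi s t o * qconj (qmid Phi s t o) - qmid Phi s t o * qconj (qdelta Phi s t o)).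
    have n0 : negligible_germ P F (fun _ _ _ => 0).
      by apply: negligible_ae (germ_adapted_cst hF 0) _; apply: aeW.
    apply: (@qall_sum _ _ _ _ lN _ _ (fun j s t o => \sum_k E j k s t o) n0) => j.
    apply: (@qall_sum _ _ _ _ lN _ _ (E j) n0) => k.
    have fw := first_order_dgerm hF (sw j k).
    exact: (qnegligible_scale2 hF fw fw fDM).
  apply: (qallD lN); last first.
    by apply: (qallZ lN); apply: (qnegligible_scale2 hF frho frhoi fDM).
  apply: (qallB lN); last first.
    by apply: (qnegligible_scale wrr); apply: (qnegligible3 hF).
  apply: (qallZ lN); apply: (qnegligible_scale2 hF frho frho).
  apply: (qfirst_order_weightr hF wMc); exact: (qfirst_order_weightl hF wM fB).
apply: (qnegligible_ae _ nH).
  apply: (qallB (germ_adapted_linear hF)).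
    exact/germ_adapted_of_first_order/(qstrat_first_order hF)/qstrat_trap_contact.
  apply/germ_adapted_of_first_order/(qfirst_order_weightr hF wMc); exact: qfirst_order_sde_germ.
apply: filterS hPhi => o hPhi s t s0 st; have t0 := le_trans s0 st.
have [us Xs] := hPhi s s0; have [ut Xt] := hPhi t t0.
have -> : trap_germ (@contact_form R n) X s t o = trap_germ (@contact_form R n) (lift Phi) s t o.
  by rewrite /trap_germ Xs Xt.
rewrite trap_contact_lift.
have := contact_algebra (Phi s o) (Phi t o) (lt0r_neq0 (rho_gt0 o s0)) (lt0r_neq0 (rho_gt0 o t0)) (wprod_re o s0 t0).
move=> /= ->; rewrite us ut subrr mulr0 scale0r addr0.
apply: (canLR (addrK _)); rewrite [RHS]addrC; congr (_ + _).
rewrite /H /dgerm !rhoinvE//; congr (_ - _ *: _).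
rewrite scaler_suml; apply: eq_bigr => j _; rewrite qnormsqE scaler_suml; apply: eq_bigr => k _.
by rewrite qcoordB expr2.
Qed.

End Lift.

(** * Continuous processes with negligible increments are constant *)

Section Uniqueness.
Context d (Omega : measurableType d) (R : realType) (P : probability Omega R).
Variable F : R -> set (set Omega).
Hypothesis hF : filtration F.

Section UniformPartition.
Variables (T : R) (T0 : 0 < T).

Let upt m i : R := (minn i m.+1)%:R / m.+1%:R * T.
Let upt0 m : upt m 0%N = 0. Proof. by rewrite /upt min0n !mul0r. Qed.
Let upt_lt m i : (i < m.+1)%N -> upt m i < upt m i.+1.
Proof.
move=> im; rewrite /upt (minn_idPl im) (minn_idPl (ltnW im)).
by rewrite ltr_pM2r// ltr_pM2r ?invr_gt0// ltr_nat.
Qed.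
Let upt_end m i : (m.+1 <= i)%N -> upt m i = T.
Proof. by move=> mi; rewrite /upt (minn_idPr mi) divff ?mul1r// pnatr_eq0. Qed.

Definition uniform_pseq : pseq T := Pseq upt0 upt_lt upt_end.

Lemma uniform_mesh0 : mesh0 uniform_pseq.
Proof.
move=> delta d0; have c0 : 0 < delta / T by rewrite divr_gt0.
near=> m => i; have [im|mi] := ltnP i m.+1; last by rewrite !(ppt_end (p := uniform_pseq)) ?subrr// leqW.
rewrite /= /upt (minn_idPl im) (minn_idPl (ltnW im)) -mulrBl -mulrBl -[i.+1%:R]natr1 [_ + 1]addrC addrK mul1r.
rewrite -ltr_pdivlMr//; near: m; exact: (near_infty_natSinv_lt (PosNum c0)).
Unshelve. all: by end_near. Qed.

End UniformPartition.

(** With weights 1 the complete sums telescope to [z T - z 0] for every partition, and a fixed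
    variable that is arbitrarily small in probability is almost surely 0. For [T = 0] no uniform
    partition into proper intervals exists, but nothing is to be shown. *)
Lemma constant_at z T : 0 <= T -> negligible_germ P F (dgerm z) ->
  {ae P, forall o, z T o = z 0 o}.
Proof.
rewrite le_eqVlt => /orP[/eqP <- _|T0 [_ nz]]; first exact: aeW.
have c1 := nz T _ (ltW T0) (uniform_mesh0 T0) _ (@arr_adapted_cst _ _ _ _ hF T _ 1) (tight_cst P 1).
have ho e : 0 < e -> outer_le P [set o | e <= `|z T o - z 0 o|] e.
  move=> e0; have [m _ /(_ m (leqnn m)) /=] := c1 e e0.
  apply: outer_leS => o /= h; exists m.+1; rewrite /psum.
  rewrite (@eq_big_nat _ _ _ _ _ _ (fun i => z (uniform_pseq T0 m i.+1) o - z (uniform_pseq T0 m i) o)); last first.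
    by move=> i _; rewrite mul1r.
  by rewrite telescope_sumr// (ppt_end (p := uniform_pseq T0))// ppt0.
have : P.-negligible (\bigcup_k [set o | k.+1%:R^-1 <= `|z T o - z 0 o|]).
  apply: negligible_bigcup => k; apply: outer_le_negligible => e e0.
  have m0 : 0 < Num.min e k.+1%:R^-1 by rewrite lt_min e0 invr_gt0 ltr0n.
  apply: (@outer_leW _ _ _ _ _ (Num.min e k.+1%:R^-1)); first by rewrite ge_min lexx.
  apply: outer_leS (ho _ m0) => o /=; apply: le_trans.
  by rewrite ge_min lexx orbT.
apply: negligibleS => o /= zo; have d0 : 0 < `|z T o - z 0 o|.
  by rewrite normr_gt0 subr_eq0; apply/eqP.
have [k _ /(_ k (leqnn k)) h] := near_infty_natSinv_lt (PosNum d0).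
by exists k => //=; apply: ltW.
Qed.

(** The null set may depend on the time; a common one is obtained for the countably many times
    [i / (j + 1)], and continuity of the paths reaches the others. *)
Lemma constant_paths z : continuous_paths z -> negligible_germ P F (dgerm z) ->
  {ae P, forall o, forall t, 0 <= t -> z t o = z 0 o}.
Proof.
move=> cz nz; have h (i j : nat) : {ae P, forall o, z (i%:R / j.+1%:R) o = z 0 o}.
  by apply: constant_at => //; rewrite divr_ge0.
have : {ae P, forall o, forall i j : nat, z (i%:R / j.+1%:R) o = z 0 o}.
  by apply: ae_foralln => i; apply: ae_foralln => j; apply: h.
apply: filterS => o ho t t0; apply/eqP; rewrite -subr_eq0 -normr_le0 leNgt; apply/negP => e0.
have /within_continuousP /(_ t _ t0 e0) [delta d0 hd] := cz o.
have [j _ /(_ j (leqnn j)) /= hj] := near_infty_natSinv_lt (PosNum d0).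
have s0 : 0 <= t * j.+1%:R by rewrite mulr_ge0.
have /andP[i1 i2] := truncn_itv s0.
have := hd ((Num.trunc (t * j.+1%:R))%:R / j.+1%:R); rewrite ho ltxx => h'.
suff : false by []; apply: h'; first by rewrite divr_ge0.
have j0 : 0 < j.+1%:R :> R by [].
have le1 : (Num.trunc (t * j.+1%:R))%:R / j.+1%:R <= t by rewrite ler_pdivrMr.
rewrite ger0_norm ?subr_ge0// (lt_trans _ hj)// ltrBlDl -(ltr_pM2r j0) mulrDl mulfVK ?gt_eqF//.
by rewrite mulVf ?gt_eqF// natr1.
Qed.

End Uniqueness.

(** * Existence and uniqueness of the horizontal lift *)

Section HorizontalLift.
Context d (Omega : measurableType d) (R : realType) (P : probability Omega R).
Variable F : R -> set (set Omega).
Hypothesis hF : filtration F.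
Variables (n : nat) (w : R -> Omega -> 'rV[quat R]_n).
Hypothesis w1 : forall t o, 0 <= t -> rnormsq (w t o) < 1.
Hypothesis sw : rsemimartingale P F w.

Lemma area_negligible a : stochastic_area P F w a ->
  qnegligible P F (fun s t o => area_germ w s t o - qdelta a s t o).
Proof.
move=> [aa _ Ia] k; have sA := qstrat_area hF w1 sw k.
have aA : germ_adapted F (qcoord_germ k (area_germ w)) by case: (strat_first_order hF sA).
have tE l s t o : 0 <= s -> s <= t -> qcoord_germ l (trap_germ (@area_form R n) w) s t o = qcoord_germ l (area_germ w) s t o.
  by move=> s0 st; rewrite /qcoord_germ trap_area//; apply: le_trans st.
have aT l : germ_adapted F (qcoord_germ l (trap_germ (@area_form R n) w)).
  move=> s t s0 st; rewrite (funext (fun o => tE l s t o s0 st)).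
  by have [+ _] := strat_first_order hF (qstrat_area hF w1 sw l); apply.
have sT := stratonovich_sums_to hF aT aa Ia k.
have sG : sums_to P (qcoord_germ k (area_germ w)) (qcoord_proc k a).
  apply: (sums_to_negligible hF) sT; apply: negligible_ae.
    by apply: germ_ext (germ_adaptedD hF aA (germ_adaptedM hF (germ_adapted_cst hF (-1)) (aT k))) => s t o; rewrite mulN1r.
  by apply: aeW => o s t s0 st; rewrite tE// subrr.
have d0 t o : qcoord_germ k (area_germ w) t t o = 0 by rewrite /qcoord_germ area_germ_diag qcoord0.
have := sewing hF aA (aa k) d0 (strat_coherent hF sA) sG.
by apply: germ_ext => s t o; rewrite /qcoord_germ !qcoordB.
Qed.

(** Sewing requires a coherent germ, and [a] comes only as an adapted continuous process, so
    [qmid Theta * qdelta a] does not have the base form. By [area_negligible], [qdelta a] may be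
    exchanged for [area_germ], which is built from semimartingales. *)
Lemma sde_negligible a Theta : stochastic_area P F w a -> SU2_sde_solution P F a Theta ->
  qnegligible P F (sde_germ w Theta).
Proof.
move=> ha [sT _ _ IT] k; have [aa _ _] := ha.
have sMA := qstrat_midl hF sT (qstrat_area hF w1 sw).
pose X := fun t o => (Theta t o, a t o); pose S := fun t o => Theta t o - Theta 0 o.
pose beta (x u : (quat R * quat R)%type) := x.1 * u.2.
have tE s t o : trap_germ beta X s t o = qmid Theta s t o * qdelta a s t o.
  by rewrite /trap_germ /qmid /qdelta /beta /X /= -mulrDl scaler_quatAl.
have lA := germ_adapted_linear hF.
have aT : qall (germ_adapted F) (trap_germ beta X).
  apply: (qall_ext tE); apply: (qallM lA) => l m; apply: (germ_adaptedM hF).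
    by have [h _ _] := qweight_mid hF sT l; exact: h.
  have := germ_adaptedD hF (germ_adapted_right (aa m)) (germ_adaptedM hF (germ_adapted_cst hF (-1)) (germ_adapted_left hF (aa m))).
  by apply: germ_ext => s t o; rewrite qcoordB mulN1r.
have aTheta l : adapted F (fun t o => qcoord l (Theta t o)) by case: (sT l).
have aS : qadapted F S.
  move=> l t t0; have s := filtration_sigma hF t0.
  under eq_fun do rewrite qcoordB.
  apply: (sub_measurableB s); first exact: aTheta.
  exact: (sub_measurable_mono hF (lexx 0) t0 (aTheta l 0 (lexx 0))).
have sums := stratonovich_sums_to hF aT aS IT k.
have nd : qnegligible P F (fun s t o => qmid Theta s t o * (area_germ w s t o - qdelta a s t o)).
  exact: (qnegligible_weightl hF (qweight_mid hF sT) (area_negligible ha)).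
have sG : sums_to P (qcoord_germ k (fun s t o => qmid Theta s t o * area_germ w s t o)) (qcoord_proc k S).
  apply: (sums_to_negligible hF) sums; apply: germ_ext (nd k) => s t o.
  by rewrite /qcoord_germ tE [in RHS]mulrBr qcoordB.
have aG : germ_adapted F (qcoord_germ k (fun s t o => qmid Theta s t o * area_germ w s t o)).
  by case: (strat_first_order hF (sMA k)).
have d0 t o : qcoord_germ k (fun s t o => qmid Theta s t o * area_germ w s t o) t t o = 0.
  by rewrite /qcoord_germ area_germ_diag mulr0 qcoord0.
have := sewing hF aG (aS k) d0 (strat_coherent hF (sMA k)) sG.
by apply: germ_ext => s t o; rewrite /qcoord_germ /sde_germ /dgerm /qcoord_proc /S /qdelta !qcoordB; ring.
Qed.

Lemma lift_horizontal a Theta : stochastic_area P F w a -> SU2_sde_solution P F a Theta ->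
  {ae P, forall o, w 0 o = 0} -> horizontal_lift P F w (lift w Theta).
Proof.
move=> ha hT w0; have [sT uT T0 _] := hT; have nT := sde_negligible ha hT.
have sX := rsemimartingale_lift hF w1 sw sT; split => //.
- by move=> t o t0; apply: AdS_lift => //; apply: uT.
- apply: filterS (filterI w0 T0) => o [wo To].
  rewrite /lift /rho wo To /rnormsq big1 => [|j _]; last by rewrite mxE /qnormsq /= expr0n !addr0.
  by rewrite subr0 sqrtr1 invr1 !scale1r.
- by apply: aeW => o t t0; apply: hyp_proj_lift => //; apply: uT.
- have fX := qstrat_trap_contact hF sX.
  have lN := negligible_linear P hF.
  have n1 : qnegligible P F (fun s t o => trap_germ (@contact_form R n) (lift w Theta) s t o
     - sde_germ w Theta s t o * qconj (qmid Theta s t o)).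
    by apply: (contact_lift hF w1 sw sT sX); apply: aeW => o t t0; split=> //; apply: uT.
  have n2 := qnegligible_weightr hF (qall_conj (weight_linear P hF) (qweight_mid hF sT)) nT.
  have n3 : qnegligible P F (trap_germ (@contact_form R n) (lift w Theta)).
    by apply: (qall_ext _ (qallD lN n1 n2)) => s t o; rewrite subrK.
  apply: (sums_to_stratonovich hF).
  + exact: germ_adapted_of_first_order (qstrat_first_order hF fX).
  + by move=> k t t0; rewrite qcoord0; apply: sub_measurable_cst; apply: (filtration_sigma hF t0).
  + move=> k; have := negligible_sums_to hF (n3 k).
    rewrite (_ : (fun _ _ => 0) = qcoord_proc k (fun _ _ => 0))//.
    by apply/funext => t; apply/funext => o; rewrite /qcoord_proc qcoord0.
Qed.

(** A zero last coordinate would make a sum of squares equal to -1. Otherwise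
    [|q_i| = |q_(n+1)| |w_i|] turns the equation of the quadric into the second claim. *)
Lemma AdS_qlast (q : 'rV[quat R]_(n + 1)) : AdS q ->
  qlast q != 0 /\ qnormsq (qlast q) * (1 - rnormsq (hyp_proj q)) = 1.
Proof.
move=> qA; have q0 : qlast q != 0.
  apply/eqP => q0; move: qA; rewrite /AdS /= q0 => e.
  have s0 : 0 <= \sum_i qnormsq (qinit q i) by apply: sumr_ge0 => i _; exact: qnormsq_ge0.
  have z0 : qnormsq (0 : quat R) = 0 by apply/eqP; rewrite qnormsq_eq0.
  by move: e; rewrite z0; lra.
split=> //; have e : \sum_i qnormsq (qinit q i) = qnormsq (qlast q) * rnormsq (hyp_proj q).
  rewrite /rnormsq mulr_sumr; apply: eq_bigr => i _.
  by rewrite mxE -qnormsqM mulrA mulrV ?mul1r.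
by move: qA; rewrite /AdS /= e mulrBr mulr1; lra.
Qed.

Lemma row_mx_hyp_proj (q : 'rV[quat R]_(n + 1)) : qlast q != 0 ->
  q = qlast q *: row_mx (hyp_proj q) 1%:M.
Proof.
move=> q0; apply/rowP => j; rewrite -[j](@fintype.splitK n 1 j); case: (fintype.split j) => i /=.
  by rewrite mxE row_mxEl mxE mulrA mulrV ?mul1r.
by rewrite mxE row_mxEr mxE (ord1 i) eqxx mulr1.
Qed.

Lemma lift_unique a Theta Y : stochastic_area P F w a -> SU2_sde_solution P F a Theta ->
  {ae P, forall o, w 0 o = 0} -> horizontal_lift P F w Y ->
  {ae P, forall o, forall t, 0 <= t -> Y t o = lift w Theta t o}.
Proof.
move=> ha hT w0 [sY AY Y0 pY IY]; have [sT uT T0 _] := hT; have nT := sde_negligible ha hT.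
have lN := negligible_linear P hF; have lW := weight_linear P hF.
(* The angular part of [Y]: on the quadric over [w] the last coordinate has norm [rho], so dividing
   by [rho] leaves a unit quaternion, and [Y] is the lift built from it. *)
pose Phi t o := rhoinv w t o *: qlast (Y t o).
have sPhi : qsemimartingale P F Phi.
  by apply: (qsemimartingaleZ hF) (semimartingale_rhoinv hF w1 sw) _; apply: sY.
have hPhi : {ae P, forall o, forall t, 0 <= t -> qnormsq (Phi t o) = 1 /\ Y t o = lift w Phi t o}.
  apply: filterS pY => o pY t t0; have [q0 qn] := AdS_qlast (AY t o t0).
  rewrite pY// in qn; have r0 := rho_gt0 w1 o t0.
  split; first by rewrite /Phi qnormsqZ rhoinvE// exprVn expr2 rho_sqr// invrK mulrC.
  rewrite /lift /Phi rhoinvE// scalerA divff ?scale1r ?lt0r_neq0// -[in row_mx _ _](pY t t0).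
  exact: row_mx_hyp_proj.
have nY : qnegligible P F (trap_germ (@contact_form R n) Y).
  move=> k; have sG := qstrat_trap_contact hF sY.
  have aG := germ_adapted_of_first_order (qstrat_first_order hF sG).
  have a0 : qadapted F (fun _ _ => 0).
    by move=> l t t0; rewrite qcoord0; apply: sub_measurable_cst; apply: (filtration_sigma hF t0).
  have sums := stratonovich_sums_to hF aG a0 IY k.
  have d0 t o : qcoord_germ k (trap_germ (@contact_form R n) Y) t t o = 0.
    rewrite /qcoord_germ trap_contact big1 => [|i _]; last by rewrite /qwedge subrr.
    by rewrite /qwedge subrr subrr scaler0 qcoord0.
  have := sewing hF (aG k) (a0 k) d0 (strat_coherent hF (sG k)) sums.
  by apply: germ_ext => s t o; rewrite /dgerm /qcoord_proc subrr subr0.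
have wM := qweight_mid hF sPhi; have wMc := qall_conj lW wM.
have n1 : qnegligible P F (fun s t o => sde_germ w Phi s t o * qconj (qmid Phi s t o)).
  apply: (qall_ext _ (qallB lN nY (contact_lift hF w1 sw sPhi sY hPhi))) => s t o.
  by rewrite opprB addrC subrK.
have n2 := qnegligible_weightr hF wM n1.
have fE := qfirst_order_sde_germ hF w1 sw sPhi.
have fD := qfirst_order_delta hF sPhi.
have n0 : negligible_germ P F (fun _ _ _ => 0).
  by apply: negligible_ae (germ_adapted_cst hF 0) _; apply: aeW.
(* This is [|D|^2 E], with [E] the defect germ. In the next claim, [|M|^2 + |D|^2 / 4 = 1] recovers
   [E] as the sum of [E conj(M) M] and a quarter of it. *)
have n3 : qnegligible P F (fun s t o => \sum_k (qcoord_germ k (qdelta Phi) s t o * qcoord_germ k (qdelta Phi) s t o) *: sde_germ w Phi s t o).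
  apply: (@qall_sum _ _ _ _ lN _ _ (fun k s t o => (qcoord_germ k (qdelta Phi) s t o * qcoord_germ k (qdelta Phi) s t o) *: sde_germ w Phi s t o) n0) => k.
  exact: (qnegligible_scale2 hF (fD k) (fD k) fE).
have nPhi : qnegligible P F (sde_germ w Phi).
  apply: (qnegligible_ae hF (germ_adapted_of_first_order fE) (qallD lN n2 (qallZ lN 4^-1 n3))).
  apply: filterS hPhi => o hPhi s t s0 st.
  have [us _] := hPhi s s0; have [ut _] := hPhi t (le_trans s0 st).
  have := qnormsq_mid_delta (Phi s o) (Phi t o); rewrite us ut.
  rewrite -scaler_suml -mulrA; under [X in _ + _ *: (X *: _)]eq_bigr do rewrite -expr2.
  rewrite -qnormsqE.
  have -> : qconj (qmid Phi s t o) * qmid Phi s t o = qnormsq (qmid Phi s t o) *: qone R.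
    by rewrite !quatE /qmul /qconj /qscale /qnormsq /=; congr Quat; ring.
  rewrite scaler_quatAr -qoneE mulr1 scalerA -scalerDl -/(qmid Phi s t o) -/(qdelta Phi s t o) => ->.
  by rewrite (_ : 2^-1 * (1 + 1) = 1) ?scale1r//; field.
pose Thc t o := qconj (Theta t o).
have sThc : qsemimartingale P F Thc := qsemimartingale_conj hF sT.
pose U t o := Phi t o * Thc t o.
(* The discrete product rule with means is exact. Writing [E] for the two defect germs, [d(Phi
   conj(Theta)) = - (E_Phi conj(M_Theta) + M_Phi conj(E_Theta))], since the two terms with the area
   germ [A] cancel by [conj(A) = -A]. *)
have nU : qnegligible P F (qdelta U).
  have m1 := qnegligible_weightr hF (qweight_mid hF sThc) nPhi.
  have m2 := qnegligible_weightl hF wM (qall_conj lN nT).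
  apply: (qall_ext _ (qallN lN (qallD lN m1 m2))) => s t o.
  rewrite /sde_germ qconjB qconjM qconj_area /U /qdelta /qmid /Thc qconjZ qconjB qconjD.
  move: (Phi s o) (Phi t o) (qconj (Theta s o)) (qconj (Theta t o)) (area_germ w s t o) => x y c e f.
  rewrite !(mulrDl, mulrDr, mulrBl, mulrBr, mulNr, mulrN, scaler_quatAl, scaler_quatAr) !mulrA.
  by apply: quatP => k; rewrite !(qcoordD, qcoordN, qcoordZ); field.
have cU : {ae P, forall o, forall k t, 0 <= t -> qcoord k (U t o) = qcoord k (U 0 o)}.
  have hk k : {ae P, forall o, forall t, 0 <= t -> qcoord k (U t o) = qcoord k (U 0 o)}.
    apply: (constant_paths hF (z := fun t o => qcoord k (U t o))).
      by have [_ + _] := qsemimartingaleM hF sPhi sThc k; apply.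
    by apply: germ_ext (nU k) => s t o; rewrite /qcoord_germ qcoordB.
  apply: filterS (filterI (filterI (hk (inord 0)) (hk (inord 1))) (filterI (hk (inord 2)) (hk (inord 3)))).
  by move=> o [[h0 h1] [h2 h3]]; elim/qcoordP.
apply: filterS (filterI (filterI cU hPhi) (filterI (filterI w0 T0) Y0)) => o [[cUo hPhio] [[w0o T0o] Y0o]] t t0.
have [uPhi ->] := hPhio t t0; rewrite /lift; congr (_ *: _); congr (_ *: _).
have U0 : U 0 o = 1.
  rewrite /U /Phi /Thc Y0o T0o rhoinvE// /rho w0o.
  have -> : rnormsq (0 : 'rV[quat R]_n) = 0.
    by rewrite /rnormsq big1 => // j _; rewrite mxE /qnormsq /= expr0n !addr0.
  rewrite subr0 sqrtr1 !invr1 scale1r /qlast /north_pole row_mxEr mxE eqxx mul1r.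
  by rewrite quatE /qconj /=; congr Quat; ring.
have Ut : U t o = 1 by rewrite -U0; apply: quatP => k; apply: cUo.
have Tc : Thc t o * Theta t o = 1.
  have := uT t o t0; rewrite /Thc; move: (Theta t o) => [a0 a1 a2 a3]; rewrite /qnormsq !quatE /qmul /qconj /qone /= => e.
  by congr Quat; [rewrite -e|..]; ring.
(* [Phi = Phi (conj(Theta) Theta) = U Theta = Theta]. *)
by rewrite -[Phi t o]mulr1 -Tc mulrA -/(U t o) Ut mul1r.
Qed.

End HorizontalLift.
Theorem theorem3p2 (R : realType) (n : nat) (hn : (0 < n)%N)
    (d : measure_display) (Omega : measurableType d) (P : probability Omega R)
    (F : R -> set (set Omega)) (hF : filtration F)
    (w : R -> Omega -> 'rV[quat R]_n)
    (hw : brownian_motion_HH P F w)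
    (hw0 : {ae P, forall omega, w 0 omega = 0})
    (a : R -> Omega -> quat R) (ha : stochastic_area P F w a)
    (Theta : R -> Omega -> quat R) (hTheta : SU2_sde_solution P F a Theta) :
  is_the_horizontal_lift P F w
    (fun t omega =>
       ((Num.sqrt (1 - rnormsq (w t omega)))^-1 *: Theta t omega)
         *: row_mx (w t omega) 1%:M).
Proof.
have [w1 sw _] := hw; split; first exact: (lift_horizontal hF w1 sw ha hTheta hw0).
by move=> Y hY; apply: (lift_unique hF w1 sw ha hTheta hw0 hY).
Qed.
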